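(* Let $\alpha>0$, and write $[\alpha]$ for the integer part of $\alpha$. Consider the setting of the context, and suppose that the linear isometry $T:\mathbb{H}=L^2([a,b])\to\mathbb{H}'=L^2([a',b'])$ is given by $Tg=\sigma\times g\circ\tau$, where $\sigma$ is non-negative and $[\alpha]+1$ times continuously differentiable on $[a',b']$, and $\tau:[a',b']\to[a,b]$ is $[\alpha]+1$ times continuously differentiable with a non-vanishing first derivative. Then there exist positive constants $C_1$ and $C_2$ such that for all $C>0$ $$\mathcal{C}(\alpha,C_1C)\subset\tilde{\mathcal{C}}(\alpha,C)\subset\mathcal{C}(\alpha,C_2C).$$
   Context: Setting. $a<b$; $\{\pi_t,\ t\in[a,b]\}$ is a collection of probability densities with respect to a measure $\zeta$ on a measurable space $(\mathrm{X},\mathcal{X})$. There is a sequence $(g_k)_{k\ge1}$ of functions $\mathrm{X}\to\mathbb{R}$ such that $\varphi_k(t)=\int g_k(x)\pi_t(x)\,\zeta(dx)$, $k\ge1$, are linearly independent functions in $\mathbb{H}=L^2([a,b])$ with dense linear span. There are reals $a'<b'$ and a linear isometry $T$ from $\mathbb{H}$ onto $\mathbb{H}'=L^2([a',b'])$ such that, for all $k\ge1$, $T\varphi_k$ is a polynomial of degree $k-1$. Approximation class. $V_m=\mathrm{span}(\varphi_1,\dots,\varphi_m)$, $P_{V_m}$ is the orthogonal projection of $\mathbb{H}$ onto $V_m$, and $$\mathcal{C}(\alpha,C)=\{f\in\mathbb{H}:\|f\|_{\mathbb{H}}\le C\text{ and }\|P_{V_m}f-f\|_{\mathbb{H}}\le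 C\,m^{-\alpha}\text{ for all }m\ge1\}.$$ Smoothness class. For $r\in\mathbb{N}^*$, $h\in\mathbb{R}$ and $f:[a,b]\to\mathbb{R}$, let $\Delta_h^r(f,x)=\sum_{i=0}^r\binom{r}{i}(-1)^if(x+(i-r/2)h)$, with the convention $\Delta_h^r(f,x)=0$ if $x+rh/2\notin[a,b]$ or $x-rh/2\notin[a,b]$. Let $\varphi(x)=\sqrt{(x-a)(b-x)}$ and $$\omega_\varphi^r(f,t)_2=\sup_{0<h\le t}\left\|x\mapsto\Delta^r_{h\varphi(x)}(f,x)\right\|_{L^2([a,b])}.$$ With $r=[\alpha]+1$, $$\tilde{\mathcal{C}}(\alpha,C)=\{f\in\mathbb{H}:\|f\|_{\mathbb{H}}\le C\text{ and }\omega_\varphi^r(f,t)_2\le Ct^\alpha\text{ for all }t>0\}.$$ *)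

(* Defs.v *)
(* MathComp / MathComp-Analysis *)
From HB Require Import structures.
From mathcomp Require Import all_boot all_order all_algebra.
From mathcomp Require Import all_classical all_reals all_analysis.

Set Implicit Arguments.
Unset Strict Implicit.
Unset Printing Implicit Defensive.
Import Order.TTheory GRing.Theory Num.Theory.
Import numFieldNormedType.Exports.
Local Open Scope classical_set_scope.
Local Open Scope ring_scope.

Definition lebesgue_on {R : realType} (a b : R) :
    {measure set (measurableTypeR R) -> \bar R} :=
  mrestr (@lebesgue_measure R) (measurable_itv `[a, b]).

Lemma le1_2 (R : realType) : (1%:E <= 2%:E :> \bar R)%E.
Proof. by rewrite lee_fin ler1n. Qed.

(* L^2([a, b]) is handled through its representatives: square-integrable Borel
   functions, whose values outside [a, b] are irrelevant.  Equality in L^2 is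
   almost-everywhere equality for [lebesgue_on a b]; it is never Leibniz
   equality of representatives in what follows. *)
Notation L2 a b := (LfunType (lebesgue_on a b) (le1_2 _)).

Section L2.
Context {R : realType} (a b : R).

Definition L2norm (f : R -> R) : \bar R :=
  ('N[lebesgue_on a b]_2%:E[EFin \o f])%E.

Definition L2inner (f g : R -> R) : R :=
  Rintegral (lebesgue_on a b) setT (fun x => f x * g x).

Definition lincomb (phi : nat -> L2 a b) (m : nat) (c : nat -> R) : L2 a b :=
  \sum_(k < m) c k *: phi k.

Definition L2free (phi : nat -> L2 a b) : Prop :=
  forall m (c : nat -> R),
    lincomb phi m c = (0 : L2 a b) %[ae lebesgue_on a b] ->
    forall k, (k < m)%N -> c k = 0.

Definition L2total (phi : nat -> L2 a b) : Prop :=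
  forall (f : L2 a b) (e : R), 0 < e ->
    exists m c, (L2norm (lincomb phi m c - f)%R < e%:E)%E.

(* Sequences are indexed from 0: the span of the first m terms. *)
Definition spanL2 (phi : nat -> L2 a b) (m : nat) : set (L2 a b) :=
  [set v | exists c : nat -> R, v = lincomb phi m c].

(* For V finite dimensional such a p exists and is unique almost everywhere,
   so the default value 0 is not used. *)
Definition orthproj (V : set (L2 a b)) (f : L2 a b) : L2 a b :=
  xget 0 [set p | V p /\ forall v, V v -> L2inner (f - p) v = 0].

Definition approx_class (phi : nat -> L2 a b) (alpha C : R) : set (L2 a b) :=
  [set f : L2 a b | (L2norm f <= C%:E)%E /\
    forall m : nat, (1 <= m)%N ->
      (L2norm (orthproj (spanL2 phi m) f - f)%R
         <= (C * m%:R `^ (- alpha))%:E)%E].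

Definition sym_diff (r : nat) (h : R) (f : R -> R) (x : R) : R :=
  if (x + r%:R * h / 2 \in `[a, b]) && (x - r%:R * h / 2 \in `[a, b])
  then \sum_(i < r.+1) 'C(r, i)%:R * (-1) ^+ i * f (x + (i%:R - r%:R / 2) * h)
  else 0.

Definition step_weight (x : R) : R := Num.sqrt ((x - a) * (b - x)).

(* For fixed h, sending x to x + c h step_weight x pulls null sets back to null
   sets, hence the modulus depends only on the almost-everywhere class of f. *)
Definition modulus (r : nat) (f : R -> R) (t : R) : \bar R :=
  ereal_sup [set L2norm (fun x => sym_diff r (h * step_weight x) f x)
            | h in [set h : R | 0 < h <= t]].

Definition intpart (alpha : R) : nat := Num.truncn alpha.

Definition smooth_class (alpha C : R) : set (L2 a b) :=
  [set f : L2 a b | (L2norm f <= C%:E)%E /\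
    forall t : R, 0 < t ->
      (modulus (intpart alpha).+1 f t <= (C * t `^ alpha)%:E)%E].

(* Differentiability on [a, b] is relative to [a, b], hence one-sided at the
   endpoints; nothing is required of f outside [a, b]. *)
Definition has_derivative_on (f df : R -> R) : Prop :=
  forall x, x \in `[a, b] ->
    (f y - f x) / (y - x) @[y --> within `[a, b] (dnbhs x)] --> df x.

Fixpoint Cn_on (n : nat) (f : R -> R) : Prop :=
  match n with
  | 0 => {within `[a, b], continuous f}
  | n'.+1 => exists df, has_derivative_on f df /\ Cn_on n' df
  end.

End L2.

(* T acts on representatives.  Linearity and norm preservation imply that it
   respects almost-everywhere equality, so it induces a map on L^2. *)
Definition linear_isometry_onto {R : realType} (a b a' b' : R)
    (T : L2 a b -> L2 a' b') : Prop :=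
  [/\ forall (c : R) (f g : L2 a b),
        T (c *: f + g) = (c *: T f + T g : L2 a' b')
          %[ae lebesgue_on a' b'],
      forall f : L2 a b, L2norm a' b' (T f) = L2norm a b f &
      forall h : L2 a' b', exists f : L2 a b,
        T f = h %[ae lebesgue_on a' b']].

Definition is_density {R : realType} {d : measure_display}
    {X : measurableType d} (zeta : {measure set X -> \bar R}) (p : X -> R) :
    Prop :=
  [/\ measurable_fun setT p, forall x, 0 <= p x &
      (\int[zeta]_x (p x)%:E = 1)%E].

(* Main.v *)
(* T identifies V_m isometrically with the polynomials of degree < m on [a', b'], so
   C(alpha, _) says that the L^2 distance E_m(T f) from T f to these polynomials is
   O(m^-alpha). For a polynomial Q of degree < n, Bernstein's inequality bounds the
   weighted r-th derivative of sigma * (Q o tau) by a multiple of n^r |Q|, hence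
   E_N(sigma * (Q o tau)) = O((n / N)^r |Q|) by Jackson's inequality; summing over dyadic
   differences of near-best polynomials, T preserves rates m^-alpha with alpha < r. So does
   its inverse, which has the same form because T being isometric and onto forces
   sigma > 0 and tau onto [a, b].

   It remains to compare E_m(f) = O(m^-alpha) with omega(f, t) = O(t^alpha) on [a, b]. One
   direction is again a dyadic sum. For the other, write 1 = (b - y)^M G + (y - a)^M G' with
   polynomials G, G'; by reflection only (b - y)^M G f matters. There f is replaced by
   averages over z of the values f(y + i * d(y) * z), 1 <= i <= r, where d(y) =
   c t sqrt(y - a + t^2) (b - y): the error is a mean of r-th differences, and the weighted
   k-th derivative of the averages is O(t^-k |f|) for every k, whence
   E_N(f) <= K (omega(f, t) + (N t)^-k |f|). Applied to f - P with P of much smaller degree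
   and k large, this closes an induction on N = 2^j. *)

Require Import Defs.
From HB Require Import structures.
From mathcomp Require Import all_boot all_order all_algebra.
From mathcomp Require Import all_classical all_reals all_analysis.
From mathcomp Require Import measurable_realfun.
From mathcomp Require Import ring lra zify.
Import Order.TTheory GRing.Theory Num.Theory.
Import numFieldNormedType.Exports.
Local Open Scope classical_set_scope.
Local Open Scope ring_scope.
Set Implicit Arguments.
Unset Strict Implicit.
Unset Printing Implicit Defensive.

(** * Quantitative L2 bounds *)

(** Three points shape the proof. The maps x + c phi(x) and y + i d(y) z have to be substituted
    under integrals, and the derivative of phi = [step_weight] is infinite at the endpoints. Only
    inequalities are needed, and they follow from expansion alone, k |x - y| <= |psi x - psi y|, so
    no substitution involves a Jacobian. The averages must be differentiable k times, uniformly in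
    t. The t^2 under the root keeps d regular at a, and the factor b - y keeps the averages inside
    [a, b]. Each derivative costs 1 / d(y), and its singularity at b is paid for by one factor of (b
    - y)^M: this is why the two endpoints are treated separately. The averages are formed for
    polynomials only, where they are finite sums of Taylor moments; density extends the result to
    all f. Bernstein's and Jackson's inequalities are both read off the eigenvalues of one Jacobi
    operator. The density of polynomials comes from the totality of [phi], carried to [a', b'] by T
    and then to [a, b] by an affine map. *)

Section expanding.
Context {R : realType}.
Notation mu := (@lebesgue_measure R).

Lemma lebesgue_diam (S : set R) (d : R) : 0 <= d -> measurable S ->
  (forall x y, S x -> S y -> `|x - y| <= d) -> (mu S <= d%:E)%E.
Proof.
move=> d0 mS Sd; have [->|/set0P[x0 Sx0]] := eqVneq S set0.
  by rewrite measure0 lee_fin.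
have hlb : has_lbound S.
  exists (x0 - d) => y Sy; have := Sd _ _ Sx0 Sy; rewrite ler_norml; lra.
have S0 : S !=set0 by exists x0.
have sub : S `<=` `[inf S, inf S + d].
  move=> y Sy; rewrite /= in_itv/= ge_inf//= -lerBlDr.
  apply: lb_le_inf => // z Sz; have := Sd _ _ Sy Sz; rewrite ler_norml; lra.
apply: (@le_trans _ _ (mu `[inf S, inf S + d])).
  by apply: le_measure; rewrite ?inE.
rewrite lebesgue_measure_itv/= lte_fin; case: ifP => _.
  by rewrite EFinN -EFinD lee_fin; lra.
by rewrite lee_fin.
Qed.

(** Cover [A] by open intervals of total length at most [mu A + e]: the part of [D] mapped into an
    interval of length l has diameter at most l / k, hence measure at most l / k. *)
Lemma expanding_measure (D : set R) (psi : R -> R) (k : R) (A : set R) :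
  0 < k -> measurable D -> measurable_fun [set: R] psi -> measurable A ->
  (forall x y, D x -> D y -> k * `|x - y| <= `|psi x - psi y|) ->
  (mu (D `&` psi @^-1` A) <= k^-1%:E * mu A)%E.
Proof.
move=> k0 mD mpsi mA exp.
have mpre B : measurable B -> measurable (D `&` psi @^-1` B).
  by move=> mB; apply: measurableI => //; rewrite -[X in measurable X]setTI; exact: mpsi.
have [Aoo|Afin] := eqVneq (mu A) +oo%E.
  by rewrite Aoo gt0_muley ?lte_fin ?invr_gt0// leey.
have Af : mu A \is a fin_num by rewrite ge0_fin_numE// lt_neqAle Afin leey.
suff H (e : R) : 0 < e -> (mu (D `&` psi @^-1` A) <= k^-1%:E * (mu A + e%:E))%E.
  apply/lee_addgt0Pr => e e0.
  have := H (k * e) (mulr_gt0 k0 e0).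
  have ke0 : (0 <= (k * e)%:E)%E by rewrite lee_fin mulr_ge0// ltW.
  by rewrite ge0_muleDr// -EFinM mulKf ?gt_eqF.
move=> e0.
have EA : mu A = ((wlength (idfun : R -> R))^* A)%mu by [].
have [F [Fi AF] Fe] : exists2 I_, open_itv_cover A I_ &
    (\sum_(0 <= k <oo) wlength (idfun : R -> R) (I_ k) <= mu A + e%:E)%E.
  move: Af; rewrite EA outer_measure_open_itv_cover.
  move=> /lb_ereal_inf_adherent-/(_ _ e0)[_/= [F]] AF <- Fe.
  by exists F => //; exact/ltW.
apply: (@le_trans _ _ (\sum_(0 <= n <oo) mu (D `&` psi @^-1` F n))%E).
  apply: measure_sigma_subadditive.
  - by move=> n; apply: mpre; have [[p q] ->] := Fi n; exact: measurable_itv.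
  - exact: mpre.
  - by move=> x [Dx /AF[n _ Fx]]; exists n.
apply: (@le_trans _ _ (k^-1%:E * \sum_(0 <= n <oo) wlength (idfun : R -> R) (F n))%E).
  rewrite -nneseriesZl; last by move=> i _; exact: (@wlength_ge0 R idfun).
  apply: lee_nneseries => // n _.
  have [[p q] FE] := Fi n; rewrite FE /= wlength_itv/= lte_fin.
  case: (ltP p q) => pq; last first.
    rewrite mule0 (_ : `]p, q[%classic = set0) ?preimage_set0 ?setI0 ?measure0//.
    by apply/seteqP; split => // x /=; rewrite in_itv/=; lra.
  rewrite -EFinD -EFinM; apply: lebesgue_diam.
  - by rewrite mulr_ge0 ?invr_ge0 ?subr_ge0// ltW.
  - by apply: mpre; exact: measurable_itv.
  - move=> x y [Dx /=]; rewrite in_itv/= => /andP[px qx] [Dy /=]; rewrite in_itv/= => /andP[py qy].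
    rewrite ler_pdivlMl//; apply: (le_trans (exp _ _ Dx Dy)).
    by rewrite ler_norml; lra.
by rewrite lee_pmul2l// lte_fin invr_gt0.
Qed.

Lemma integral_mrestr (D : set R) (mD : measurable D) (f : R -> \bar R) :
  measurable_fun [set: R] f -> (forall x, 0 <= f x)%E ->
  (\int[mrestr mu mD]_x f x = \int[mu]_(x in D) f x)%E.
Proof.
move=> mf f0.
rewrite -(setUv D) ge0_integral_setU//=; last 3 first.
- exact: measurableC.
- by rewrite setUv.
- by apply/disj_setPS; rewrite setICr.
rewrite (eq_measure_integral mu); last first.
  by move=> A mA AD; rewrite /= /mrestr setIidl.
rewrite [X in (_ + X)%E](_ : _ = 0%E) ?adde0//.
rewrite (eq_measure_integral mzero) ?integral_measure_zero//.
move=> A mA AD /=; rewrite /mrestr (_ : A `&` D = set0) ?measure0//.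
by apply/seteqP; split => // x [/AD].
Qed.

(** By the measure bound, the image under [psi] of Lebesgue measure on [D] is at most k^-1 times
    Lebesgue measure. This plays the part of a change of variables throughout. *)
Lemma expanding_integral (D E : set R) (psi : R -> R) (k : R) (f : R -> \bar R) :
  0 < k -> measurable D -> measurable E ->
  measurable_fun D psi -> measurable_fun E f ->
  (forall x, 0 <= f x)%E ->
  (forall x, D x -> E (psi x)) ->
  (forall x y, D x -> D y -> k * `|x - y| <= `|psi x - psi y|) ->
  (\int[mu]_(x in D) f (psi x) <= k^-1%:E * \int[mu]_(x in E) f x)%E.
Proof.
move=> k0 mD mE mpsi mf f0 DE exp.
(* Extending by 0 outside [D] makes the map measurable on the whole line; the measure [mrestr mu mD]
   ignores the added values. *)
pose p := psi \_ D.
have mp : measurable_fun [set: R] p by apply/(measurable_restrictT _ _).1.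
pose g := f \_ E.
have mg : measurable_fun [set: R] g by apply/(measurable_restrictT _ _).1.
have g0 x : (0 <= g x)%E by rewrite /g patchE; case: ifP.
have -> : (\int[mu]_(x in D) f (psi x) = \int[mu]_(x in D) g (p x))%E.
  apply: eq_integral => x xD; rewrite /g /p /= !patchE xD ifT//.
  by rewrite inE; apply: DE; rewrite inE in xD.
have -> : (\int[mu]_(x in E) f x = \int[mu]_x g x)%E by rewrite integral_mkcond.
have mgp : measurable_fun [set: R] (g \o p) by exact: measurableT_comp.
rewrite -(integral_mrestr mD mgp) => [|x]; last exact: g0.
have k0' : 0 <= k^-1 by rewrite invr_ge0 ltW.
rewrite -(@ge0_integral_mscale _ _ _ mu setT measurableT (NngNum k0') g mg); last by move=> x _; exact: g0.
pose nu : {measure set (measurableTypeR R) -> \bar R} := mrestr mu mD.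
have := @ge0_integral_pushforward _ _ (measurableTypeR R) (measurableTypeR R) R p mp nu setT g measurableT mg (fun y _ => g0 y).
rewrite preimage_setT => <-.
apply: ge0_le_measure_integral => // A mA.
suff : (mu (D `&` p @^-1` A) <= k^-1%:E * mu A)%E.
  by rewrite setIC.
apply: expanding_measure => // x y Dx Dy.
by rewrite /p !patchE !mem_set//; exact: exp.
Qed.
End expanding.

Section norm_bound.
Context {R : realType}.
Notation mu := (@lebesgue_measure R).

(* The L2([a, b]) norm of [f] is at most [e]. *)
Definition NB (a b : R) (f : R -> R) (e : R) : Prop :=
  [/\ measurable_fun `[a, b] f, 0 <= e &
      (\int[mu]_(x in `[a, b]) ((f x) ^+ 2)%:E <= (e ^+ 2)%:E)%E].

Implicit Types (a b e : R) (f g : R -> R).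

Lemma ler_sqr_norm (x y : R) : `|x| <= `|y| -> x ^+ 2 <= y ^+ 2.
Proof.
by move=> xy; rewrite -(real_normK (num_real x)) -(real_normK (num_real y)) lerXn2r ?nnegrE.
Qed.

Lemma msqr (D : set R) f : measurable D -> measurable_fun D f ->
  measurable_fun D (fun x => ((f x) ^+ 2)%:E).
Proof. by move=> mD mf; apply/measurable_EFinP; exact: measurable_funX. Qed.

Lemma NB_le a b f g c e : measurable_fun `[a, b] g -> 0 <= c ->
  (forall x, x \in `[a, b] -> `|g x| <= c * `|f x|) ->
  NB a b f e -> NB a b g (c * e).
Proof.
move=> mg c0 gf [mf e0 fe]; split => //; first exact: mulr_ge0.
apply: (@le_trans _ _ (\int[mu]_(x in `[a, b]) ((c ^+ 2)%:E * ((f x) ^+ 2)%:E))%E).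
  apply: ge0_le_integral => //=.
  - by move=> x _; rewrite lee_fin sqr_ge0.
  - exact: msqr.
  - by apply/measurable_EFinP; apply: measurable_funM => //; exact: measurable_funX.
  - move=> x xab; rewrite lee_fin -exprMn.
    by apply: ler_sqr_norm; rewrite normrM (ger0_norm c0) gf.
rewrite ge0_integralZl//=.
- by rewrite exprMn (EFinM (c ^+ 2)) lee_wpmul2l// lee_fin sqr_ge0.
- exact: msqr.
- by move=> x _; rewrite lee_fin sqr_ge0.
- by rewrite lee_fin sqr_ge0.
Qed.

Lemma NB_mono a b f e e' : e <= e' -> NB a b f e -> NB a b f e'.
Proof.
move=> ee [mf e0 fe]; split => //; first exact: le_trans ee.
by apply: (le_trans fe); rewrite lee_fin lerXn2r ?nnegrE//; exact: le_trans ee.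
Qed.

Lemma NB_dom a b f g e : measurable_fun `[a, b] g ->
  (forall x, x \in `[a, b] -> `|g x| <= `|f x|) -> NB a b f e -> NB a b g e.
Proof.
move=> mg gf H; rewrite -(mul1r e); apply: (NB_le mg ler01 _ H).
by move=> x /gf; rewrite mul1r.
Qed.

Lemma NB_scale a b f c e : NB a b f e -> NB a b (fun x => c * f x) (`|c| * e).
Proof.
move=> H; apply: (NB_le _ _ _ H) => //.
  by have [mf _ _] := H; exact: measurable_funM.
by move=> x _; rewrite normrM.
Qed.

Lemma NB_opp a b f e : NB a b f e -> NB a b (fun x => - f x) e.
Proof.
move=> H; apply: (NB_dom _ _ H) => //.
  by have [mf _ _] := H; exact: measurableT_comp.
by move=> x _; rewrite normrN.
Qed.

Lemma NB_eps a b f e : 0 <= e -> (forall eps, 0 < eps -> NB a b f (e + eps)) -> NB a b f e.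
Proof.
move=> e0 H; have [mf _ _] := H 1 ltr01; split => //.
apply/lee_addgt0Pr => d d0.
(* With s <= 1 and s (2 e + 1) <= d, (e + s)^2 = e^2 + s (2 e + s) <= e^2 + d. *)
pose s := Num.min 1 (d / (2 * e + 1)).
have e1 : 0 < 2 * e + 1 by lra.
have s0 : 0 < s by rewrite /s lt_min ltr01/= divr_gt0.
have [_ _ h] := H s s0; apply: (le_trans h); rewrite -EFinD lee_fin.
have s1 : s <= 1 by rewrite /s ge_min lexx.
have : s * (2 * e + 1) <= d by rewrite -ler_pdivlMr// /s ge_min lexx orbT.
nra.
Qed.

(** Minkowski's inequality from (f + g)^2 <= (1 + s) f^2 + (1 + 1/s) g^2: with s = q / p the right
    side integrates to at most (p + q)^2. The slack eps serves to make p and q positive. *)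
Lemma NB_add a b f g e e' : NB a b f e -> NB a b g e' ->
  NB a b (fun x => f x + g x) (e + e').
Proof.
move=> Hf Hg; have [mf e0 _] := Hf; have [mg e'0 _] := Hg.
apply: NB_eps => [|eps eps0]; first exact: addr_ge0.
pose p := e + eps / 2; pose q := e' + eps / 2.
have p0 : 0 < p by rewrite /p; lra.
have q0 : 0 < q by rewrite /q; lra.
have [_ _ If] : NB a b f p by apply: NB_mono Hf; rewrite /p; lra.
have [_ _ Ig] : NB a b g q by apply: NB_mono Hg; rewrite /q; lra.
rewrite (_ : e + e' + eps = p + q); last by rewrite /p /q; field.
split; [exact: measurable_funD| by rewrite addr_ge0// ltW|].
pose s := q / p.
have s0 : 0 < s by rewrite divr_gt0.
apply: (@le_trans _ _ (\int[mu]_(x in `[a, b]) ((1 + s)%:E * ((f x) ^+ 2)%:E + (1 + s^-1)%:E * ((g x) ^+ 2)%:E))%E).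
  apply: ge0_le_integral => //=.
  - by move=> x _; rewrite lee_fin sqr_ge0.
  - by apply: msqr => //; exact: measurable_funD.
  - by apply/measurable_EFinP; apply: measurable_funD; apply: measurable_funM => //; exact: measurable_funX.
  - move=> x xab; rewrite lee_fin.
    have -> : (1 + s) * f x ^+ 2 + (1 + s^-1) * g x ^+ 2 =
      (f x + g x) ^+ 2 + (s * f x - g x) ^+ 2 / s by field; rewrite gt_eqF.
    by rewrite lerDl divr_ge0// ?sqr_ge0// ltW.
rewrite ge0_integralD//=; first last.
- by apply/measurable_EFinP; apply: measurable_funM => //; exact: measurable_funX.
- by move=> x _; rewrite lee_fin mulr_ge0 ?sqr_ge0// addr_ge0// invr_ge0 ltW.
- by apply/measurable_EFinP; apply: measurable_funM => //; exact: measurable_funX.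
- by move=> x _; rewrite lee_fin mulr_ge0 ?sqr_ge0// addr_ge0// ltW.
have h1 : (0 <= (1 + s)%:E)%E by rewrite lee_fin addr_ge0// ltW.
have h2 : (0 <= (1 + s^-1)%:E)%E by rewrite lee_fin addr_ge0// invr_ge0 ltW.
rewrite !ge0_integralZl//=; try by (try exact: msqr); move=> x _; rewrite lee_fin sqr_ge0.
apply: (le_trans (leeD (lee_wpmul2l h1 If) (lee_wpmul2l h2 Ig))).
rewrite -!EFinM -EFinD lee_fin /s.
rewrite [leLHS](_ : _ = (p + q) ^+ 2)//; field.
by rewrite !gt_eqF.
Qed.

Lemma NB_sub a b f g e e' : NB a b f e -> NB a b g e' ->
  NB a b (fun x => f x - g x) (e + e').
Proof. by move=> Hf /NB_opp; exact: NB_add. Qed.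

Lemma NB_ext a b f g e : (forall x, x \in `[a, b] -> f x = g x) -> NB a b f e -> NB a b g e.
Proof.
move=> fg H; have [mf _ _] := H; apply: (NB_dom _ _ H) => //.
  by apply: (eq_measurable_fun f) => // x /[!inE] /fg.
by move=> x /fg ->.
Qed.

Lemma NB0 a b : NB a b (fun=> 0) 0.
Proof.
by split => //; rewrite integral0_eq ?expr0n// => x _; rewrite expr0n.
Qed.

Lemma NB_sum a b (n : nat) (F : nat -> R -> R) (E : nat -> R) :
  (forall i, (i < n)%N -> NB a b (F i) (E i)) ->
  NB a b (fun x => \sum_(i < n) F i x) (\sum_(i < n) E i).
Proof.
elim: n => [|n IH] H.
  by rewrite big_ord0; apply: NB_ext (NB0 a b) => x _; rewrite big_ord0.
rewrite big_ord_recr/=; apply: NB_ext (NB_add (IH _) (H n _)) => //.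
  by move=> x _; rewrite big_ord_recr.
by move=> i ni; apply: H; rewrite ltnS ltnW.
Qed.

Lemma NB_ae a b f g e : measurable_fun `[a, b] g ->
  {ae mu, forall x, x \in `[a, b] -> f x = g x} -> NB a b f e -> NB a b g e.
Proof.
move=> mg fg [mf e0 fe]; split => //; rewrite (le_trans _ fe)//.
rewrite (@ge0_ae_eq_integral _ _ _ mu _ (fun x => ((g x) ^+ 2)%:E) (fun x => ((f x) ^+ 2)%:E))//.
- exact: msqr.
- exact: msqr.
- by move=> x _; rewrite lee_fin sqr_ge0.
- by move=> x _; rewrite lee_fin sqr_ge0.
- case: fg => N [mN N0 sub]; exists N; split => // x /= H; apply: sub => h.
  by apply: H => xab; rewrite h.
Qed.

Lemma lebesgue_itvcc a b : a <= b -> mu `[a, b]%classic = (b - a)%:E.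
Proof.
move=> ab; rewrite lebesgue_measure_itv/= lte_fin; case: ltP => // ba.
by rewrite (@le_anti _ _ a b) ?subrr// ab.
Qed.

Lemma NB_sup a b f M : a <= b -> 0 <= M -> measurable_fun `[a, b] f ->
  (forall x, x \in `[a, b] -> `|f x| <= M) -> NB a b f (Num.sqrt (b - a) * M).
Proof.
move=> ab M0 mf fM; split => //; first by rewrite mulr_ge0// sqrtr_ge0.
apply: (@le_trans _ _ (\int[mu]_(x in `[a, b]) (cst (M ^+ 2)%:E x))%E).
  apply: ge0_le_integral => //=.
  - by move=> x _; rewrite lee_fin sqr_ge0.
  - exact: msqr.
  - by move=> x /fM h; rewrite lee_fin; apply: ler_sqr_norm; rewrite (ger0_norm M0).
rewrite integral_cst// exprMn sqr_sqrtr ?subr_ge0//.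
by rewrite [X in (_ * X)%E](lebesgue_itvcc ab) -EFinM mulrC.
Qed.

Lemma NB_comp a b a' b' f (psi : R -> R) k e : 0 < k ->
  measurable_fun `[a', b'] psi ->
  (forall x, x \in `[a', b'] -> psi x \in `[a, b]) ->
  (forall x y, x \in `[a', b'] -> y \in `[a', b'] -> k * `|x - y| <= `|psi x - psi y|) ->
  NB a b f e -> NB a' b' (fun x => f (psi x)) (Num.sqrt k^-1 * e).
Proof.
move=> k0 mpsi pin pex [mf e0 fe]; split.
- apply: (measurable_comp (F := `[a, b])) => //.
  by move=> _ [x xab <-]; exact: pin.
- by rewrite mulr_ge0// sqrtr_ge0.
- rewrite exprMn sqr_sqrtr; last by rewrite invr_ge0 ltW.
  apply: (le_trans (@expanding_integral R _ `[a, b] psi k (fun x => ((f x) ^+ 2)%:E) k0 _ _ mpsi _ _ pin pex)) => //.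
  + exact: msqr.
  + by move=> x; rewrite lee_fin sqr_ge0.
  + by rewrite (EFinM k^-1) lee_wpmul2l// lee_fin invr_ge0 ltW.
Qed.

End norm_bound.

(** * Polynomial inequalities with Jacobi weights *)

Section psd.
Context {R : realType} {V : lmodType R} (B : V -> V -> R).
Hypothesis BC : forall u v, B u v = B v u.
Hypothesis BD : forall u v w, B (u + v) w = B u w + B v w.
Hypothesis BZ : forall c u w, B (c *: u) w = c * B u w.
Hypothesis Bge0 : forall u, 0 <= B u u.

Lemma form_0l w : B 0 w = 0.
Proof. by rewrite -(scale0r (0 : V)) BZ mul0r. Qed.

Lemma form_Nl u w : B (- u) w = - B u w.
Proof. by rewrite -scaleN1r BZ mulN1r. Qed.

Lemma form_Bl u v w : B (u - v) w = B u w - B v w.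
Proof. by rewrite BD form_Nl. Qed.

Lemma form_suml n (F : nat -> V) w : B (\sum_(i < n) F i) w = \sum_(i < n) B (F i) w.
Proof. by elim: n => [|n IH]; rewrite ?big_ord0 ?form_0l// !big_ord_recr/= BD IH. Qed.

(** If B u q were nonzero, u + t q with the chosen t would have B-square exactly -1. *)
Lemma form_null u q : B q q = 0 -> B u q = 0.
Proof.
move=> q0; apply/eqP/negP => /negP nz.
pose t := - (B u u + 1) / (2 * B u q).
have := Bge0 (u + t *: q).
rewrite BD !(BC _ (u + _)) !BD !BZ !(BC _ (t *: q)) !BZ q0 !mulr0 addr0 (BC q u).
have -> : t * B u q = - (B u u + 1) / 2 by rewrite /t; field.
by rewrite leNgt => /negP; apply; lra.
Qed.

Lemma form_orth_sum (q : nat -> V) n (c : nat -> R) :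
  (forall i j, i != j -> B (q i) (q j) = 0) ->
  B (\sum_(i < n) c i *: q i) (\sum_(i < n) c i *: q i) = \sum_(i < n) c i ^+ 2 * B (q i) (q i).
Proof.
move=> orth; rewrite (form_suml _ (fun i => c i *: q i)); apply: eq_bigr => i _.
rewrite BZ BC (form_suml _ (fun i => c i *: q i)) (bigD1 i)//= big1 ?addr0.
  by rewrite BZ; ring.
by move=> j ji; rewrite BZ orth ?mulr0.
Qed.

(* The coefficient on a vector of length zero is a division by zero, which is harmless:
   by Cauchy-Schwarz such a vector is orthogonal to everything. *)
Lemma orth_projection_exists (phi : nat -> V) (n : nat) (f : V) :
  exists c : nat -> R, forall k, (k < n)%N -> B (f - \sum_(i < n) c i *: phi i) (phi k) = 0.
Proof.
elim: n f => [|n IH] f; first by exists (fun=> 0).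
have [d dP] := IH (phi n); have [c cP] := IH f.
set q := phi n - _ in dP; set f1 := f - _ in cP.
pose t := B f1 q / B q q.
exists (fun i => if (i == n)%N then t else c i - t * d i).
have -> : f - \sum_(i < n.+1) (if (i == n :> nat)%N then t else c i - t * d i) *: phi i = f1 - t *: q.
  rewrite big_ord_recr/= eqxx /f1 /q scalerBr scaler_sumr.
  under eq_bigr do rewrite ltn_eqF// scalerBl -scalerA.
  by rewrite sumrB opprD opprB opprB !addrA; congr (_ - _); rewrite addrAC.
have f1q : B (f1 - t *: q) q = 0.
  rewrite form_Bl BZ /t; have [q0|q0] := eqVneq (B q q) 0; last by rewrite divfK// subrr.
  by rewrite (form_null f1 q0) q0 mulr0 subrr.
have lt_case k : (k < n)%N -> B (f1 - t *: q) (phi k) = 0.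
  by move=> kn; rewrite form_Bl BZ cP// dP// mulr0 subrr.
move=> k; rewrite ltnS leq_eqVlt => /predU1P[->|/lt_case//].
have -> : phi n = q + \sum_(i < n) d i *: phi i by rewrite /q subrK.
rewrite BC BD -(BC _ q) f1q add0r (form_suml _ (fun i => d i *: phi i)) big1// => i _.
by rewrite BZ BC lt_case ?mulr0.
Qed.

End psd.

Section poly_integral.
Context {R : realType}.
Notation mu := (@lebesgue_measure R).
Implicit Types (P Q : {poly R}).

(** The antiderivative with zero constant term: at index 0 the coefficient is a division by [0%:R],
    which is 0. *)
Definition prim P : {poly R} := \poly_(i < (size P).+1) (P`_i.-1 / i%:R).

Lemma coef_prim P i : (prim P)`_i = P`_i.-1 / i%:R.
Proof.
rewrite coef_poly; case: ifP => // /negbT; rewrite -leqNgt.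
by case: i => [//|i] /= Pi; rewrite nth_default ?mul0r.
Qed.

Lemma primD P Q : prim (P + Q) = prim P + prim Q.
Proof. by apply/polyP => i; rewrite !(coefD, coef_prim) mulrDl. Qed.

Lemma primZ c P : prim (c *: P) = c *: prim P.
Proof. by apply/polyP => i; rewrite !(coefZ, coef_prim) mulrA. Qed.

Lemma deriv_prim P : (prim P)^`() = P.
Proof.
apply/polyP => i; by rewrite coef_deriv coef_prim /= -(mulr_natr (_ / _)) divfK.
Qed.

Lemma size_prim P n : (size P <= n)%N -> (size (prim P) <= n.+1)%N.
Proof. by move=> Pn; apply: leq_trans (size_poly _ _) _. Qed.

Lemma deriv_eq_const P Q : P^`() = Q^`() -> exists c, P = Q + c%:P.
Proof.
move=> PQ; exists ((P - Q)`_0); apply/eqP; rewrite addrC -subr_eq; apply/eqP/polyP => -[|i].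
  by rewrite coefC.
have : (P - Q)^`()`_i = 0 by rewrite derivB PQ subrr coef0.
rewrite coef_deriv => /eqP; rewrite -mulr_natr mulf_eq0 pnatr_eq0 orbF coefC => /eqP -> //.
Qed.

(** The integral over [a, b], defined on coefficients so that linearity and integration by parts are
    algebraic; [pint_lebesgue] identifies it with the Lebesgue integral. *)
Definition pint (a b : R) P : R := (prim P).[b] - (prim P).[a].

Variables (a b : R).

Lemma pintD P Q : pint a b (P + Q) = pint a b P + pint a b Q.
Proof. by rewrite /pint primD !hornerD; ring. Qed.

Lemma pintZ c P : pint a b (c *: P) = c * pint a b P.
Proof. by rewrite /pint primZ !hornerZ mulrBr. Qed.

Lemma pint_deriv P : pint a b P^`() = P.[b] - P.[a].
Proof.
rewrite /pint; have [c ->] := deriv_eq_const (deriv_prim P^`()).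
by rewrite !hornerD !hornerC; ring.
Qed.

End poly_integral.

Section poly_lebesgue.
Context {R : realType}.
Notation mu := (@lebesgue_measure R).
Variables (a b : R).
Hypothesis ab : a < b.

Lemma continuous_horner (P : {poly R}) : continuous (horner P).
Proof. by move=> x; apply/differentiable_continuous/derivable1_diffP/derivable_horner. Qed.

Lemma measurable_horner (P : {poly R}) (D : set R) : measurable_fun D (horner P).
Proof. by apply: measurable_funTS; apply: continuous_measurable_fun; exact: continuous_horner. Qed.

Lemma FTC_within (f F : R -> R) : {within `[a, b], continuous f} ->
  {within `[a, b], continuous F} ->
  (forall x, x \in `]a, b[ -> is_derive x (1 : R) F (f x)) ->
  (\int[mu]_(x in `[a, b]) (f x)%:E = (F b - F a)%:E)%E.
Proof.
move=> cf cF dF; rewrite (continuous_FTC2 (F := F) ab cf) ?EFinB//.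
- have /(continuous_within_itvP _ ab)[_ Fa Fb] := cF; split => // x xab.
  by have [] := dF _ xab.
- by move=> x xab; rewrite derive1E; have [_ ->] := dF _ xab.
Qed.

Lemma pint_lebesgue (P : {poly R}) :
  (\int[mu]_(x in `[a, b]) (P.[x])%:E = (pint a b P)%:E)%E.
Proof.
apply: (@FTC_within (horner P) (horner (prim P))).
- by apply: continuous_subspaceT; exact: continuous_horner.
- by apply: continuous_subspaceT; exact: continuous_horner.
- by move=> x _; rewrite -[X in X.[x]](deriv_prim P); exact: is_derive_poly.
Qed.

Lemma pint_ge0 (P : {poly R}) : (forall x, x \in `[a, b] -> 0 <= P.[x]) -> 0 <= pint a b P.
Proof.
by move=> P0; rewrite -lee_fin -pint_lebesgue; apply: integral_ge0 => x xab; rewrite lee_fin P0.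
Qed.

Definition wt : {poly R} := ('X - a%:P) * (b%:P - 'X).

Lemma horner_wt x : wt.[x] = (x - a) * (b - x).
Proof. by rewrite /wt !hornerE. Qed.

Lemma wt_ge0 x : x \in `[a, b] -> 0 <= (x - a) * (b - x).
Proof. by rewrite in_itv/= => /andP[ax xb]; rewrite mulr_ge0 ?subr_ge0. Qed.

(** The inner product with Jacobi weight ((x - a)(b - x))^k, so that [jac k P P] is the squared L2
    norm of phi^k P with phi = [step_weight]. *)
Definition jac k (P Q : {poly R}) : R := pint a b (P * Q * wt ^+ k).

Lemma jacC k P Q : jac k P Q = jac k Q P.
Proof. by rewrite /jac (mulrC P). Qed.

Lemma jacD k P1 P2 Q : jac k (P1 + P2) Q = jac k P1 Q + jac k P2 Q.
Proof. by rewrite /jac !mulrDl pintD. Qed.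

Lemma jacZ k c P Q : jac k (c *: P) Q = c * jac k P Q.
Proof. by rewrite /jac -!scalerAl pintZ. Qed.

Lemma jac_ge0 k P : 0 <= jac k P P.
Proof.
apply: pint_ge0 => x xab; rewrite hornerM horner_exp horner_wt hornerM.
by rewrite mulr_ge0 ?exprn_ge0 ?wt_ge0// -expr2 sqr_ge0.
Qed.

(* The Jacobi differential operator: symmetric for [jac k], and diagonal with eigenvalues
   [jeig k m] in the basis of orthogonal polynomials. *)
Definition jop k (Q : {poly R}) : {poly R} :=
  - (wt * Q^`()^`() + k.+1%:R *: (wt^`() * Q^`())).

(** The difference of the two sides is the integral of the derivative of wt^(k+1) Q' P, and [wt]
    vanishes at both ends. *)
Lemma jac_parts k P Q : jac k.+1 Q^`() P^`() = jac k (jop k Q) P.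
Proof.
apply/eqP; rewrite -subr_eq0; apply/eqP.
have -> : jac k.+1 Q^`() P^`() - jac k (jop k Q) P = pint a b (wt ^+ k.+1 * Q^`() * P)^`().
  rewrite /jac -[- pint _ _ _]mulN1r -pintZ -pintD; congr pint.
  rewrite !derivM deriv_exp /= /jop scaleN1r scaler_nat exprS.
  ring.
by rewrite pint_deriv !hornerM !horner_exp !horner_wt !subrr mulr0 mul0r !expr0n/= !mul0r subrr.
Qed.

Lemma wtE : wt = - 'X ^+ 2 + (a + b)%:P * 'X - (a * b)%:P.
Proof. by rewrite /wt polyCD polyCM; ring. Qed.

Lemma deriv_wt : wt^`() = - (2%:R)%:P * 'X + (a + b)%:P.
Proof. by rewrite wtE !poly.derivE polyC_natr polyCD; ring. Qed.

Lemma jopD k P Q : jop k (P + Q) = jop k P + jop k Q.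
Proof. by rewrite /jop !derivD !mulrDr scalerDr; ring. Qed.

Lemma jopZ k c P : jop k (c *: P) = c *: jop k P.
Proof. by rewrite /jop !derivZ -!mul_polyC; ring. Qed.

Definition jeig k m : R := m%:R * (m + 2 * k + 1)%:R.

(** [wt] has leading term -x^2, so the coefficient of x^m in [jop k 'X^m] is m (m - 1) + 2 (k + 1) m
    = m (m + 2 k + 1): the operator is triangular on monomials. *)
Lemma jop_Xn k m : (size (jop k 'X^m - jeig k m *: 'X^m)%R <= m)%N.
Proof.
case: m => [|[|m]].
- by rewrite expr0 /jop /jeig !poly.derivE mul0r !scale0r !mulr0 scaler0 addr0 subr0 oppr0 size_poly0.
- rewrite expr1 /jop /jeig derivX derivC mulr0 add0r mulr1 deriv_wt.
  rewrite (_ : _ - _ = (- (k.+1%:R * (a + b)))%:P) ?size_polyC ?leq_b1//.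
  rewrite -!mul_polyC !(polyCN, polyCM, polyCD) !polyC_natr.
  ring.
- have -> : jop k 'X^(m.+2) - jeig k m.+2 *: 'X^(m.+2) =
    (- (m.+2%:R * (m.+1%:R + k.+1%:R) * (a + b))) *: 'X^(m.+1) +
    (m.+2%:R * m.+1%:R * (a * b)) *: 'X^m.
    have nE n (p : {poly R}) : p *+ n = (n%:R)%:P * p by rewrite polyC_natr mulr_natl.
    have -> : jeig k m.+2 = (m%:R + 1 + 1) * (m%:R + 1 + 1 + (k%:R + k%:R) + 1).
      by rewrite /jeig; ring.
    rewrite /jop derivXn derivMn derivXn /= deriv_wt wtE !nE -!mul_polyC -!natr1.
    move: (m%:R : R) (k%:R : R) => x y.
    rewrite !(polyCN, polyCM, polyCD, polyC1, polyC0) !exprS.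
    ring.
  rewrite (leq_trans (size_polyD _ _))// geq_max (leq_trans (size_scale_leq _ _))//= ?size_polyXn//.
  by rewrite (leq_trans (size_scale_leq _ _))//= size_polyXn.
Qed.

Lemma size_jop k (Q : {poly R}) n : (size Q <= n)%N -> (size (jop k Q) <= n)%N.
Proof.
move=> Qn; rewrite -(coefK Q) poly_def.
rewrite (big_morph (jop k) (jopD k) (_ : jop k 0 = 0)); last first.
  by have := jopZ k 0 0; rewrite !scale0r.
apply: (leq_trans (size_sum _ _ _)); apply/bigmax_leqP => i _.
rewrite jopZ (leq_trans (size_scale_leq _ _))// -(subrK (jeig k i *: 'X^i) (jop k 'X^i)).
rewrite (leq_trans (size_polyD _ _))// geq_max (leq_trans (jop_Xn _ _))/=; last first.
  by rewrite ltnW// (leq_trans (ltn_ord i)).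
by rewrite (leq_trans (size_scale_leq _ _))// size_polyXn (leq_trans (ltn_ord i)).
Qed.

Lemma size_jop_eig k (Q : {poly R}) n : (size Q <= n.+1)%N ->
  (size (jop k Q - jeig k n *: Q)%R <= n)%N.
Proof.
move=> Qn; have QE : Q = (Q - Q`_n *: 'X^n) + Q`_n *: 'X^n by rewrite subrK.
have sQ : (size (Q - Q`_n *: 'X^n)%R <= n)%N.
  apply/leq_sizeP => j; rewrite leq_eqVlt => /predU1P[<-|nj].
    by rewrite coefB coefZ coefXn eqxx mulr1 subrr.
  by rewrite coefB coefZ coefXn gtn_eqF// mulr0 subr0 (leq_sizeP _ _ Qn).
rewrite QE jopD jopZ scalerDr opprD addrACA (leq_trans (size_polyD _ _))// geq_max.
apply/andP; split.
  rewrite (leq_trans (size_polyD _ _))// geq_max size_jop//= size_polyN.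
  by rewrite (leq_trans (size_scale_leq _ _)).
rewrite scalerA (mulrC (jeig _ _)) -scalerA -scalerBr (leq_trans (size_scale_leq _ _))//.
exact: jop_Xn.
Qed.

Lemma legendre_basis k : exists q : nat -> {poly R},
  [/\ forall m, (size (q m) <= m.+1)%N, forall m, (q m)`_m = 1 &
      forall m (P : {poly R}), (size P <= m)%N -> jac k (q m) P = 0].
Proof.
have H m : exists p : {poly R}, [/\ (size p <= m.+1)%N, p`_m = 1 &
    forall P : {poly R}, (size P <= m)%N -> jac k p P = 0].
  have [c cP] := orth_projection_exists (@jacC k) (@jacD k) (@jacZ k) (@jac_ge0 k)
    (fun i => 'X^i) m 'X^m.
  set S := \sum_(i < m) _ in cP.
  have sS : (size S <= m)%N.
    rewrite (leq_trans (size_sum _ _ _))//; apply/bigmax_leqP => i _.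
    by rewrite (leq_trans (size_scale_leq _ _))// size_polyXn.
  exists ('X^m - S); split.
  - by rewrite (leq_trans (size_polyD _ _))// geq_max size_polyN size_polyXn leqnn/= ltnW.
  - by rewrite coefB coefXn eqxx (leq_sizeP _ _ sS)// subr0.
  - move=> P Pm; rewrite -(coefK P) poly_def jacC.
    rewrite (form_suml (@jacD k) (@jacZ k) _ (fun i => P`_i *: 'X^i)) big1// => i _.
    by rewrite jacZ jacC cP ?mulr0// (leq_trans (ltn_ord i)).
exists (fun m => projT1 (cid (H m))).
by split => m; case: cid => p [].
Qed.

Lemma monic_basis_expand (q : nat -> {poly R}) :
  (forall m, (size (q m) <= m.+1)%N) -> (forall m, (q m)`_m = 1) ->
  forall n (Q : {poly R}), (size Q <= n)%N -> exists c : nat -> R, Q = \sum_(i < n) c i *: q i.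
Proof.
move=> sq lq; elim=> [|n IH] Q Qn.
  exists (fun=> 0); rewrite big_ord0; apply/eqP; rewrite -size_poly_eq0.
  by move: Qn; rewrite leqn0.
have sQ : (size (Q - Q`_n *: q n)%R <= n)%N.
  apply/leq_sizeP => j; rewrite leq_eqVlt => /predU1P[<-|nj].
    by rewrite coefB coefZ lq mulr1 subrr.
  by rewrite coefB coefZ (leq_sizeP _ _ (sq n))// mulr0 subr0 (leq_sizeP _ _ Qn).
have [c cE] := IH _ sQ.
exists (fun i => if (i == n)%N then Q`_n else c i).
rewrite big_ord_recr/= eqxx -[LHS](subrK (Q`_n *: q n)) cE; congr (_ + _).
by apply: eq_bigr => i _; rewrite ltn_eqF.
Qed.

(** One basis diagonalises both forms: each q_i is orthogonal to all lower degrees, and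
    [jop k (q i)] is [jeig k i] times q_i plus terms of lower degree, which pair to 0 with q_i. *)
Lemma jac_expand k : exists q : nat -> {poly R},
  [/\ forall m, (size (q m) <= m.+1)%N,
    forall n (Q : {poly R}), (size Q <= n)%N -> exists c : nat -> R, Q = \sum_(i < n) c i *: q i,
    forall n (c : nat -> R), jac k (\sum_(i < n) c i *: q i) (\sum_(i < n) c i *: q i) =
      \sum_(i < n) c i ^+ 2 * jac k (q i) (q i) &
    forall n (c : nat -> R), jac k.+1 (\sum_(i < n) c i *: q i)^`() (\sum_(i < n) c i *: q i)^`() =
      \sum_(i < n) c i ^+ 2 * (jeig k i * jac k (q i) (q i))].
Proof.
have [q [sq lq oq]] := legendre_basis k.
have orth i j : i != j -> jac k (q i) (q j) = 0.
  by rewrite neq_ltn => /orP[ij|ji]; [rewrite jacC|]; rewrite oq// (leq_trans (sq _)).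
exists q; split => //.
- exact: monic_basis_expand.
- by move=> n c; exact: (form_orth_sum (@jacC k) (@jacD k) (@jacZ k)).
pose F (P Q : {poly R}) := jac k.+1 P^`() Q^`().
have FC P Q : F P Q = F Q P by exact: jacC.
have FD P1 P2 Q : F (P1 + P2) Q = F P1 Q + F P2 Q by rewrite /F derivD jacD.
have FZ c P Q : F (c *: P) Q = c * F P Q by rewrite /F derivZ jacZ.
have orthF i j : i != j -> F (q i) (q j) = 0.
  rewrite neq_ltn => /orP[ij|ji]; [rewrite /F|rewrite FC /F]; rewrite jac_parts jacC oq//.
    by rewrite size_jop// (leq_trans (sq _)).
  by rewrite size_jop// (leq_trans (sq _)).
move=> n c; rewrite -/(F _ _) (form_orth_sum FC FD FZ _ _ orthF); apply: eq_bigr => i _.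
congr (_ * _); rewrite /F jac_parts -(subrK (jeig k i *: q i) (jop k (q i))) jacD jacZ.
by rewrite jacC oq ?add0r// size_jop_eig.
Qed.

Lemma jeig_mono k m n : (m <= n)%N -> jeig k m <= jeig k n.
Proof. by move=> mn; rewrite /jeig -!natrM ler_nat leq_mul// !leq_add. Qed.

Lemma jeig_ge0 k m : 0 <= jeig k m. Proof. by rewrite /jeig mulr_ge0. Qed.

Lemma jac_bernstein k n (Q : {poly R}) : (size Q <= n.+1)%N ->
  jac k.+1 Q^`() Q^`() <= jeig k n * jac k Q Q.
Proof.
have [q [sq ex J1 J2]] := jac_expand k => /ex[c ->]; rewrite J1 J2 mulr_sumr.
apply: ler_sum => i _; rewrite mulrCA ler_wpM2r//.
  exact: mulr_ge0 (sqr_ge0 _) (jac_ge0 _ _).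
by rewrite jeig_mono// -ltnS.
Qed.

(** A spectral gap: subtract from Q an antiderivative of S, then the modes of index < n. The
    remaining modes have eigenvalue at least [jeig k n], and the discarded ones contribute a
    nonnegative amount to the right side. *)
Lemma jac_poincare k n (Q S : {poly R}) : (0 < n)%N -> (size S <= n.-1)%N ->
  exists2 P : {poly R}, (size P <= n)%N &
    jeig k n * jac k (Q - P) (Q - P) <= jac k.+1 (Q^`() - S) (Q^`() - S).
Proof.
move=> n0 Sn; have [q [sq ex J1 J2]] := jac_expand k.
pose U := prim S; have sU : (size U <= n)%N by rewrite -(prednK n0) size_prim.
pose N := maxn n (size (Q - U)%R).
have [c cE] := ex N (Q - U) (leq_maxr _ _).
pose d i := if (i < n)%N then 0 else c i.
pose e i := if (i < n)%N then c i else 0.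
exists (U + \sum_(i < N) e i *: q i).
  rewrite (leq_trans (size_polyD _ _))// geq_max sU/= (leq_trans (size_sum _ _ _))//.
  apply/bigmax_leqP => i _; rewrite /e; case: ifP => ni; last by rewrite scale0r size_poly0.
  by rewrite (leq_trans (size_scale_leq _ _))// (leq_trans (sq _)).
have -> : Q - (U + \sum_(i < N) e i *: q i) = \sum_(i < N) d i *: q i.
  rewrite opprD addrA cE -sumrB; apply: eq_bigr => i _.
  by rewrite -scalerBl /d /e; case: ifP; rewrite ?subrr ?subr0.
have -> : Q^`() - S = (\sum_(i < N) c i *: q i)^`() by rewrite -cE derivB deriv_prim.
rewrite J1 J2 mulr_sumr; apply: ler_sum => i _; rewrite mulrCA /d.
case: ifP => ni.
  by rewrite expr0n mul0r; apply: mulr_ge0 (sqr_ge0 _) (mulr_ge0 (jeig_ge0 _ _) (jac_ge0 _ _)).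
by rewrite ler_wpM2l ?sqr_ge0// ler_wpM2r ?jac_ge0// jeig_mono// leqNgt ni.
Qed.

(** The m-th derivative has degree at most n - m, so the eigenvalue met at weight m is at most (n -
    m)(n + m + 1), hence at most 2 n^2. *)
Lemma jac_bernstein_iter m n (Q : {poly R}) : (size Q <= n.+1)%N ->
  jac m Q^`(m) Q^`(m) <= (2 * n%:R ^+ 2) ^+ m * jac 0 Q Q.
Proof.
move=> Qn; elim: m => [|m IH]; first by rewrite derivn0 expr0 mul1r.
have sQ : (size Q^`(m) <= (n - m).+1)%N.
  elim: m {IH} => [|m IH]; first by rewrite subn0.
  rewrite derivnS; have [->|nz] := eqVneq Q^`(m) 0; first by rewrite deriv0 size_poly0.
  by rewrite subnS -ltnS (leq_trans (lt_size_deriv nz))// (leq_trans IH)// ltnS leqSpred.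
rewrite derivnS (le_trans (jac_bernstein _ sQ))// exprS -mulrA ler_pM ?jeig_ge0 ?jac_ge0//.
rewrite /jeig; case: (leqP n m) => nm.
  by rewrite (eqP (_ : n - m == 0)%N) ?subn_eq0// mul0r mulr_ge0 ?sqr_ge0.
rewrite -natrX -!natrM ler_nat -{2 3}(subnK (ltnW nm)).
move: (n - m)%N (subn_gt0 m n) => j; rewrite nm => j0; nia.
Qed.

(** Starting from the approximation 0 of the r-th derivative, each antiderivative uses one spectral
    gap. The gaps occur at degrees n, ..., n - r + 1, and every eigenvalue is at least s^2 because s
    <= n + 1 - r. *)
Lemma jac_jackson_iter r k n (Q : {poly R}) (s : R) : (r <= n)%N ->
  0 <= s -> s <= (n.+1 - r)%:R ->
  exists2 P : {poly R}, (size P <= n)%N &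
    (s ^+ 2) ^+ r * jac k (Q - P) (Q - P) <= jac (k + r) Q^`(r) Q^`(r).
Proof.
move=> + s0; elim: r k n Q => [|r IH] k n Q rn sn.
  by exists 0; rewrite ?size_poly0// expr0 mul1r subr0 addn0 derivn0.
have n0 : (0 < n)%N by exact: leq_trans rn.
have [||S sS HS] := IH k.+1 n.-1 Q^`().
- by rewrite -ltnS prednK.
- by rewrite prednK.
have [P sP HP] := jac_poincare k Q n0 sS.
exists P => //; rewrite derivSn addnS -addSn; apply: le_trans HS.
rewrite exprSr -mulrA ler_wpM2l ?exprn_ge0 ?sqr_ge0//; apply: le_trans HP.
rewrite ler_wpM2r ?jac_ge0// /jeig.
have sn' : s <= n%:R.
  by rewrite (le_trans sn)// ler_nat subSS leq_subr.
rewrite expr2 ler_pM// (le_trans sn')// ler_nat; lia.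
Qed.

End poly_lebesgue.

(** * Bernstein and Jackson inequalities *)

Section within_continuity.
Context {R : realType}.
Implicit Types (A : set R) (f g : R -> R).

Lemma within_contD A f g : {within A, continuous f} -> {within A, continuous g} ->
  {within A, continuous (fun x => f x + g x)}.
Proof. by move=> cf cg x; have := cvgD (cf x) (cg x); exact. Qed.

Lemma within_contM A f g : {within A, continuous f} -> {within A, continuous g} ->
  {within A, continuous (fun x => f x * g x)}.
Proof. by move=> cf cg x; have := cvgM (cf x) (cg x); exact. Qed.

Lemma within_contN A f : {within A, continuous f} -> {within A, continuous (fun x => - f x)}.
Proof. by move=> cf x; have := cvgN (cf x); exact. Qed.

Lemma within_cont_cst A (c : R) : {within A, continuous (fun=> c)}.
Proof. by move=> x; exact: cvg_cst. Qed.

Lemma within_contB A f g : {within A, continuous f} -> {within A, continuous g} ->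
  {within A, continuous (fun x => f x - g x)}.
Proof. by move=> cf /within_contN; exact: within_contD. Qed.

Lemma within_cont_comp A f g : continuous g -> {within A, continuous f} ->
  {within A, continuous (fun x => g (f x))}.
Proof. by move=> cg cf x; have := continuous_comp (cf x) (cg (f x)); exact. Qed.

Lemma within_contV A f : (forall x, A x -> f x != 0) -> {within A, continuous f} ->
  {within A, continuous (fun x => (f x)^-1)}.
Proof.
move=> f0 cf; rewrite continuous_subspace_in => x /[!inE] Ax.
by have := cvgV (f0 x Ax) (cf x); exact.
Qed.

Lemma within_cont_horner A (P : {poly R}) f : {within A, continuous f} ->
  {within A, continuous (fun x => P.[f x])}.
Proof. exact/within_cont_comp/continuous_horner. Qed.

End within_continuity.

Section chains.
Context {R : realType}.
Notation mu := (@lebesgue_measure R).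

(** Two-sided derivatives inside and continuity up to the ends: the form used by the fundamental
    theorem of calculus and the mean value theorem. *)
Definition der_on (a b : R) (f df : R -> R) : Prop :=
  [/\ {within `[a, b], continuous f}, {within `[a, b], continuous df} &
      forall x, x \in `]a, b[ -> is_derive x (1 : R) f (df x)].

Fixpoint nder (k : nat) (a b : R) (g gk : R -> R) : Prop :=
  match k with
  | 0 => {within `[a, b], continuous g} /\ g = gk
  | k'.+1 => exists dg, der_on a b g dg /\ nder k' a b dg gk
  end.

Lemma nder_cont_last k a b (g gk : R -> R) : nder k a b g gk -> {within `[a, b], continuous gk}.
Proof. by elim: k g => [g [cg <-]//|k IH g [dg [_ /IH]]]. Qed.

Lemma der_onD a b f df g dg : der_on a b f df -> der_on a b g dg ->
  der_on a b (fun x => f x + g x) (fun x => df x + dg x).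
Proof.
move=> [cf cdf Df] [cg cdg Dg]; split; [exact: within_contD|exact: within_contD|].
by move=> x xab; apply: is_deriveD; [exact: Df|exact: Dg].
Qed.

Lemma within_meas a b (f : R -> R) : {within `[a, b], continuous f} -> measurable_fun `[a, b] f.
Proof. by move=> cf; apply: subspace_continuous_measurable_fun. Qed.

Lemma within_bounded a b (f : R -> R) : a <= b -> {within `[a, b], continuous f} ->
  exists2 M, 0 <= M & forall x, x \in `[a, b] -> `|f x| <= M.
Proof.
move=> ab cf; have cnf : {within `[a, b], continuous (fun x => `|f x|)}.
  by apply: within_cont_comp cf; exact: norm_continuous.
have [c cab H] := EVT_max ab cnf.
by exists `|f c|.
Qed.

Variables (a b : R).
Hypothesis ab : a < b.

(** Cauchy-Schwarz through |f| <= s f^2 / 2 + 1 / (2 s), balanced by s = sqrt(b - a) / e'; the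
    enlarged bound e' is positive even when e = 0. *)
Lemma NB_L1 f e : NB a b f e ->
  (\int[mu]_(x in `[a, b]) `|(f x)%:E| <= (Num.sqrt (b - a) * e)%:E)%E.
Proof.
move=> Hf; set L := b - a; have L0 : 0 < L by rewrite subr_gt0.
have sL : 0 < Num.sqrt L by rewrite sqrtr_gt0.
apply/lee_addgt0Pr => d d0.
pose e' := e + d / Num.sqrt L.
have e0 : 0 <= e by case: Hf.
have e'0 : 0 < e' by rewrite /e' ltr_wpDl// divr_gt0.
have [mf _ If] : NB a b f e' by apply: NB_mono Hf; rewrite /e' lerDl divr_ge0// ltW.
pose s := Num.sqrt L / e'.
have s0 : 0 < s by rewrite divr_gt0.
apply: (@le_trans _ _ (\int[mu]_(x in `[a, b]) ((s / 2)%:E * ((f x) ^+ 2)%:E + ((2 * s)^-1)%:E))%E).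
  apply: ge0_le_integral => //=.
  - by do 2 apply: measurableT_comp => //.
  - by apply/measurable_EFinP; apply: measurable_funD => //; apply: measurable_funM => //; exact: measurable_funX.
  - move=> x xab; rewrite lee_fin.
    have -> : s / 2 * f x ^+ 2 + (2 * s)^-1 = `|f x| + (s * `|f x| - 1) ^+ 2 / (2 * s).
      by rewrite -(real_normK (num_real (f x))); field; rewrite gt_eqF.
    by rewrite lerDl divr_ge0 ?sqr_ge0// mulr_ge0// ltW.
rewrite ge0_integralD//=; first last.
- by move=> x _; rewrite lee_fin invr_ge0 mulr_ge0// ltW.
- by apply/measurable_EFinP; apply: measurable_funM => //; exact: measurable_funX.
- by move=> x _; rewrite lee_fin mulr_ge0 ?sqr_ge0// divr_ge0// ltW.
rewrite ge0_integralZl//=; first last.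
- by rewrite lee_fin divr_ge0// ltW.
- by move=> x _; rewrite lee_fin sqr_ge0.
- exact: msqr.
rewrite integral_cst//= [X in (_ + _ * X)%E](lebesgue_itvcc (ltW ab)) -EFinM.
have h1 : (0 <= (s / 2)%:E)%E by rewrite lee_fin divr_ge0// ltW.
apply: (le_trans (leeD (lee_wpmul2l h1 If) (le_refl _))).
rewrite -EFinM -EFinD lee_fin -/L.
have -> : (2 * s)^-1 * L = (2 * s)^-1 * Num.sqrt L ^+ 2 by rewrite sqr_sqrtr// ltW.
rewrite [leLHS](_ : _ = Num.sqrt L * e'); last by rewrite /s; field; rewrite !gt_eqF.
by rewrite /e' mulrDr mulrCA divff ?mulr1// gt_eqF.
Qed.

Lemma NB_antiderivative h h' e : der_on a b h h' -> h a = 0 -> NB a b h' e ->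
  NB a b h ((b - a) * e).
Proof.
move=> [ch ch' dh] ha He; have e0 : 0 <= e by case: He.
have -> : (b - a) * e = Num.sqrt (b - a) * (Num.sqrt (b - a) * e).
  by rewrite mulrA -expr2 sqr_sqrtr// subr_ge0 ltW.
apply: NB_sup; [exact: ltW|by rewrite mulr_ge0// sqrtr_ge0|exact: within_meas|].
move=> x /[dup] xab; rewrite in_itv/= => /andP[ax xb].
have [<-|nax] := eqVneq a x; first by rewrite ha normr0 mulr_ge0// sqrtr_ge0.
have ltax : a < x by rewrite lt_neqAle nax.
have sub : `[a, x] `<=` `[a, b].
  by move=> y /=; rewrite !in_itv/= => /andP[-> yx]; rewrite (le_trans yx).
have mh' : measurable_fun `[a, b] h' by exact: within_meas.
rewrite -lee_fin; apply: le_trans (NB_L1 He).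
have <- : (`|\int[mu]_(y in `[a, x]) (h' y)%:E| = `|h x|%:E)%E.
  suff -> : (\int[mu]_(y in `[a, x]) (h' y)%:E = (h x - h a)%:E)%E by rewrite ha subr0.
  apply: (@FTC_within _ _ _ ltax h' h).
  - exact: continuous_subspaceW ch'.
  - exact: continuous_subspaceW ch.
  - move=> y; rewrite in_itv/= => /andP[ay yx]; apply: dh.
    by rewrite in_itv/= ay (lt_le_trans yx).
apply: (@le_trans _ _ (\int[mu]_(y in `[a, x]) `|(h' y)%:E|)%E).
  apply: le_abse_integral => //; apply/measurable_EFinP; exact: measurable_funS mh'.
apply: ge0_subset_integral => //.
by do 2 apply: measurableT_comp => //.
Qed.

Lemma der_on_poly (P : {poly R}) : der_on a b (horner P) (horner P^`()).
Proof.
by split; [apply: continuous_subspaceT; exact: continuous_horner..|move=> x _; exact: is_derive_poly].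
Qed.

(** Serves to reduce Jackson's inequality to polynomials: an unweighted approximation of the last
    derivative is integrated k times, with the constants matched at [a] so that every error vanishes
    there. *)
Lemma nder_antiderivative k g gk (q : {poly R}) e : nder k a b g gk ->
  NB a b (fun x => gk x - q.[x]) e ->
  exists2 Q : {poly R}, Q^`(k) = q & NB a b (fun x => g x - Q.[x]) ((b - a) ^+ k * e).
Proof.
elim: k g => [g [_ <-] H|k IH g [dg [Dg /IH H]] /H[Q1 Q1q HQ1]].
  by exists q; rewrite ?derivn0// expr0 mul1r.
pose Q := prim Q1 + (g a - (prim Q1).[a])%:P.
have dQ : Q^`() = Q1 by rewrite derivD derivC addr0 deriv_prim.
exists Q; first by rewrite derivSn dQ.
rewrite exprS -mulrA; apply: NB_antiderivative HQ1.
- have [cg cdg dgd] := Dg; have [cQ cQ1 dQd] := der_on_poly Q; rewrite dQ in cQ1 dQd.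
  split; [exact: within_contB|exact: within_contB|move=> x xab].
  by apply: is_deriveB; [exact: dgd|exact: dQd].
- by rewrite /Q hornerD hornerC; ring.
Qed.

End chains.

Section weighted.
Context {R : realType}.
Notation mu := (@lebesgue_measure R).
Variables (a b : R).
Hypothesis ab : a < b.
Notation phi := (step_weight a b).

Lemma step_weight_ge0 x : 0 <= phi x. Proof. exact: sqrtr_ge0. Qed.

Lemma step_weight_sqr x : x \in `[a, b] -> phi x ^+ 2 = (x - a) * (b - x).
Proof. by move=> xab; rewrite sqr_sqrtr// wt_ge0. Qed.

Lemma continuous_step_weight : continuous phi.
Proof.
move=> x; have -> : phi = Num.sqrt \o horner (wt a b).
  by apply/funext => y /=; rewrite horner_wt.
by apply: continuous_comp; [exact: continuous_horner|exact: sqrt_continuous].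
Qed.

Lemma measurable_step_weight (D : set R) : measurable_fun D phi.
Proof. by apply: measurable_funTS; apply: continuous_measurable_fun; exact: continuous_step_weight. Qed.

Lemma step_weight_le x : x \in `[a, b] -> phi x <= b - a.
Proof.
move=> xab; have L0 : 0 <= b - a by rewrite subr_ge0 ltW.
rewrite -(ler_pXn2r (n := 2))// ?nnegrE ?step_weight_ge0// step_weight_sqr//.
by move: xab; rewrite in_itv/= => /andP[ax xb]; nra.
Qed.

Lemma NB_jacP k (P : {poly R}) e : 0 <= e ->
  NB a b (fun x => phi x ^+ k * P.[x]) e <-> jac a b k P P <= e ^+ 2.
Proof.
move=> e0.
have E : (\int[mu]_(x in `[a, b]) ((phi x ^+ k * P.[x]) ^+ 2)%:E = (jac a b k P P)%:E)%E.
  rewrite -pint_lebesgue//; apply: eq_integral => x /[!inE] xab; congr (_%:E).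
  by rewrite exprMn exprAC step_weight_sqr// hornerM horner_exp horner_wt hornerM -expr2 mulrC.
rewrite /NB E lee_fin; split; first by case.
by move=> H; split => //; apply: measurable_funM;
  [apply: measurable_funX; exact: measurable_step_weight|exact: measurable_horner].
Qed.

Lemma NB_bernstein m n (Q : {poly R}) e : (size Q <= n.+1)%N -> NB a b (horner Q) e ->
  NB a b (fun x => phi x ^+ m * Q^`(m).[x]) ((2 * n%:R) ^+ m * e).
Proof.
move=> Qn H; have e0 : 0 <= e by case: H.
have J0 : jac a b 0 Q Q <= e ^+ 2.
  by apply/(NB_jacP 0 Q e0); apply: NB_ext H => x _; rewrite expr0 mul1r.
apply/NB_jacP; first by rewrite mulr_ge0// exprn_ge0// mulr_ge0.
rewrite (le_trans (jac_bernstein_iter ab m Qn))// (exprMn _ _ e) exprAC.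
apply: ler_pM; [by rewrite exprn_ge0// mulr_ge0// sqr_ge0|exact: jac_ge0| |by []].
rewrite lerXn2r ?nnegrE ?sqr_ge0 ?mulr_ge0 ?sqr_ge0//.
by have := sqr_ge0 (n%:R : R); nra.
Qed.

(* The L2 distance from [f] to the polynomials of degree < n is at most [e]; as an infimum,
   it need not be shown to be attained. *)
Definition EB (f : R -> R) (n : nat) (e : R) : Prop :=
  forall eps, 0 < eps -> exists2 P : {poly R}, (size P <= n)%N &
    NB a b (fun x => f x - P.[x]) (e + eps).

(** Carried as a hypothesis through the approximation theory; it is established from the totality of
    [phi] once the isometry is available. *)
Definition poly_dense : Prop :=
  forall g e, NB a b g e -> forall eps, 0 < eps ->
    exists P : {poly R}, NB a b (fun x => g x - P.[x]) eps.

Lemma EB_mono f n n' e e' : (n <= n')%N -> e <= e' -> EB f n e -> EB f n' e'.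
Proof.
move=> nn ee H eps e0; have [P sP HP] := H eps e0; exists P; first exact: leq_trans nn.
by apply: NB_mono HP; rewrite lerD2r.
Qed.

Lemma NB_EB f n e : NB a b f e -> EB f n e.
Proof.
move=> H eps e0; exists 0; rewrite ?size_poly0//.
apply: (NB_mono (e := e)); first by rewrite lerDl ltW.
by apply: NB_ext H => x _; rewrite horner0 subr0.
Qed.

Lemma EB_add f g n e e' : EB f n e -> EB g n e' -> EB (fun x => f x + g x) n (e + e').
Proof.
move=> Hf Hg eps e0; have e2 : 0 < eps / 2 by lra.
have [P sP HP] := Hf _ e2; have [Q sQ HQ] := Hg _ e2.
exists (P + Q); first by rewrite (leq_trans (size_polyD _ _))// geq_max sP.
have -> : e + e' + eps = (e + eps / 2) + (e' + eps / 2) by lra.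
by apply: NB_ext (NB_add HP HQ) => x _; rewrite hornerD; ring.
Qed.

Lemma EB_eps f n e : (forall eps, 0 < eps -> EB f n (e + eps)) -> EB f n e.
Proof.
move=> H eps e0; have e2 : 0 < eps / 2 by lra.
by have [P sP HP] := H _ e2 _ e2; exists P => //; apply: NB_mono HP; lra.
Qed.

Lemma EB_ext f g n e : (forall x, x \in `[a, b] -> f x = g x) -> EB f n e -> EB g n e.
Proof.
move=> fg H eps e0; have [P sP HP] := H _ e0; exists P => //.
by apply: NB_ext HP => x /fg ->.
Qed.

Lemma EB_polyD f (P : {poly R}) n e : (size P <= n)%N -> EB f n e ->
  EB (fun x => f x + P.[x]) n e.
Proof.
move=> sP H eps e0; have [Q sQ HQ] := H _ e0.
exists (Q + P); first by rewrite (leq_trans (size_polyD _ _))// geq_max sQ.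
by apply: NB_ext HQ => x _; rewrite hornerD; ring.
Qed.

Hypothesis dense : poly_dense.

(** The spectral inequality concerns polynomials. So [gr] is approximated by a polynomial [q] in the
    unweighted norm, and Q is an r-fold antiderivative of [q] close to [g]. The weighted norm of [q]
    exceeds that of [gr] by at most L eta, as [step_weight] is at most b - a. *)
Lemma EB_jackson r n g gr e : (r <= n)%N -> nder r a b g gr ->
  NB a b (fun x => phi x ^+ r * gr x) e -> EB g n ((r%:R / n%:R) ^+ r * e).
Proof.
move=> rn ng Hg eps eps0.
pose L := (b - a) ^+ r.
have L0 : 0 < L by rewrite exprn_gt0// subr_gt0.
have e0 : 0 <= e by case: Hg.
(* For r >= 1, n / r <= n + 1 - r amounts to (n - r)(r - 1) >= 0; for r = 0, s is 0 and s^0 is 1. *)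
pose s : R := n%:R / r%:R.
have s0 : 0 <= s by rewrite divr_ge0.
have sr0 : 0 < s ^+ r.
  case: r rn @s {ng Hg L L0 s0} => [|r] rn s; first by rewrite expr0.
  by rewrite exprn_gt0// /s divr_gt0// ltr0n// (leq_trans _ rn).
have sV : (r%:R / n%:R) ^+ r = (s ^+ r)^-1 by rewrite /s -exprVn invf_div.
(* Replacing g by Q costs L eta, and replacing [gr] by [q] costs L eta / s^r; the two add up to
   eps. *)
pose eta := eps / (L * (1 + (s ^+ r)^-1)).
have d0 : 0 < L * (1 + (s ^+ r)^-1) by rewrite mulr_gt0// addr_gt0// invr_gt0.
have eta0 : 0 < eta by rewrite divr_gt0.
have [M M0 grM] := within_bounded (ltW ab) (nder_cont_last ng).
have [q Hq] := dense (NB_sup (ltW ab) M0 (within_meas (nder_cont_last ng)) grM) eta0.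
have [Q Qq HQ] := nder_antiderivative ab ng Hq.
have Hphiq : NB a b (fun x => phi x ^+ r * q.[x]) (e + L * eta).
  apply: NB_ext (NB_sub Hg (NB_le (g := fun x => phi x ^+ r * (gr x - q.[x])) _ (ltW L0) _ Hq)).
  - by move=> x _; ring.
  - apply: measurable_funM; first by apply: measurable_funX; exact: measurable_step_weight.
    by case: Hq.
  - move=> x xab; rewrite normrM ler_wpM2r// ger0_norm ?exprn_ge0 ?step_weight_ge0//.
    by rewrite lerXn2r ?nnegrE ?step_weight_ge0 ?step_weight_le// subr_ge0 ltW.
have eL0 : 0 <= e + L * eta by rewrite addr_ge0// mulr_ge0// ltW.
have /(NB_jacP r q eL0) Jq := Hphiq.
have sn : s <= (n.+1 - r)%:R.
  rewrite /s; case: (r) rn => [|m] mn; first by rewrite invr0 mulr0.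
  rewrite ler_pdivrMr ?ltr0n// -natrM ler_nat subSS.
  have := subnK (ltnW mn); move: (n - m)%N (subn_gt0 m n) => j; rewrite mn => j0 <-; nia.
have [P sP HP] := @jac_jackson_iter R a b ab r 0 n Q s rn s0 sn.
exists P => //.
have HQP : NB a b (fun x => Q.[x] - P.[x]) ((s ^+ r)^-1 * (e + L * eta)).
  have c0 : 0 <= (s ^+ r)^-1 * (e + L * eta) by rewrite mulr_ge0// invr_ge0 ltW.
  suff : NB a b (fun x => phi x ^+ 0 * (Q - P).[x]) ((s ^+ r)^-1 * (e + L * eta)).
    by apply: NB_ext => x _; rewrite expr0 mul1r hornerD hornerN.
  apply/NB_jacP => //; rewrite exprMn exprVn mulrC ler_pdivlMr; last by apply: exprn_gt0.
  by rewrite mulrC exprAC (le_trans HP)// add0n Qq.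
apply: NB_mono (NB_ext _ (NB_add HQ HQP)); last by move=> x _; ring.
rewrite sV -/L.
have -> : eps = L * eta * (1 + (s ^+ r)^-1).
  by rewrite /eta; field; rewrite !gt_eqF//= addr_gt0.
by rewrite le_eqVlt; apply/orP; left; apply/eqP; ring.
Qed.

End weighted.

(** * Weighted differences *)

Section finite_differences.
Context {R : realType}.

Lemma size_subr_shift (P : {poly R}) n : (size P <= n.+1)%N ->
  (size (P - (P \Po ('X + 1)))%R <= n)%N.
Proof.
move=> Pn; have [->|P0] := eqVneq P 0.
  by rewrite comp_poly0 subrr size_poly0.
have sX : size ('X + 1%:P : {poly R}) = 2%N by rewrite size_XaddC.
have sP : size (P \Po ('X + 1)) = size P by rewrite size_comp_poly2.
have lP : (P \Po ('X + 1))`_(size P).-1 = P`_(size P).-1.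
  rewrite -{1}sP -/(lead_coef _) lead_coef_comp ?sX//.
  by rewrite [lead_coef ('X + 1)]lead_coefXaddC expr1n mulr1.
rewrite -ltnS (leq_trans _ Pn)//.
have P1 : (0 < size P)%N by rewrite size_poly_gt0.
rewrite -(prednK P1) ltnS; apply/leq_sizeP => j.
rewrite leq_eqVlt => /predU1P[<-|Pj]; first by rewrite coefB lP subrr.
rewrite prednK// in Pj.
by rewrite coefB !nth_default ?subr0// sP.
Qed.

(** By Pascal's rule the difference of order r + 1 of P is the difference of order r of P - P(X +
    1), whose degree is smaller. *)
Lemma binomial_alt_sum_eq0 r (P : {poly R}) : (size P <= r)%N ->
  \sum_(i < r.+1) 'C(r, i)%:R * (-1) ^+ i * P.[i%:R] = 0.
Proof.
elim: r P => [|r IH] P Pr.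
  move: Pr; rewrite leqn0 size_poly_eq0 => /eqP ->.
  by rewrite big1// => i _; rewrite horner0 mulr0.
have := IH _ (size_subr_shift Pr).
under eq_bigr do rewrite hornerD hornerN horner_comp hornerD hornerX hornerC mulrBr.
rewrite sumrB => /eqP; rewrite subr_eq0 => /eqP E.
rewrite big_ord_recl/= bin0 expr0 mulr1.
under eq_bigr do rewrite /bump/= add1n binS natrD mulrDl mulrDl exprS mulN1r !mulrN !mulNr.
rewrite big_split/= !sumrN.
have EB : \sum_(i < r.+1) 'C(r, i)%:R * (-1) ^+ i * P.[i.+1%:R] =
    \sum_(i < r.+1) 'C(r, i)%:R * (-1) ^+ i * P.[i%:R].
  by rewrite E; apply: eq_bigr => i _; rewrite -natr1.
have EA : \sum_(i < r) 'C(r, i.+1)%:R * (-1) ^+ i.+1 * P.[i.+1%:R] =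
    - \sum_(i < r) 'C(r, i.+1)%:R * (-1) ^+ i * P.[i.+1%:R].
  by rewrite -sumrN; apply: eq_bigr => i _; rewrite exprS; ring.
rewrite EB big_ord_recr/= bin_small// mul0r mul0r addr0 [X in _ - X]big_ord_recl/=.
by rewrite bin0 expr0 EA; ring.
Qed.

Definition diff_moment (r m : nat) : R :=
  \sum_(i < r.+1) 'C(r, i)%:R * (-1) ^+ i * (i%:R - r%:R / 2) ^+ m.

Lemma diff_moment_eq0 r m : (m < r)%N -> diff_moment r m = 0.
Proof.
move=> mr; rewrite -[RHS](@binomial_alt_sum_eq0 r (('X - (r%:R / 2)%:P) ^+ m)).
  by apply: eq_bigr => i _; rewrite horner_exp !hornerE.
by rewrite size_exp_XsubC.
Qed.

Lemma diff_moment_le r m : `|diff_moment r m| <= 2 ^+ r * r%:R ^+ m.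
Proof.
apply: (le_trans (ler_norm_sum _ _ _)).
have -> : (2 ^+ r : R) = \sum_(i < r.+1) 'C(r, i)%:R.
  have := exprDn (1 : R) 1 r; rewrite -{1}[1 + 1]/(2%:R) => ->.
  by apply: eq_bigr => i _; rewrite !expr1n mul1r.
rewrite mulr_suml; apply: ler_sum => i _.
rewrite !normrM normrX normrN1 expr1n mulr1 normr_nat normrX ler_wpM2l//.
rewrite lerXn2r ?nnegrE// ler_norml.
have : (i%:R : R) <= r%:R by rewrite ler_nat -ltnS.
have : (0 : R) <= i%:R by [].
lra.
Qed.

Lemma taylor_diff r (Q : {poly R}) (x s : R) :
  \sum_(i < r.+1) 'C(r, i)%:R * (-1) ^+ i * Q.[x + (i%:R - r%:R / 2) * s] =
  \sum_(m < size Q) diff_moment r m * s ^+ m * Q^`N(m).[x].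
Proof.
under eq_bigr => i _ do rewrite (nderiv_taylor _ (mulrC _ _)).
under eq_bigr do rewrite mulr_sumr.
rewrite exchange_big/=; apply: eq_bigr => m _; rewrite /diff_moment !mulr_suml.
by apply: eq_bigr => i _; rewrite exprMn; ring.
Qed.

End finite_differences.

Section modulus_bounds.
Context {R : realType}.
Notation mu := (@lebesgue_measure R).
Variables (a b : R).
Hypothesis ab : a < b.
Notation phi := (step_weight a b).

(** All points x + c phi(x) with |c| <= k lie in [a, b]; the ends are excluded so that phi(x) >
    0. *)
Definition admissible (k x : R) : Prop :=
  [/\ a < x, x < b, k * phi x <= x - a & k * phi x <= b - x].

Lemma admissible_cc k x : admissible k x -> x \in `[a, b].
Proof. by case=> *; rewrite in_itv/= !ltW. Qed.

(** Equivalently k |phi'| <= 1/2, as phi' = (a + b - 2 x) / (2 phi). With u = x - a and v = b - x,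
    admissibility gives k^2 v <= u and k^2 u <= v, whence k^2 (v - u)^2 <= u v. *)
Lemma admissible_weight k x : 0 <= k -> admissible k x ->
  k * `|a + b - 2 * x| <= phi x.
Proof.
move=> k0 /[dup] /admissible_cc xab [ax xb h1 h2].
rewrite -(ler_pXn2r (n := 2))// ?nnegrE ?step_weight_ge0// ?mulr_ge0// exprMn.
rewrite real_normK ?num_real//.
have p0 : 0 <= phi x by exact: step_weight_ge0.
have p2 := step_weight_sqr xab.
have q1 : (k * phi x) ^+ 2 <= (x - a) ^+ 2 by rewrite lerXn2r ?nnegrE ?mulr_ge0// subr_ge0 ltW.
have q2 : (k * phi x) ^+ 2 <= (b - x) ^+ 2 by rewrite lerXn2r ?nnegrE ?mulr_ge0// subr_ge0 ltW.
rewrite p2 exprMn p2 in q1 q2 *.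
set u := x - a in q1 q2 *; set v := b - x in q1 q2 *.
have u0 : 0 < u by rewrite subr_gt0.
have v0 : 0 < v by rewrite subr_gt0.
have -> : a + b - 2 * x = v - u by rewrite /u /v; ring.
have r1 : k ^+ 2 * v <= u.
  by rewrite -(ler_pM2r u0) -mulrA (mulrC v) -expr2.
have r2 : k ^+ 2 * u <= v.
  by rewrite -(ler_pM2r v0) -mulrA -expr2.
have k2 : 0 <= k ^+ 2 by exact: sqr_ge0.
case: (leP u v) => uv; nra.
Qed.

(** A finite-difference form of k |phi'| <= 1/2: phi(x) - phi(y) is (x - y)(a + b - x - y) / (phi(x)
    + phi(y)), and a + b - x - y is the mean of the quantities bounded at x and at y. No point
    between x and y is consulted. *)
Lemma shift_expanding k c x y : 0 <= k -> `|c| <= k -> admissible k x -> admissible k y ->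
  2^-1 * `|x - y| <= `|(x + c * phi x) - (y + c * phi y)|.
Proof.
move=> k0 ck Ax Ay.
have Wx := admissible_weight k0 Ax; have Wy := admissible_weight k0 Ay.
have x2 := step_weight_sqr (admissible_cc Ax); have y2 := step_weight_sqr (admissible_cc Ay).
have px : 0 < phi x by rewrite sqrtr_gt0 mulr_gt0// subr_gt0; case: Ax.
have py : 0 < phi y by rewrite sqrtr_gt0 mulr_gt0// subr_gt0; case: Ay.
have key : k * `|phi x - phi y| <= 2^-1 * `|x - y|.
  have pp : 0 < phi x + phi y by rewrite addr_gt0.
  rewrite -(ler_pM2r pp) -mulrA -{1}(gtr0_norm pp) -normrM.
  have -> : (phi x - phi y) * (phi x + phi y) = (x - y) * (a + b - x - y).
    by rewrite -subr_sqr x2 y2; ring.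
  rewrite normrM mulrCA (mulrC 2^-1) -mulrA ler_wpM2l//.
  have -> : a + b - x - y = 2^-1 * (a + b - 2 * x) + 2^-1 * (a + b - 2 * y) by field.
  have := ler_normD (2^-1 * (a + b - 2 * x)) (2^-1 * (a + b - 2 * y)).
  rewrite !normrM (@ger0_norm _ 2^-1)// => T.
  apply: (le_trans (ler_wpM2l k0 T)); lra.
have : `|c * (phi x - phi y)| <= 2^-1 * `|x - y|.
  by rewrite normrM (le_trans _ key)// ler_wpM2r.
have -> : x + c * phi x - (y + c * phi y) = (x - y) + c * (phi x - phi y) by ring.
have := lerB_normD (x - y) (c * (phi x - phi y)).
lra.
Qed.

Lemma measurable_admissible k : measurable [set x | admissible k x].
Proof.
have mle (f : R -> R) : measurable_fun [set: R] f -> measurable [set x | 0 <= f x].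
  move=> mf; have := mf measurableT `[0, +oo[%classic (measurable_itv _).
  by rewrite setTI; congr measurable; apply/seteqP; split => x /=; rewrite in_itv/= andbT.
have -> : [set x | admissible k x] = `]a, b[ `&`
    ([set x | 0 <= x - a - k * phi x] `&` [set x | 0 <= b - x - k * phi x]).
  apply/seteqP; split => x /=; rewrite in_itv/= !subr_ge0.
    by move=> [-> -> -> ->].
  by move=> [/andP[? ?] [? ?]]; split.
apply: measurableI => //; apply: measurableI; apply: mle.
- by apply: measurable_funB; [exact: measurable_funB|apply: measurable_funM => //; exact: measurable_step_weight].
- by apply: measurable_funB; [exact: measurable_funB|apply: measurable_funM => //; exact: measurable_step_weight].
Qed.

Lemma NB_shift k c f e : 0 <= k -> `|c| <= k -> NB a b f e ->
  NB a b (fun x => if `[< admissible k x >] then f (x + c * phi x) else 0) (Num.sqrt 2 * e).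
Proof.
move=> k0 ck [mf e0 fe].
pose D := [set x | admissible k x].
have mD : measurable D by exact: measurable_admissible.
have sD : D `<=` `[a, b] by move=> x /admissible_cc.
pose psi x := x + c * phi x.
have mpsi (A : set R) : measurable_fun A psi.
  by apply: measurable_funD => //; apply: measurable_funM => //; exact: measurable_step_weight.
have Dpsi x : D x -> psi x \in `[a, b].
  move=> [ax xb h1 h2]; rewrite in_itv/= /psi.
  have : `|c * phi x| <= k * phi x by rewrite normrM (ger0_norm (step_weight_ge0 _ _ _)) ler_wpM2r// step_weight_ge0.
  rewrite ler_norml => /andP[]; lra.
have mfp : measurable_fun D (f \o psi).
  by apply: (measurable_comp (F := `[a, b])) => // _ [x Dx <-]; exact: Dpsi.
have E : (fun x => if `[< admissible k x >] then f (x + c * phi x) else 0) = (f \o psi) \_ D.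
  apply/funext => x; rewrite patchE; case: asboolP => Ax.
    by rewrite mem_set.
  by rewrite memNset.
rewrite E; split.
- by apply: measurable_funTS; apply/(measurable_restrictT _ _).1.
- by rewrite mulr_ge0// sqrtr_ge0.
have -> : (\int[mu]_(x in `[a, b]) ((((f \o psi) \_ D) x) ^+ 2)%:E =
    \int[mu]_(x in D) ((f (psi x)) ^+ 2)%:E)%E.
  rewrite -[in RHS](setIidr sD) integral_mkcondr; apply: eq_integral => x _.
  by rewrite !patchE; case: ifP => // _; rewrite expr0n.
have half0 : (0 : R) < 2^-1 by [].
apply: (le_trans (@expanding_integral R D `[a, b] psi 2^-1 (fun x => ((f x) ^+ 2)%:E) half0 mD _ (mpsi _) _ _ Dpsi _)) => //.
- exact: msqr.
- by move=> x; rewrite lee_fin sqr_ge0.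
- by move=> x y Dx Dy; exact: shift_expanding ck Dx Dy.
- by rewrite invrK exprMn sqr_sqrtr// (EFinM 2) lee_wpmul2l.
Qed.

Definition wdiff (r : nat) (h : R) (f : R -> R) (x : R) : R :=
  sym_diff a b r (h * phi x) f x.

(* [wdiff] away from the endpoints, so that [step_weight] does not vanish. *)
Definition wdiff_int (r : nat) (h : R) (f : R -> R) (x : R) : R :=
  if `[< admissible (r%:R * h / 2) x >]
  then \sum_(i < r.+1) 'C(r, i)%:R * (-1) ^+ i * f (x + (i%:R - r%:R / 2) * (h * phi x))
  else 0.

Lemma wdiff_intE r h f x : 0 <= h -> x \in `]a, b[ -> wdiff r h f x = wdiff_int r h f x.
Proof.
move=> h0; rewrite in_itv/= => /andP[ax xb]; rewrite /wdiff /sym_diff /wdiff_int.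
have p0 := step_weight_ge0 a b x.
have E : r%:R * (h * phi x) / 2 = r%:R * h / 2 * phi x by rewrite -!mulrA (mulrC (phi x)).
have rh0 : 0 <= r%:R * h / 2 * phi x by rewrite !mulr_ge0.
rewrite E; congr (if _ then _ else _).
apply/andP/asboolP; rewrite !in_itv/=.
  move=> [/andP[_ h1] /andP[h2 _]]; split => //; lra.
by move=> [_ _ h1 h2]; split; apply/andP; split; lra.
Qed.

Lemma measurable_wdiff_int r h f : measurable_fun [set: R] f ->
  measurable_fun [set: R] (wdiff_int r h f).
Proof.
move=> mf; pose D := [set x | admissible (r%:R * h / 2) x].
have -> : wdiff_int r h f =
    (fun x => \sum_(i < r.+1) 'C(r, i)%:R * (-1) ^+ i * f (x + (i%:R - r%:R / 2) * (h * phi x))) \_ D.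
  apply/funext => x; rewrite patchE /wdiff_int; case: asboolP => Ax.
    by rewrite mem_set.
  by rewrite memNset.
apply/(measurable_restrictT _ _).1; first exact: measurable_admissible.
apply: measurable_sum => i; apply: measurable_funM => //.
apply: measurable_funTS; apply: (measurableT_comp mf).
apply: measurable_funD => //; apply: measurable_funM => //; apply: measurable_funM => //.
exact: measurable_step_weight.
Qed.

Lemma NB_wdiff_int r h f e : 0 <= h -> NB a b f e ->
  NB a b (wdiff_int r h f) (2 ^+ r * Num.sqrt 2 * e).
Proof.
move=> h0 Hf; set k := r%:R * h / 2.
have k0 : 0 <= k by rewrite /k divr_ge0// mulr_ge0.
pose c (i : nat) := (i%:R - r%:R / 2) * h.
have ck i : (i < r.+1)%N -> `|c i| <= k.
  rewrite ltnS => ir; have : (i%:R : R) <= r%:R by rewrite ler_nat.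
  have i0 : (0 : R) <= i%:R by []. move=> iR.
  rewrite /c /k normrM (ger0_norm h0) mulrAC ler_wpM2r// ler_norml; lra.
pose F (i : nat) x := 'C(r, i)%:R * (-1) ^+ i *
  (if `[< admissible k x >] then f (x + c i * phi x) else 0).
have HF i : (i < r.+1)%N -> NB a b (F i) ('C(r, i)%:R * (Num.sqrt 2 * e)).
  move=> ir; have := NB_scale ('C(r, i)%:R * (-1) ^+ i) (NB_shift k0 (ck i ir) Hf).
  by rewrite normrM normrX normrN1 expr1n mulr1 normr_nat.
have := NB_sum HF; rewrite -mulr_suml.
have -> : \sum_(i < r.+1) 'C(r, i)%:R = (2 ^+ r : R).
  have := exprDn (1 : R) 1 r; rewrite -{1}[1 + 1]/(2%:R) => ->.
  by apply: eq_bigr => i _; rewrite !expr1n mul1r.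
rewrite mulrA; apply: NB_ext => x _; rewrite /F /wdiff_int -/k; case: asboolP => Ax.
  by apply: eq_bigr => i _; rewrite /c !mulrA.
by rewrite big1// => i _; rewrite mulr0.
Qed.

(** In Taylor's formula the moments of order below r vanish, and Bernstein's inequality bounds the
    m-th term by 2^r q^m e with q = 2 r n h, the factor 1 / m! being dropped. As q <= 1/2, the
    series is at most twice its first term. *)
Lemma NB_wdiff_int_poly_small r h n (Q : {poly R}) e : 0 <= h -> (0 < n)%N ->
  (size Q <= n)%N -> 4 * r%:R * (n%:R * h) <= 1 -> NB a b (horner Q) e ->
  NB a b (wdiff_int r h (horner Q)) (2 ^+ r * 2 * (2 * r%:R * (n%:R * h)) ^+ r * e).
Proof.
move=> h0 n0 Qn small HQ; have e0 : 0 <= e by case: HQ.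
pose q := 2 * r%:R * (n%:R * h).
have q0 : 0 <= q by rewrite /q !mulr_ge0.
have q2 : 2 * q <= 1 by rewrite /q; lra.
pose F (m : nat) x := diff_moment r m * h ^+ m * (m`!%:R)^-1 * (phi x ^+ m * Q^`(m).[x]).
pose E (m : nat) := if (m < r)%N then 0 else 2 ^+ r * q ^+ m * e.
have HF m : (m < size Q)%N -> NB a b (F m) (E m).
  move=> _; rewrite /E; case: ifP => mr.
    by apply: NB_ext (NB0 a b) => x _; rewrite /F diff_moment_eq0// !mul0r.
  have := NB_scale (diff_moment r m * h ^+ m * (m`!%:R)^-1)
    (NB_bernstein ab m (leq_trans Qn (leqnSn n)) HQ).
  apply: NB_mono; rewrite mulrA ler_wpM2r// !normrM normfV normrX (ger0_norm h0) normr_nat.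
  have f1 : (m`!%:R : R)^-1 <= 1 by rewrite invf_le1 ?ltr0n ?ler1n ?fact_gt0.
  have f0 : 0 <= (m`!%:R : R)^-1 by rewrite invr_ge0.
  apply: (@le_trans _ _ (2 ^+ r * r%:R ^+ m * h ^+ m * 1 * (2 * n%:R) ^+ m)).
    rewrite ler_wpM2r ?exprn_ge0 ?mulr_ge0// ler_pM ?mulr_ge0 ?exprn_ge0//.
    by rewrite ler_wpM2r ?exprn_ge0// diff_moment_le.
  by rewrite le_eqVlt; apply/orP; left; apply/eqP; rewrite /q !exprMn; ring.
have sumE : \sum_(m < size Q) E m <= 2 ^+ r * 2 * q ^+ r * e.
  (* The partial geometric sum in closed form, so that induction on N closes; the terms with m < r
     are 0. *)
  suff : forall N, \sum_(m < N) E m <= 2 ^+ r * e * q ^+ r * (2 - (if (N <= r)%N then 2 else (1/2) ^+ (N - r).-1)).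
    move=> /(_ (size Q)) H; apply: (le_trans H).
    have -> : 2 ^+ r * 2 * q ^+ r * e = 2 ^+ r * e * q ^+ r * 2 by ring.
    rewrite ler_wpM2l ?mulr_ge0 ?exprn_ge0//; case: ifP => _; first lra.
    by rewrite gerBl exprn_ge0//; lra.
  have h0' : (0 : R) <= 1 / 2 by lra.
  elim=> [|N IH]; first by rewrite big_ord0 subrr mulr0.
  rewrite big_ord_recr/= /E; case: ltnP => Nr.
    by rewrite addr0 (le_trans IH)// (ltnW Nr) subrr mulr0.
  apply: (le_trans (lerD IH (le_refl _))).
  have -> : q ^+ N = q ^+ r * q ^+ (N - r) by rewrite -exprD subnKC.
  have qN : q ^+ (N - r) <= (1 / 2) ^+ (N - r).
    by rewrite lerXn2r ?nnegrE//; lra.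
  have c0 : 0 <= 2 ^+ r * e * q ^+ r by rewrite !mulr_ge0// exprn_ge0.
  have -> : 2 ^+ r * (q ^+ r * q ^+ (N - r)) * e = 2 ^+ r * e * q ^+ r * q ^+ (N - r) by ring.
  rewrite -mulrDr ler_wpM2l// subSn//=.
  move: Nr; rewrite leq_eqVlt => /predU1P[<-|rN].
    by rewrite leqnn subnn !expr0; lra.
  rewrite leqNgt rN /=.
  have E1 : (1 / 2) ^+ (N - r) = 1 / 2 * (1 / 2) ^+ (N - r).-1 :> R.
    by rewrite -exprS prednK// subn_gt0.
  by move: qN; rewrite E1; move: ((1/2) ^+ (N - r).-1) (q ^+ (N - r)) => u v; lra.
have Hsum : NB a b (fun x => \sum_(m < size Q) F m x) (2 ^+ r * 2 * q ^+ r * e).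
  exact: NB_mono sumE (NB_sum HF).
apply: NB_dom Hsum.
  by apply: measurable_funTS; apply: measurable_wdiff_int; exact: measurable_horner.
move=> x xab; rewrite /wdiff_int; case: asboolP => Ax; last by rewrite normr0.
rewrite taylor_diff le_eqVlt; apply/orP; left; apply/eqP; congr (`|_|).
apply: eq_bigr => m _; rewrite /F nderivn_def hornerMn exprMn -[in RHS]mulr_natr.
have : m`!%:R != 0 :> R by rewrite pnatr_eq0 -lt0n fact_gt0.
by move=> f0; field.
Qed.

(** When 4 r n h > 1 there is no smallness to exploit, but then (4 r)^r (n h)^r >= 1 and the bound
    valid for arbitrary functions suffices. *)
Lemma NB_wdiff_poly r : exists2 B, 0 <= B & forall h n (Q : {poly R}) e,
  0 <= h -> (0 < n)%N -> (size Q <= n)%N -> NB a b (horner Q) e ->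
  NB a b (wdiff_int r h (horner Q)) (B * (n%:R * h) ^+ r * e).
Proof.
exists (2 ^+ r * 2 * (4 * r%:R) ^+ r + 2 ^+ r * Num.sqrt 2 * (4 * r%:R) ^+ r + 2 ^+ r * Num.sqrt 2).
  by rewrite !addr_ge0// !mulr_ge0// ?exprn_ge0// ?mulr_ge0// sqrtr_ge0.
move=> h n Q e h0 n0 Qn HQ; have e0 : 0 <= e by case: HQ.
have nh0 : 0 <= n%:R * h by rewrite mulr_ge0.
have s20 : 0 <= Num.sqrt (2 : R) by exact: sqrtr_ge0.
have P0 : 0 <= (4 * r%:R : R) by rewrite mulr_ge0.
have X0 : 0 <= (n%:R * h) ^+ r by rewrite exprn_ge0.
have C0 : 0 <= (2 : R) ^+ r by rewrite exprn_ge0.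
have D0 : 0 <= (4 * r%:R : R) ^+ r by rewrite exprn_ge0.
case: (leP (4 * r%:R * (n%:R * h)) 1) => small.
  apply: NB_mono (NB_wdiff_int_poly_small h0 n0 Qn small HQ).
  rewrite ler_wpM2r//; apply: (@le_trans _ _ (2 ^+ r * 2 * (4 * r%:R) ^+ r * (n%:R * h) ^+ r)).
    rewrite -[leRHS]mulrA -exprMn ler_wpM2l ?mulr_ge0//.
    by rewrite lerXn2r ?nnegrE ?mulr_ge0// ler_wpM2r// ler_wpM2r//; lra.
  by rewrite ler_wpM2r// -addrA lerDl addr_ge0// !mulr_ge0.
apply: NB_mono (NB_wdiff_int r h0 HQ); rewrite ler_wpM2r//.
have big : 1 <= (4 * r%:R) ^+ r * (n%:R * h) ^+ r.
  by rewrite -exprMn exprn_ege1// ltW.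
apply: (@le_trans _ _ (2 ^+ r * Num.sqrt 2 * (4 * r%:R) ^+ r * (n%:R * h) ^+ r)).
  by rewrite -(mulrA _ ((4 * r%:R) ^+ r)) ler_peMr// mulr_ge0.
by rewrite ler_wpM2r// addrAC lerDr addr_ge0// !mulr_ge0.
Qed.

End modulus_bounds.

Section powers.
Context {R : realType}.

Lemma powR_inv (t al : R) : 0 < t -> t^-1 `^ al = (t `^ al)^-1.
Proof. by move=> t0; rewrite -(powR_inv1 (ltW t0)) -powRrM mulN1r powRN. Qed.

Lemma powR_exp (t al : R) n : 0 <= t -> (t ^+ n) `^ al = (t `^ al) ^+ n.
Proof.
by move=> t0; rewrite -powR_mulrn// -powRrM mulrC powRrM powR_mulrn// powR_ge0.
Qed.

End powers.

(** * Summing near-best polynomials over dyadic degrees *)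

Section dyadic.
Context {R : realType}.
Variables (a b : R) (Phi : (R -> R) -> R -> Prop) (B theta : R) (r : nat).
Hypothesis PhiD : forall f g e e', Phi f e -> Phi g e' -> Phi (fun x => f x + g x) (e + e').
Hypothesis Phi_mono : forall f e e', e <= e' -> Phi f e -> Phi f e'.
Hypothesis Phi_bounded : forall f e, NB a b f e -> Phi f (B * e).
Hypothesis Phi_poly : forall n (Q : {poly R}) e, (0 < n)%N -> (size Q <= n)%N ->
  NB a b (horner Q) e -> Phi (horner Q) (B * (n%:R * theta) ^+ r * e).
Hypothesis B0 : 0 <= B.
Hypothesis theta0 : 0 < theta.

(** [Phi f e] abstracts a bound e on a subadditive quantity of f; in the applications x = 2^alpha
    and y = 2^(r - alpha). The block between levels i - 1 and i has norm O(x^-i), so [Phi_poly]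
    bounds it by a multiple of theta^r 2^(r i) x^-i = theta^r y^i, and the geometric sum is
    dominated by its last term. Only rates up to level J are assumed, so that the lemma can be used
    inside an induction on the level. *)
Lemma dyadic_approximant (f : R -> R) (x y K : R) (J : nat) :
  1 <= x -> 1 < y -> y * x = 2 ^+ r -> 0 < K -> NB a b f K ->
  (forall i, (i <= J)%N -> EB a b f (2 ^ i) (K * x^-1 ^+ i)) ->
  exists P : {poly R}, [/\ (size P <= 2 ^ J)%N,
    NB a b (fun z => f z - P.[z]) (2 * K * x^-1 ^+ J) &
    Phi (horner P) (B * (3 + 2 * x) * K * theta ^+ r * (y ^+ J * (y / (y - 1))))].
Proof.
move=> x1 y1 yx K0 Hf; have x0 : 0 < x by exact: lt_le_trans x1.
have y10 : 0 < y - 1 by lra.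
have M0 : 0 <= B * (3 + 2 * x) * K * theta ^+ r.
  by rewrite !mulr_ge0 ?exprn_ge0// ?ltW//; lra.
have xV i : 0 < x^-1 ^+ i by rewrite exprn_gt0// invr_gt0.
have two i : (2 ^ i)%:R * theta = 2 ^+ i * theta :> R by rewrite natrX.
elim: J => [|J IH] HJ.
  have [P sP HP] := HJ 0%N (leqnn _) _ K0.
  rewrite expr0 mulr1 in HP; exists P; split => //.
    by apply: NB_mono HP; rewrite expr0; lra.
  have HPn : NB a b (horner P) (3 * K).
    apply: (@NB_ext _ _ _ (fun z => f z - (f z - P.[z]))); first by move=> z _; ring.
    by apply: NB_mono (NB_sub Hf HP); lra.
  have := Phi_poly (n := 1) isT sP HPn; apply: Phi_mono.
  rewrite mul1r expr0 mul1r.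
  apply: (@le_trans _ _ (B * (3 + 2 * x) * K * theta ^+ r * 1)).
    have c0 : 0 <= B * K * theta ^+ r by rewrite !mulr_ge0 ?exprn_ge0// ltW.
    have -> : B * theta ^+ r * (3 * K) = 3 * (B * K * theta ^+ r) by ring.
    have -> : B * (3 + 2 * x) * K * theta ^+ r * 1 = (3 + 2 * x) * (B * K * theta ^+ r) by ring.
    by rewrite ler_wpM2r//; lra.
  by rewrite ler_wpM2l// ler_pdivlMr// mul1r; lra.
have [P [sP HP PhiP]] := IH (fun i iJ => HJ i (leqW iJ)).
have [Q sQ HQ] := HJ J.+1 (leqnn _) _ (mulr_gt0 K0 (xV J.+1)).
exists Q; split => //; first by apply: NB_mono HQ; lra.
(* P is within 2 K x^-J = 2 x K x^-(J+1) of f, and Q within 2 K x^-(J+1); the constant 3 + 2 x also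
   covers level 0, where P alone has norm at most 3 K. *)
have HQP : NB a b (horner (Q - P)) ((3 + 2 * x) * K * x^-1 ^+ J.+1).
  apply: (@NB_ext _ _ _ (fun z => (f z - P.[z]) - (f z - Q.[z]))).
    by move=> z _; rewrite hornerD hornerN; ring.
  apply: NB_mono (NB_sub HP HQ).
  have -> : x^-1 ^+ J = x * x^-1 ^+ J.+1 by rewrite exprS mulrA divff ?mul1r// gt_eqF.
  have : 0 <= K * x^-1 ^+ J.+1 by rewrite mulr_ge0// ltW.
  by move: (x^-1 ^+ J.+1) => u; lra.
have sQP : (size (Q - P)%R <= 2 ^ J.+1)%N.
  rewrite (leq_trans (size_polyD _ _))// geq_max sQ size_polyN (leq_trans sP)//.
  by rewrite leq_exp2l.
have pos2 : (0 < 2 ^ J.+1)%N by rewrite expn_gt0.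
have := PhiD PhiP (Phi_poly pos2 sQP HQP).
have -> : (fun z => P.[z] + (Q - P).[z]) = horner Q.
  by apply/funext => z; rewrite hornerD hornerN; ring.
apply: Phi_mono; rewrite le_eqVlt; apply/orP; left; apply/eqP.
rewrite two exprMn -exprM mulnC exprM -yx exprMn.
have xx : x ^+ J.+1 * x^-1 ^+ J.+1 = 1 by rewrite -exprMn divff ?expr1n// gt_eqF.
have -> : B * (y ^+ J.+1 * x ^+ J.+1 * theta ^+ r) * ((3 + 2 * x) * K * x^-1 ^+ J.+1) =
  B * y ^+ J.+1 * theta ^+ r * (3 + 2 * x) * K * (x ^+ J.+1 * x^-1 ^+ J.+1) by ring.
rewrite xx exprS; field.
by rewrite gt_eqF.
Qed.

Lemma dyadic_level : theta <= 1 -> exists J : nat, 2 ^+ J <= theta^-1 /\ theta^-1 < 2 ^+ J.+1.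
Proof.
move=> t1; have tV : 1 <= theta^-1 by rewrite invf_ge1.
pose N := Num.truncn theta^-1.
have tV0 : 0 <= theta^-1 by rewrite invr_ge0 ltW.
have /andP[N1 N2] := truncn_itv tV0.
have N0 : (0 < N)%N by rewrite truncn_gt0.
exists (trunc_log 2 N); split.
  by apply: le_trans N1; rewrite -natrX ler_nat trunc_logP.
by apply: (lt_le_trans N2); rewrite -natrX ler_nat trunc_log_ltn.
Qed.

(** The level balances two costs: with 2^J <= 1 / theta < 2^(J+1), the remainder costs x^-J <= x
    theta^alpha and the polynomial part theta^r y^J <= theta^alpha. The condition alpha < r gives y
    > 1, so that the blocks sum geometrically. *)
Lemma dyadic_sum (f : R -> R) (alpha K : R) : 0 < alpha -> alpha < r%:R -> theta <= 1 ->
  0 < K -> NB a b f K ->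
  (forall i, EB a b f (2 ^ i) (K * (2 `^ alpha)^-1 ^+ i)) ->
  Phi f ((B * (2 * 2 `^ alpha + (3 + 2 * 2 `^ alpha) * (2 `^ (r%:R - alpha) / (2 `^ (r%:R - alpha) - 1))))
    * K * theta `^ alpha).
Proof.
move=> al0 alr t1 K0 Hf HE; set x := 2 `^ alpha; set y := 2 `^ (r%:R - alpha).
have x1 : 1 <= x by rewrite -(powRr0 2) ler_powR// ?ler1n// ltW.
have y1 : 1 < y.
  have -> : 1 = 1 `^ (r%:R - alpha) :> R by rewrite powR1.
  by rewrite /y gt0_ltr_powR ?subr_gt0 ?nnegrE// ltr1n.
have yx : y * x = 2 ^+ r.
  rewrite /y /x -powRD; last by rewrite pnatr_eq0 implybT.
  by rewrite subrK powR_mulrn.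
have [J [J1 J2]] := dyadic_level t1.
have [P [sP HP PhiP]] := dyadic_approximant (J := J) x1 y1 yx K0 Hf (fun i _ => HE i).
have := PhiD (Phi_bounded HP) PhiP.
have -> : (fun z => f z - P.[z] + P.[z]) = f by apply/funext => z; rewrite subrK.
apply: Phi_mono.
have x0 : 0 < x by exact: lt_le_trans x1.
have y0 : 0 < y by exact: lt_trans y1.
have tal : 0 < theta `^ alpha by exact: powR_gt0.
have tra : 0 < theta `^ (r%:R - alpha) by exact: powR_gt0.
have xJ : x^-1 ^+ J <= x * theta `^ alpha.
  have : theta^-1 `^ alpha <= (2 ^+ J.+1) `^ alpha.
    by rewrite ge0_ler_powR ?nnegrE ?invr_ge0 ?exprn_ge0// ltW.
  rewrite powR_inv// powR_exp// -/x exprS => H.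
  have xJ0 : 0 < x ^+ J by rewrite exprn_gt0.
  rewrite exprVn -(ler_pM2l xJ0) divff ?gt_eqF//.
  by rewrite mulrA (mulrC (x ^+ J)) -ler_pdivrMr// mul1r.
have yJ : theta ^+ r * y ^+ J <= theta `^ alpha.
  have : (2 ^+ J) `^ (r%:R - alpha) <= theta^-1 `^ (r%:R - alpha).
    by rewrite ge0_ler_powR ?nnegrE ?invr_ge0 ?exprn_ge0// ?subr_ge0 ltW.
  rewrite powR_inv// powR_exp// -/y => H.
  have -> : theta ^+ r = theta `^ alpha * theta `^ (r%:R - alpha).
    rewrite -powRD; last by rewrite (gt_eqF theta0) implybT.
    by rewrite addrC subrK powR_mulrn// ltW.
  rewrite -mulrA -[leRHS]mulr1 (ler_wpM2l (ltW tal))//.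
  by rewrite mulrC -ler_pdivlMr// mul1r.
have w0 : 0 <= y / (y - 1) by rewrite divr_ge0// ?subr_ge0 ltW.
apply: (@le_trans _ _ (B * (2 * K * (x * theta `^ alpha)) +
    B * (3 + 2 * x) * K * (theta `^ alpha) * (y / (y - 1)))).
  apply: lerD.
    by rewrite ler_wpM2l// ler_wpM2l// mulr_ge0// ltW.
  rewrite (mulrA _ (y ^+ J)) ler_wpM2r// -(mulrA _ (theta ^+ r)) ler_wpM2l//.
  by rewrite !mulr_ge0// ?ltW//; lra.
by rewrite le_eqVlt; apply/orP; left; apply/eqP; ring.
Qed.

End dyadic.

(** * Averages with a variable step *)

Lemma within_cont_sum {R : realType} (A : set R) n (F : nat -> R -> R) :
  (forall i, {within A, continuous (F i)}) ->
  {within A, continuous (fun x => \sum_(i < n) F i x)}.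
Proof.
move=> cF; elim: n => [|n IH].
  have -> : (fun x => \sum_(i < 0) F i x) = (fun=> 0) by apply/funext => x; rewrite big_ord0.
  exact: within_cont_cst.
have -> : (fun x => \sum_(i < n.+1) F i x) = (fun x => \sum_(i < n) F i x + F n x).
  by apply/funext => x; rewrite big_ord_recr.
exact: within_contD.
Qed.

Section real_derivatives.
Context {R : realType}.
Implicit Types (f g : R -> R).

Lemma derM f g (y df dg : R) : is_derive y (1 : R) f df -> is_derive y (1 : R) g dg ->
  is_derive y (1 : R) (fun z => f z * g z) (df * g y + f y * dg).
Proof.
move=> Hf Hg; apply: (is_derive_eq (is_deriveM Hf Hg)).
by rewrite /GRing.scale/=; ring.
Qed.

Lemma derZ k f (y df : R) : is_derive y (1 : R) f df ->
  is_derive y (1 : R) (fun z => k * f z) (k * df).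
Proof. by move=> Hf; exact: (is_deriveZ k Hf). Qed.

Lemma derX n f (y df : R) : is_derive y (1 : R) f df ->
  is_derive y (1 : R) (fun z => f z ^+ n) (n%:R * f y ^+ n.-1 * df).
Proof.
move=> Hf; have -> : (fun z => f z ^+ n) = f ^+ n.
  by apply/funext => z; elim: n => [|n IH]; rewrite ?expr0// !exprS IH.
exact: is_deriveX.
Qed.

Lemma derV f (y df : R) : f y != 0 -> is_derive y (1 : R) f df ->
  is_derive y (1 : R) (fun z => (f z)^-1) (- df / f y ^+ 2).
Proof.
move=> f0 Hf; apply: (is_derive_eq (is_deriveV f0 Hf)).
by rewrite /GRing.scale/=; ring.
Qed.

Lemma der_comp f g (y df dg : R) : is_derive (g y) (1 : R) f df -> is_derive y (1 : R) g dg ->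
  is_derive y (1 : R) (fun z => f (g z)) (df * dg).
Proof. by move=> Hf Hg; exact: (is_derive1_comp Hf Hg). Qed.

End real_derivatives.

Section moments.
Context {R : realType}.
Implicit Types (f eta : {poly R}).

(** The integral of eta(z) f(y + s z) over z in [0, 1]. As f is a polynomial, it is a finite sum of
    Taylor coefficients against moments of eta, hence differentiable term by term. *)
Definition mom eta f (y s : R) : R := pint 0 1 (eta * (f \Po (y%:P + s *: 'X))).

Lemma comp_taylor f (y s : R) : f \Po (y%:P + s *: 'X) =
  \sum_(m < size f) (f^`N(m).[y] * s ^+ m) *: 'X^m.
Proof.
rewrite /comp_poly (nderiv_taylor _ (mulrC _ _)) size_map_inj_poly ?polyC0//; last exact: polyC_inj.
by apply: eq_bigr => m _; rewrite nderivn_map horner_map exprZn mul_polyC scalerA.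
Qed.

Lemma pint_sum n (F : nat -> {poly R}) (p q : R) :
  pint p q (\sum_(i < n) F i) = \sum_(i < n) pint p q (F i).
Proof.
elim: n => [|n IH]; last by rewrite !big_ord_recr/= pintD IH.
by rewrite !big_ord0 -(scale0r 0) pintZ mul0r.
Qed.

Lemma momE eta f y s : mom eta f y s =
  \sum_(m < size f) f^`N(m).[y] * s ^+ m * pint 0 1 (eta * 'X^m).
Proof.
rewrite /mom comp_taylor mulr_sumr (pint_sum _ (fun m => eta * ((f^`N(m).[y] * s ^+ m) *: 'X^m))).
by apply: eq_bigr => m _; rewrite -scalerAr pintZ.
Qed.

Lemma mom_parts1 eta m : eta.[0] = 0 -> eta.[1] = 0 ->
  pint 0 1 (eta^`() * 'X^m) = - (m%:R * pint 0 1 (eta * 'X^(m.-1))).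
Proof.
move=> e0 e1; apply/eqP; rewrite -addr_eq0 -pintZ -pintD; apply/eqP.
have -> : eta^`() * 'X^m + m%:R *: (eta * 'X^(m.-1)) = (eta * 'X^m)^`().
  by rewrite derivM derivXn scaler_nat mulrnAr.
by rewrite pint_deriv !hornerM e0 e1 !mul0r subrr.
Qed.

Lemma mom_parts2 eta m : eta.[1] = 0 ->
  pint 0 1 (('X * eta)^`() * 'X^m) = - (m%:R * pint 0 1 (eta * 'X^m)).
Proof.
move=> e1; rewrite mom_parts1 ?hornerM ?hornerX ?mul0r ?e1 ?mulr0//.
case: m => [|m]; first by rewrite !mul0r.
by rewrite /= (mulrC 'X) -mulrA -exprS.
Qed.

Lemma nderivn_deriv f m : (f^`N(m))^`() = m.+1%:R *: f^`N(m.+1).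
Proof.
apply/polyP => j; rewrite coef_deriv !coef_nderivn coefZ coef_nderivn -mulrnA addnS.
rewrite addSn mulr_natl -mulrnA; congr (_ *+ _).
by rewrite [RHS]mulnC mul_bin_left subSn ?leq_addr// addKn mulnC.
Qed.

(** Differentiation in y produces f', which is (i del y)^-1 times a derivative in z; integration by
    parts moves it onto eta, which vanishes at 0 and 1. The cost is a factor 1 / del y and no
    derivative of f. *)
Lemma is_derive_mom eta f (i y dd : R) (del : R -> R) : eta.[0] = 0 -> eta.[1] = 0 ->
  i != 0 -> del y != 0 -> is_derive y (1 : R) del dd ->
  is_derive y (1 : R) (fun z => mom eta f z (i * del z))
    ((- i^-1 * mom eta^`() f y (i * del y) - dd * mom ('X * eta)^`() f y (i * del y)) / del y).
Proof.
move=> e0 e1 i0 d0 Hd.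
have -> : (fun z => mom eta f z (i * del z)) =
    \sum_(m < size f) (fun z => f^`N(m).[z] * (i * del z) ^+ m * pint 0 1 (eta * 'X^m)).
  by apply/funext => z; rewrite momE fct_sumE.
pose D (m : nat) := (m.+1%:R * f^`N(m.+1).[y] * (i * del y) ^+ m +
   f^`N(m).[y] * (m%:R * (i * del y) ^+ m.-1 * (i * dd))) * pint 0 1 (eta * 'X^m).
have HD (m : 'I_(size f)) : is_derive y (1 : R)
    (fun z => f^`N(m).[z] * (i * del z) ^+ m * pint 0 1 (eta * 'X^m)) (D m).
  have d1 : is_derive y (1 : R) (fun z => f^`N(m).[z]) (m.+1%:R * f^`N(m.+1).[y]).
    by rewrite -hornerZ -nderivn_deriv; exact: is_derive_poly.
  have d2 : is_derive y (1 : R) (fun z => i * del z) (i * dd).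
    by apply: (is_deriveZ i Hd).
  have d3 := is_deriveX m d2.
  have pw : (fun z => i * del z) ^+ m = (fun z => (i * del z) ^+ m).
    by apply/funext => z; elim: (nat_of_ord m) => [|k IH]; rewrite ?expr0// !exprS -IH.
  rewrite pw in d3.
  have d5 := is_deriveZ (pint 0 1 (eta * 'X^m)) (is_deriveM d1 d3).
  have -> : (fun z => f^`N(m).[z] * (i * del z) ^+ m * pint 0 1 (eta * 'X^m)) =
    pint 0 1 (eta * 'X^m) *: ((fun z => f^`N(m).[z]) * (fun z => (i * del z) ^+ m)).
    by apply/funext => z; rewrite mulrC.
  by apply: (is_derive_eq d5); rewrite /D /GRing.scale/=; ring.
apply: (is_derive_eq (is_derive_sum HD)).
pose G (m : nat) := i^-1 * f^`N(m).[y] * (i * del y) ^+ m * (m%:R * pint 0 1 (eta * 'X^(m.-1))).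
pose H (m : nat) := dd * f^`N(m).[y] * (i * del y) ^+ m * (m%:R * pint 0 1 (eta * 'X^m)).
have DE (m : nat) : D m * del y = G m.+1 + H m.
  rewrite /D /G /H; case: m => [|m] /=; last by rewrite !exprS; field.
  by rewrite expr1 expr0 !mul0r; field.
(* Shifting the index is free: G 0 = 0, and the Taylor coefficient of order [size f] vanishes. *)
have EG : \sum_(m < size f) G m.+1 = \sum_(m < size f) G m.
  have : \sum_(m < (size f).+1) G m = \sum_(m < size f) G m + G (size f) by rewrite big_ord_recr.
  rewrite big_ord_recl {1}/G mul0r mulr0 add0r => ->.
  by rewrite /G [f^`N(_)]nderivn_poly0// horner0 mulr0 !mul0r addr0.
apply: (mulIf d0); rewrite divfK// mulr_suml.
under eq_bigr do rewrite DE.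
rewrite big_split/= EG !momE !mulr_sumr -sumrB -big_split/=; apply: eq_bigr => m _.
by rewrite mom_parts1// mom_parts2// /G /H; ring.
Qed.

End moments.

Section smoothing_coefficients.
Context {R : realType}.
Variables (a b c rr : R).
Hypotheses (ab : a < b) (c0 : 0 < c).

(** The t^2 under the root makes [Bs] positive and differentiable up to [a], and at least c t^2.
    [Es] is (b - y) Bs', so that [stepw] has derivative Es - Bs. *)
Definition Bs (t y : R) : R := c * t * Num.sqrt (y - a + t ^+ 2).
Definition Es (t y : R) : R := c ^+ 2 * t ^+ 2 * (b - y) / (2 * Bs t y).
Definition stepw (t y : R) : R := Bs t y * (b - y).

Lemma stepwE t y : stepw t y = Bs t y * (b - y). Proof. by []. Qed.

(* Coefficients generated by 1, b - y, Bs and Es: closed under stepw * d/dy, and bounded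
   uniformly in the step t; keeping them as syntax makes the uniformity automatic. *)
Inductive coef :=
  | Cst of R | Cv | Cb | Ce | Cadd of coef & coef | Cmul of coef & coef.

Fixpoint ceval (t y : R) (e : coef) : R :=
  match e with
  | Cst x => x | Cv => b - y | Cb => Bs t y | Ce => Es t y
  | Cadd e1 e2 => ceval t y e1 + ceval t y e2
  | Cmul e1 e2 => ceval t y e1 * ceval t y e2
  end.

Fixpoint cder (e : coef) : coef :=
  match e with
  | Cst _ => Cst 0
  | Cv => Cmul (Cst (-1)) (Cmul Cb Cv)
  | Cb => Cmul Ce Cb
  | Ce => Cadd (Cmul (Cst (-1)) (Cmul Ce Cb)) (Cmul (Cst (-1)) (Cmul Ce Ce))
  | Cadd e1 e2 => Cadd (cder e1) (cder e2)
  | Cmul e1 e2 => Cadd (Cmul (cder e1) e2) (Cmul e1 (cder e2))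
  end.

Lemma BsE t y : Bs t y = c * t * Num.sqrt (y - a + t ^+ 2). Proof. by []. Qed.

Lemma Bs_gt0 t y : 0 < t -> a <= y -> 0 < Bs t y.
Proof.
by move=> t0 ay; rewrite !mulr_gt0// sqrtr_gt0 ltr_wpDl ?subr_ge0// exprn_gt0.
Qed.

Lemma stepw_gt0 t y : 0 < t -> a <= y -> y < b -> 0 < stepw t y.
Proof. by move=> t0 ay yb; rewrite mulr_gt0 ?Bs_gt0// subr_gt0. Qed.

Lemma is_derive_Bs t y : 0 < t -> a <= y ->
  is_derive y (1 : R) (Bs t) (c ^+ 2 * t ^+ 2 / (2 * Bs t y)).
Proof.
move=> t0 ay.
have s0 : 0 < y - a + t ^+ 2 by rewrite ltr_wpDl ?subr_ge0// exprn_gt0.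
have d1 : is_derive y (1 : R) (fun z => z - a + t ^+ 2) 1.
  have := is_derive_poly ('X + (t ^+ 2 - a)%:P) y.
  rewrite derivD derivX derivC addr0 hornerC.
  by congr is_derive; apply/funext => z; rewrite hornerD hornerX hornerC; ring.
have d2 := derZ (c * t) (der_comp (f := Num.sqrt) (g := fun z => z - a + t ^+ 2) (is_derive1_sqrt s0) d1).
apply: (is_derive_eq d2); rewrite mulr1 /Bs.
have q0 : Num.sqrt (y - a + t ^+ 2) != 0 by rewrite gt_eqF// sqrtr_gt0.
by field; rewrite q0 !gt_eqF.
Qed.

Lemma is_derive_coef_v y : is_derive y (1 : R) (fun z => b - z) (-1).
Proof.
have := is_derive_poly (b%:P - 'X) y.
rewrite derivB derivX derivC sub0r hornerN hornerC.
by congr is_derive; apply/funext => z; rewrite !hornerE.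
Qed.

Lemma is_derive_ceval t y e : 0 < t -> a <= y -> y < b ->
  is_derive y (1 : R) (fun z => ceval t z e) (ceval t y (cder e) / stepw t y).
Proof.
move=> t0 ay yb; have B0 := Bs_gt0 t0 ay; have v0 : 0 < b - y by rewrite subr_gt0.
have dB := is_derive_Bs t0 ay; have dv := is_derive_coef_v y.
have nB : Bs t y != 0 by rewrite gt_eqF.
have nv : b - y != 0 by rewrite gt_eqF.
elim: e => [x||||e1 d1 e2 d2|e1 d1 e2 d2] /=.
- by apply: (is_derive_eq (is_derive_cst x y 1)); rewrite mul0r.
- by apply: (is_derive_eq dv); rewrite /stepw; field; rewrite ?nB ?nv.
- by apply: (is_derive_eq dB); rewrite /stepw /Es; field; rewrite ?nB ?nv.
- have nB2 : 2 * Bs t y != 0 by rewrite mulf_neq0.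
  apply: (is_derive_eq (derM (derZ (c ^+ 2 * t ^+ 2) dv) (derV (f := fun z => 2 * Bs t z) nB2 (derZ 2 dB)))).
  by rewrite /stepw /Es; field; rewrite ?nB ?nv.
- by apply: (is_derive_eq (is_deriveD d1 d2)); rewrite mulrDl.
- by apply: (is_derive_eq (derM d1 d2)); ring.
Qed.

Lemma is_derive_stepw t y : 0 < t -> a <= y ->
  is_derive y (1 : R) (stepw t) (Es t y - Bs t y).
Proof.
move=> t0 ay; have nB : Bs t y != 0 by rewrite gt_eqF ?Bs_gt0.
apply: (is_derive_eq (derM (is_derive_Bs t0 ay) (is_derive_coef_v y))).
by rewrite /Es; field; rewrite nB.
Qed.

Lemma ceval_bounded e : exists2 K, 0 <= K & forall t y, 0 < t -> t <= 1 ->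
  y \in `[a, b] -> `|ceval t y e| <= K.
Proof.
elim: e => [x||||e1 [K1 K10 H1] e2 [K2 K20 H2]|e1 [K1 K10 H1] e2 [K2 K20 H2]] /=.
- by exists `|x|.
- exists (b - a); first by rewrite subr_ge0 ltW.
  by move=> t y _ _; rewrite in_itv/= => /andP[ay yb]; rewrite ger0_norm ?subr_ge0//; lra.
- exists (c * Num.sqrt (b - a + 1)); first by rewrite mulr_ge0 ?sqrtr_ge0// ltW.
  move=> t y t0 t1; rewrite in_itv/= => /andP[ay yb]; rewrite gtr0_norm ?Bs_gt0// /Bs.
  rewrite -mulrA ler_wpM2l ?(ltW c0)//.
  rewrite -[leRHS]mul1r ler_pM ?sqrtr_ge0 ?(ltW t0)// ler_wsqrtr// lerD ?expr_le1 ?(ltW t0)//.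
  by rewrite lerB.
- exists (c * (b - a)); first by rewrite mulr_ge0 ?subr_ge0// ltW.
  move=> t y t0 t1; rewrite in_itv/= => /andP[ay yb].
  have B0 := Bs_gt0 t0 ay.
  have v0 : 0 <= b - y by rewrite subr_ge0.
  rewrite ger0_norm /Es; last by rewrite divr_ge0 ?mulr_ge0 ?exprn_ge0// ltW.
  rewrite ler_pdivrMr; last exact: mulr_gt0 B0.
  have ba0 : 0 <= b - a by rewrite subr_ge0 ltW.
  (* This keeps [Es] bounded near [a] as t tends to 0: its numerator is of order t^2. *)
  have Bt : c * t ^+ 2 <= Bs t y.
    rewrite /Bs -mulrA ler_wpM2l ?(ltW c0)// expr2 ler_wpM2l ?(ltW t0)//.
    rewrite -{1}(gtr0_norm t0) -sqrtr_sqr ler_wsqrtr// lerDr subr_ge0//.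
  have : c * (c * t ^+ 2) * (b - y) <= c * Bs t y * (b - a).
    by rewrite ler_pM ?mulr_ge0 ?exprn_ge0 ?(ltW c0) ?(ltW t0)// ?ler_wpM2l ?(ltW c0)//; lra.
  have : 0 <= c * Bs t y * (b - a) by exact: mulr_ge0 (mulr_ge0 (ltW c0) (ltW B0)) ba0.
  have -> : c ^+ 2 * t ^+ 2 * (b - y) = c * (c * t ^+ 2) * (b - y) by ring.
  lra.
- exists (K1 + K2); first exact: addr_ge0.
  by move=> t y t0 t1 yab; apply: (le_trans (ler_normD _ _)); rewrite lerD ?H1 ?H2.
- exists (K1 * K2); first exact: mulr_ge0.
  by move=> t y t0 t1 yab; rewrite normrM ler_pM ?H1 ?H2.
Qed.

Lemma within_cont_Bs t : {within `[a, b], continuous (Bs t)}.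
Proof.
apply: within_contM; first exact: within_cont_cst.
apply: (within_cont_comp (g := Num.sqrt)); first exact: sqrt_continuous.
apply: continuous_subspaceT => z.
have -> : (fun x => x - a + t ^+ 2) = horner ('X + (t ^+ 2 - a)%:P).
  by apply/funext => x; rewrite hornerD hornerX hornerC; ring.
exact: continuous_horner.
Qed.

Lemma within_cont_v : {within `[a, b], continuous (fun y => b - y)}.
Proof.
apply: continuous_subspaceT => z.
have -> : (fun x => b - x) = horner (b%:P - 'X) by apply/funext => x; rewrite !hornerE.
exact: continuous_horner.
Qed.

Lemma within_cont_ceval t e : 0 < t -> {within `[a, b], continuous (fun y => ceval t y e)}.
Proof.
move=> t0; elim: e => [x||||e1 d1 e2 d2|e1 d1 e2 d2] /=.
- exact: within_cont_cst.
- exact: within_cont_v.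
- exact: within_cont_Bs.
- apply: within_contM.
    by apply: within_contM; [exact: within_cont_cst|exact: within_cont_v].
  apply: within_contV.
    by move=> x /=; rewrite in_itv/= => /andP[ax _]; rewrite gt_eqF// mulr_gt0// Bs_gt0.
  by apply: within_contM; [exact: within_cont_cst|exact: within_cont_Bs].
- exact: within_contD.
- exact: within_contM.
Qed.

Lemma within_cont_mom eta f t (i : R) :
  {within `[a, b], continuous (fun y => mom eta f y (i * stepw t y))}.
Proof.
have -> : (fun y => mom eta f y (i * stepw t y)) =
  (fun y => \sum_(m < size f) f^`N(m).[y] * (i * stepw t y) ^+ m * pint 0 1 (eta * 'X^m)).
  by apply/funext => y; rewrite momE.
apply: (within_cont_sum (F := fun m y => f^`N(m).[y] * (i * stepw t y) ^+ m * pint 0 1 (eta * 'X^m))) => n.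
apply: within_contM; last exact: within_cont_cst.
apply: within_contM.
  by apply: continuous_subspaceT; exact: continuous_horner.
have -> : (fun x => (i * stepw t x) ^+ n) = (fun x => ('X^n).[i * stepw t x]).
  by apply/funext => x; rewrite hornerXn.
apply: within_cont_horner; apply: within_contM; first exact: within_cont_cst.
by apply: within_contM; [exact: within_cont_Bs|exact: within_cont_v].
Qed.

(** A coefficient, an averaging kernel, and the multiple of the step at which f is averaged. *)
Definition sterm : Type := (coef * {poly R} * R)%type.

Definition term_val (f : {poly R}) (t y : R) (T : sterm) : R :=
  ceval t y T.1.1 * mom T.1.2 f y (T.2 * stepw t y).

(** The first entry is [stepw] times d/dy applied to the prefactor Bs^-k (b - y)^(M - k) and the
    coefficient; the other two carry the kernels produced by [is_derive_mom]. Dividing by [stepw]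
    then raises k by one: each derivative consumes one factor b - y and adds one factor 1 / Bs. *)
Definition dterm (M k : nat) (T : sterm) : seq sterm :=
  let: (e, eta, i) := T in
  [:: (Cadd (Cmul e (Cadd (Cmul (Cst (- k%:R)) Ce) (Cmul (Cst (- (M - k)%:R)) Cb))) (cder e), eta, i);
      (Cmul e (Cst (- i^-1)), eta^`(), i);
      (Cmul e (Cadd Cb (Cmul (Cst (-1)) Ce)), ('X * eta)^`(), i)].

(* The shape of the k-th derivative of [(b - y) ^+ M] times a sum of averages of [f]: an
   integration by parts in the averaging variable removes the derivatives falling on [f]. *)
Definition smooth (f : {poly R}) (M k : nat) (s : seq sterm) (t y : R) : R :=
  (Bs t y)^-1 ^+ k * (b - y) ^+ (M - k) * \sum_(T <- s) term_val f t y T.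

Lemma smoothE f M k s t y : smooth f M k s t y =
  (Bs t y)^-1 ^+ k * (b - y) ^+ (M - k) * \sum_(T <- s) term_val f t y T.
Proof. by []. Qed.

(* Vanishing of order [p] at 0 and 1 allows [p] integrations by parts without boundary terms. *)
Definition vanishing (p : nat) (T : sterm) : Prop :=
  0 < T.2 <= rr /\ exists g : {poly R}, T.1.2 = ('X * (1 - 'X)) ^+ p * g.

Fixpoint all_vanishing (p : nat) (s : seq sterm) : Prop :=
  if s is T :: s' then vanishing p T /\ all_vanishing p s' else True.

Lemma all_vanishing_cat p s1 s2 :
  all_vanishing p s1 -> all_vanishing p s2 -> all_vanishing p (s1 ++ s2).
Proof. by elim: s1 => //= T s1 IH [HT H1] H2; split => //; exact: IH. Qed.

Lemma vanishing_dterm M k p (T : sterm) : vanishing p.+1 T ->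
  all_vanishing p (dterm M k T).
Proof.
case: T => [[e eta] i] [/= i0 [g etaE]].
have V1 (q : {poly R}) : exists g0 : {poly R}, (('X * (1 - 'X)) ^+ p.+1 * q)^`() = ('X * (1 - 'X)) ^+ p * g0.
  exists ((('X * (1 - 'X))^`() *+ p.+1) * q + ('X * (1 - 'X)) * q^`()).
  by rewrite derivM deriv_exp /= exprS; ring.
split; [split => //=|split; [split => //=|split => //; split => //=]].
- by exists ('X * (1 - 'X) * g); rewrite etaE exprS; ring.
- by rewrite etaE; exact: V1.
- by rewrite etaE mulrCA; exact: V1.
Qed.

Lemma vanishing_dterms M k p (s : seq sterm) : all_vanishing p.+1 s ->
  all_vanishing p (flatten (map (dterm M k) s)).
Proof.
elim: s => //= T s IH [HT Hs].
by apply: all_vanishing_cat; [exact: vanishing_dterm|exact: IH].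
Qed.

(** The added multiple of [term_val] undoes the derivative of the prefactor, which the first entry
    of [dterm] contains but a single term does not. *)
Lemma is_derive_tval f t y M k (T : sterm) : 0 < t -> a <= y -> y < b -> vanishing 1 T ->
  is_derive y (1 : R) (fun z => term_val f t z T)
    (((k%:R * Es t y + (M - k)%:R * Bs t y) * term_val f t y T +
      \sum_(T' <- dterm M k T) term_val f t y T') / stepw t y).
Proof.
move=> t0 ay yb; case: T => [[e eta] i] [/= /andP[i0 _] [g etaE]].
have ni0 : i != 0 by rewrite gt_eqF.
have d0 : stepw t y != 0 by rewrite gt_eqF// stepw_gt0.
have e0 : eta.[0] = 0 by rewrite etaE !hornerE.
have e1 : eta.[1] = 0 by rewrite etaE !hornerE subrr; ring.
have dm := is_derive_mom f e0 e1 ni0 d0 (is_derive_stepw t0 ay).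
apply: (is_derive_eq (derM (is_derive_ceval e t0 ay yb) dm)).
by rewrite /dterm !big_cons big_nil /term_val /=; field; rewrite d0.
Qed.

Lemma is_derive_smooth f M k s t y : (k < M)%N -> 0 < t -> a <= y -> y < b ->
  all_vanishing 1 s ->
  is_derive y (1 : R) (smooth f M k s t)
    (smooth f M k.+1 (flatten (map (dterm M k) s)) t y).
Proof.
move=> kM t0 ay yb Hs.
have B0 := Bs_gt0 t0 ay; have v0 : 0 < b - y by rewrite subr_gt0.
have nB : Bs t y != 0 by rewrite gt_eqF.
have nv : b - y != 0 by rewrite gt_eqF.
have d0 : stepw t y != 0 by rewrite gt_eqF// stepw_gt0.
have dS : is_derive y (1 : R) (fun z => \sum_(T <- s) term_val f t z T)
   (((k%:R * Es t y + (M - k)%:R * Bs t y) * \sum_(T <- s) term_val f t y T +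
      \sum_(T' <- flatten (map (dterm M k) s)) term_val f t y T') / stepw t y).
  elim: s Hs => [_|T s IH [HT /IH{}IH]].
    have -> : (fun z => \sum_(T <- [::]) term_val f t z T) = (fun=> 0).
      by apply/funext => z; rewrite big_nil.
    by apply: (is_derive_eq (is_derive_cst _ _ _)); rewrite !big_nil mulr0 addr0 mul0r.
  have -> : (fun z => \sum_(T' <- T :: s) term_val f t z T') =
      (fun z => term_val f t z T + \sum_(T' <- s) term_val f t z T').
    by apply/funext => z; rewrite big_cons.
  apply: (is_derive_eq (is_deriveD (is_derive_tval f M k t0 ay yb HT) IH)).
  by rewrite !big_cons /= big_cat/=; ring.
have dB := derX k (derV nB (is_derive_Bs t0 ay)).
have dv := derX (M - k) (is_derive_coef_v y).
apply: (is_derive_eq (derM (derM dB dv) dS)).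
rewrite /smooth.
move: (\sum_(T <- s) _) (\sum_(T <- flatten _) _) => S S'.
have [j Mk] : exists j, (M - k = j.+1)%N by exists (M - k).-1; rewrite prednK// subn_gt0.
rewrite (subnS M) Mk /stepw /Es /=.
have kE : k%:R * (Bs t y)^-1 ^+ k.-1 = k%:R * (Bs t y)^-1 ^+ k * Bs t y.
  by case: k {kM Hs dS dB dv Mk} => [|k]; rewrite ?mul0r// exprS; field; rewrite nB.
rewrite kE !exprS; field; rewrite nB nv//.
Qed.

End smoothing_coefficients.

Section tonelli.
Context {R : realType}.
Notation mu := (@lebesgue_measure R).
Notation RR := (measurableTypeR R * measurableTypeR R)%type.

Lemma tonelli_on (D1 D2 : set R) (G : R -> R -> \bar R) :
  measurable D1 -> measurable D2 ->
  measurable_fun [set: RR] (fun p : RR => G p.1 p.2) -> (forall x y, 0 <= G x y)%E ->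
  (\int[mu]_(x in D1) \int[mu]_(y in D2) G x y = \int[mu]_(y in D2) \int[mu]_(x in D1) G x y)%E.
Proof.
move=> m1 m2 mG G0.
pose H := (fun p : RR => G p.1 p.2) \_ (D1 `*` D2).
have mH : measurable_fun [set: RR] H.
  by apply/(measurable_restrictT _ _).1; [exact: measurableX|exact: measurable_funTS].
have H0 p : (0 <= H p)%E by rewrite /H patchE; case: ifP.
have := @fubini_tonelli _ _ (measurableTypeR R) (measurableTypeR R) R mu mu H mH H0.
have E1 x y : H (x, y) = if (x \in D1) && (y \in D2) then G x y else 0%E.
  rewrite /H patchE /=; congr (if _ then _ else _).
  by apply/idP/andP => [/[!inE]//|[/[!inE]]].
have -> : (\int[mu]_x \int[mu]_y H (x, y) = \int[mu]_(x in D1) \int[mu]_(y in D2) G x y)%E.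
  rewrite [RHS]integral_mkcond; apply: eq_integral => x _; rewrite patchE.
  case: ifP => xD.
    by rewrite [RHS]integral_mkcond; apply: eq_integral => y _; rewrite E1 xD patchE.
  by rewrite integral0_eq// => y _; rewrite E1 xD.
move=> ->; rewrite [RHS]integral_mkcond; apply: eq_integral => y _; rewrite patchE.
case: ifP => yD.
  by rewrite [RHS]integral_mkcond; apply: eq_integral => x _; rewrite E1 yD andbT patchE.
by rewrite integral0_eq// => x _; rewrite E1 yD andbF.
Qed.

Lemma measurable_inner_integral (D2 : set R) (G : R -> R -> \bar R) :
  measurable D2 -> measurable_fun [set: RR] (fun p : RR => G p.1 p.2) ->
  (forall x y, 0 <= G x y)%E ->
  measurable_fun [set: R] (fun x => \int[mu]_(y in D2) G x y)%E.
Proof.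
move=> m2 mG G0.
pose H := (fun p : RR => G p.1 p.2) \_ (setT `*` D2).
have mH : measurable_fun [set: RR] H.
  by apply/(measurable_restrictT _ _).1; [exact: measurableX|exact: measurable_funTS].
have H0 p : (0 <= H p)%E by rewrite /H patchE; case: ifP.
have := @measurable_fun_fubini_tonelli_F _ _ (measurableTypeR R) (measurableTypeR R) R mu H mH H0.
congr (measurable_fun _ _); apply/funext => x.
rewrite [RHS]integral_mkcond; apply: eq_integral => y _; rewrite /H !patchE /=.
by congr (if _ then _ else _); apply/idP/idP => /[!inE]; [case|split].
Qed.

End tonelli.

Section poly_cauchy_schwarz.
Context {R : realType}.

Lemma pint_cst (x : R) : pint 0 1 x%:P = x.
Proof.
have -> : x%:P = (x *: 'X)^`() by rewrite derivZ derivX -mul_polyC mulr1.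
by rewrite pint_deriv !hornerZ !hornerX; ring.
Qed.

(** The integral over [0, 1] of the square of P minus its mean is nonnegative. *)
Lemma pint_sqr_le (P : {poly R}) : pint 0 1 P ^+ 2 <= pint 0 1 (P ^+ 2).
Proof.
have := @pint_ge0 R 0 1 ltr01 ((P - (pint 0 1 P)%:P) ^+ 2).
have -> : (P - (pint 0 1 P)%:P) ^+ 2 = P ^+ 2 + (- 2 * pint 0 1 P) *: P + (pint 0 1 P ^+ 2)%:P.
  by rewrite -mul_polyC !polyCM polyCN polyC_natr; ring.
rewrite !pintD pintZ pint_cst => H.
have : 0 <= pint 0 1 (P ^+ 2) + - 2 * pint 0 1 P * pint 0 1 P + pint 0 1 P ^+ 2.
  apply: H => x _; rewrite -[X in 0 <= X.[x]](_ : (P - (pint 0 1 P)%:P) ^+ 2 = _).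
    by rewrite horner_exp sqr_ge0.
  by rewrite -mul_polyC !polyCM polyCN polyC_natr; ring.
lra.
Qed.

Lemma horner_bounded (P : {poly R}) (a b : R) : a <= b ->
  exists2 K, 0 <= K & forall x, x \in `[a, b] -> `|P.[x]| <= K.
Proof. by move=> ab; apply: within_bounded => //; apply: continuous_subspaceT; exact: continuous_horner. Qed.

Lemma mom_sqr_le (eta f : {poly R}) (y s K : R) : 0 <= K ->
  (forall x, x \in `[0, 1] -> `|eta.[x]| <= K) ->
  mom eta f y s ^+ 2 <= K ^+ 2 * pint 0 1 ((f \Po (y%:P + s *: 'X)) ^+ 2).
Proof.
move=> K0 HK; rewrite (le_trans (pint_sqr_le _))// -subr_ge0 -mulN1r -!pintZ -pintD.
apply: pint_ge0 => // x x01.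
rewrite hornerD !hornerZ !horner_exp hornerM mulN1r subr_ge0 exprMn ler_wpM2r ?sqr_ge0//.
by apply: ler_sqr_norm; rewrite (ger0_norm K0) HK.
Qed.

Lemma horner_comp_affine (f : {poly R}) (y s z : R) :
  (f \Po (y%:P + s *: 'X)).[z] = f.[y + s * z].
Proof. by rewrite horner_comp !hornerE. Qed.

End poly_cauchy_schwarz.

Section smoothing_bounds.
Context {R : realType}.
Notation mu := (@lebesgue_measure R).
Notation RR := (measurableTypeR R * measurableTypeR R)%type.
Variables (a b c rr : R).
Hypotheses (ab : a < b) (c0 : 0 < c) (rr0 : 0 <= rr).
Hypothesis csmall : rr * (c * (2 * (b - a) + 2)) <= 2^-1.
Notation phi := (step_weight a b).
Notation stepw := (stepw a b c).
Notation Bs := (Bs a c).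

Lemma sqrt_le_add1 (x : R) : 0 <= x -> Num.sqrt (x + 1) <= x + 1.
Proof.
move=> x0; rewrite -[leRHS](gtr0_norm (_ : 0 < x + 1)) ?ltr_wpDl// -sqrtr_sqr.
by rewrite ler_wsqrtr//; nra.
Qed.

Lemma Bs_le t y : 0 < t -> t <= 1 -> y \in `[a, b] -> Bs t y <= c * t * (b - a + 1).
Proof.
move=> t0 t1; rewrite in_itv/= => /andP[ay yb].
rewrite BsE ler_wpM2l ?mulr_ge0 ?(ltW c0) ?(ltW t0)//.
apply: le_trans (sqrt_le_add1 _); last by rewrite subr_ge0 ltW.
by rewrite ler_wsqrtr// lerD ?expr_le1 ?(ltW t0)// lerB.
Qed.

(** Makes y -> y + i d(y) z expand distances by at least 1/2 for 0 <= i <= rr and 0 <= z <= 1. The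
    square root alone has slope up to 1 / (2 t); the factor t in [Bs] compensates, so that one c
    serves all t. *)
Lemma stepw_lipschitz t x y : 0 < t -> t <= 1 -> x \in `[a, b] -> y \in `[a, b] ->
  rr * `|stepw t x - stepw t y| <= 2^-1 * `|x - y|.
Proof.
move=> t0 t1 /[dup] xab + /[dup] yab; rewrite !in_itv/= => /andP[ax xb] /andP[ay yb].
pose S z := Num.sqrt (z - a + t ^+ 2).
have SE z : a <= z -> S z ^+ 2 = z - a + t ^+ 2.
  by move=> az; rewrite sqr_sqrtr// addr_ge0 ?subr_ge0// sqr_ge0.
have St z : a <= z -> t <= S z.
  by move=> az; rewrite -(gtr0_norm t0) -sqrtr_sqr ler_wsqrtr// lerDr subr_ge0.
have HS : 2 * t * `|S x - S y| <= `|x - y|.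
  have -> : x - y = (S x - S y) * (S x + S y) by rewrite -subr_sqr !SE//; ring.
  have := St _ ax; have := St _ ay => h1 h2.
  rewrite normrM mulrC ler_wpM2l// ger0_norm; lra.
have HB : `|Bs t x - Bs t y| <= c / 2 * `|x - y|.
  rewrite !BsE -mulrBr normrM (gtr0_norm (mulr_gt0 c0 t0)).
  have -> : c * t * `|S x - S y| = c / 2 * (2 * t * `|S x - S y|) by field.
  by rewrite ler_wpM2l// divr_ge0// ltW.
have By := Bs_le t0 t1 yab; have By0 := Bs_gt0 c0 t0 ay.
have E : stepw t x - stepw t y = (Bs t x - Bs t y) * (b - x) - Bs t y * (x - y).
  by rewrite !stepwE; ring.
have L0 : 0 < b - a by rewrite subr_gt0.
have By1 : Bs t y <= c * (b - a + 1).
  apply: (le_trans By); rewrite -mulrA ler_wpM2l ?(ltW c0)//; nra.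
have : `|stepw t x - stepw t y| <= c * (2 * (b - a) + 2) * `|x - y|.
  rewrite E; apply: (le_trans (ler_normB _ _)); rewrite (normrM (_ - _)) (normrM (Bs t y)).
  rewrite (ger0_norm (_ : 0 <= b - x)) ?subr_ge0// (gtr0_norm By0).
  have n0 : 0 <= `|x - y| by [].
  have h1 : `|Bs t x - Bs t y| * (b - x) <= c / 2 * `|x - y| * (b - a).
    by rewrite ler_pM// ?subr_ge0//; lra.
  have h2 : Bs t y * `|x - y| <= c * (b - a + 1) * `|x - y| by rewrite ler_wpM2r.
  have h3 : 0 <= c * (b - a) * `|x - y| by rewrite !mulr_ge0// ltW.
  have h4 : 0 <= c * `|x - y| by rewrite mulr_ge0// ltW.
  apply: (le_trans (lerD h1 h2)).
  have -> : c / 2 * `|x - y| * (b - a) + c * (b - a + 1) * `|x - y| =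
    3/2 * (c * (b - a) * `|x - y|) + c * `|x - y| by field.
  have -> : c * (2 * (b - a) + 2) * `|x - y| = 2 * (c * (b - a) * `|x - y|) + 2 * (c * `|x - y|) by ring.
  lra.
move=> /(ler_wpM2l rr0) H; apply: (le_trans H).
by rewrite mulrA ler_wpM2r.
Qed.

Lemma stepw_le t y : 0 < t -> t <= 1 -> y \in `[a, b] ->
  0 <= stepw t y /\ rr * stepw t y <= 2^-1 * (b - y).
Proof.
move=> t0 t1 /[dup] yab; rewrite in_itv/= => /andP[ay yb].
have By := Bs_le t0 t1 yab; have By0 := Bs_gt0 c0 t0 ay.
have v0 : 0 <= b - y by rewrite subr_ge0.
have L0 : 0 < b - a by rewrite subr_gt0.
split; first by rewrite mulr_ge0// ltW.
rewrite !stepwE mulrA ler_wpM2r//; apply: le_trans csmall.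
rewrite ler_wpM2l//; apply: (le_trans By); rewrite -mulrA ler_wpM2l ?(ltW c0)//; nra.
Qed.

Lemma measurable_stepw t : measurable_fun [set: R] (stepw t).
Proof.
apply: measurable_funM.
  apply: measurable_funM => //.
  apply: (measurableT_comp (f := @Num.sqrt R) (g := fun x : R => x - a + t ^+ 2)).
    by apply: continuous_measurable_fun; exact: sqrt_continuous.
  by apply: measurable_funD => //; exact: measurable_funB.
exact: measurable_funB.
Qed.

(** Cauchy-Schwarz in z, then Tonelli: for each fixed z the map y -> y + i d(y) z stays in [a, b]
    and expands distances by at least 1/2, which costs a factor 2 in the integral, whatever t is. *)
Lemma NB_mom eta : exists2 K, 0 <= K & forall i t f e, 0 <= i -> i <= rr ->
  0 < t -> t <= 1 -> NB a b (horner f) e ->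
  NB a b (fun y => mom eta f y (i * stepw t y)) (K * e).
Proof.
have [K K0 HK] := horner_bounded eta (ler01 : (0 : R) <= 1).
exists (K * Num.sqrt 2); first by rewrite mulr_ge0// sqrtr_ge0.
move=> i t f e i0 ir t0 t1 [mf e0 fe].
have mM : measurable_fun `[a, b] (fun y => mom eta f y (i * stepw t y)).
  by apply: within_meas; exact: within_cont_mom.
split => //; first by rewrite !mulr_ge0// sqrtr_ge0.
pose G (y z : R) := ((f.[y + i * stepw t y * z]) ^+ 2)%:E.
have G0 y z : (0 <= G y z)%E by rewrite lee_fin sqr_ge0.
have mG : measurable_fun [set: RR] (fun p : RR => G p.1 p.2).
  apply/measurable_EFinP; apply: measurable_funX.
  apply: (measurableT_comp (f := horner f)); first exact: measurable_horner.
  apply: measurable_funD; first exact: measurable_fst.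
  apply: measurable_funM; last exact: measurable_snd.
  apply: measurable_funM => //.
  by apply: (measurableT_comp (f := stepw t)); [exact: measurable_stepw|exact: measurable_fst].
apply: (@le_trans _ _ (\int[mu]_(y in `[a, b]) ((K ^+ 2)%:E * \int[mu]_(z in `[0%R, 1%R]) G y z))%E).
  apply: ge0_le_integral => //=.
  - by move=> x _; rewrite lee_fin sqr_ge0.
  - exact: msqr.
  - apply: emeasurable_funM => //; apply: measurable_funTS.
    exact: measurable_inner_integral.
  - move=> y yab.
    have -> : (\int[mu]_(z in `[0%R, 1%R]) G y z = (pint 0 1 ((f \Po (y%:P + (i * stepw t y) *: 'X)) ^+ 2))%:E)%E.
      rewrite -pint_lebesgue//; apply: eq_integral => z _; congr (_%:E).
      by rewrite horner_exp horner_comp_affine.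
    by rewrite -EFinM lee_fin; exact: mom_sqr_le.
rewrite ge0_integralZl//=; first last.
- by rewrite lee_fin sqr_ge0.
- by move=> y _; apply: integral_ge0 => z _; exact: G0.
- by apply: measurable_funTS; exact: measurable_inner_integral.
rewrite 2!exprMn sqr_sqrtr// -mulrA (EFinM (K ^+ 2)) lee_wpmul2l ?lee_fin ?sqr_ge0//.
rewrite tonelli_on//.
apply: (@le_trans _ _ (\int[mu]_(z in `[0%R, 1%R]) cst (2 * e ^+ 2)%:E z)%E); last first.
  rewrite integral_cst// [X in (_ * X)%E](lebesgue_itvcc (ler01 : (0:R) <= 1)).
  by rewrite subr0 mule1.
apply: ge0_le_integral => //=.
- by move=> z _; apply: integral_ge0 => y _; exact: G0.
- apply: measurable_funTS; apply: (measurable_inner_integral (G := fun z y => G y z)) => //.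
  exact: (measurableT_comp mG (@measurable_swap _ _ _ _)).
- move=> z; rewrite in_itv/= => /andP[z0 z1].
  have half0 : (0 : R) < 2^-1 by [].
  apply: (le_trans (@expanding_integral R `[a, b] `[a, b] (fun y => y + i * stepw t y * z)
    2^-1 (fun x => ((f.[x]) ^+ 2)%:E) half0 _ _ _ _ _ _ _)) => //.
  + apply: measurable_funTS; apply: measurable_funD => //; apply: measurable_funM => //.
    by apply: measurable_funM => //; exact: measurable_stepw.
  + by apply: msqr => //; exact: measurable_horner.
  + by move=> x; rewrite lee_fin sqr_ge0.
  + move=> y yab; have [d0 dv] := stepw_le t0 t1 yab.
    move: yab; rewrite /= !in_itv/= => /andP[ay yb].
    have h0 : 0 <= i * stepw t y * z by exact: mulr_ge0 (mulr_ge0 i0 d0) z0.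
    have h1 : i * stepw t y * z <= rr * stepw t y.
      by rewrite -[leRHS]mulr1; apply: ler_pM (mulr_ge0 i0 d0) z0 _ z1; exact: ler_wpM2r.
    apply/andP; split; first by rewrite (le_trans ay)// lerDl.
    have v0 : 0 <= b - y by rewrite subr_ge0.
    lra.
  + move=> x y xab yab.
    have HL := stepw_lipschitz t0 t1 xab yab.
    have E : x + i * stepw t x * z - (y + i * stepw t y * z) =
      (x - y) + i * z * (stepw t x - stepw t y) by ring.
    rewrite E.
    have : `|i * z * (stepw t x - stepw t y)| <= rr * `|stepw t x - stepw t y|.
      rewrite normrM ler_wpM2r// (ger0_norm (mulr_ge0 i0 z0)).
      by rewrite -[leRHS]mulr1; exact: ler_pM.
    have := lerB_normD (x - y) (i * z * (stepw t x - stepw t y)).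
    lra.
  + by rewrite invrK EFinM lee_wpmul2l.
Qed.

End smoothing_bounds.

Section smoothing_rate.
Context {R : realType}.
Variables (a b c rr : R).
Hypotheses (ab : a < b) (c0 : 0 < c) (rr0 : 0 <= rr).
Hypothesis csmall : rr * (c * (2 * (b - a) + 2)) <= 2^-1.
Hypothesis dense : poly_dense a b.
Notation phi := (step_weight a b).
Notation stepw := (stepw a b c).
Notation Bs := (Bs a c).
Notation smooth := (smooth a b c).
Notation all_vanishing := (all_vanishing rr).

Fixpoint terms_iter (M k n : nat) (s : seq (sterm (R := R))) : seq (sterm (R := R)) :=
  if n is n'.+1 then terms_iter M k.+1 n' (flatten (map (dterm M k) s)) else s.

Lemma all_vanishing_le p q s : (q <= p)%N -> all_vanishing p s -> all_vanishing q s.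
Proof.
move=> qp; elim: s => //= T s IH [[HT [g HE]] Hs]; split; last exact: IH.
split => //; exists (('X * (1 - 'X)) ^+ (p - q) * g).
by rewrite mulrA -exprD subnKC.
Qed.

Lemma all_vanishing_iter M k n p s : all_vanishing (n + p) s -> all_vanishing p (terms_iter M k n s).
Proof.
elim: n k s => [|n IH] k s //= H; apply: IH.
exact: vanishing_dterms.
Qed.

Lemma within_cont_smooth f M k s t : 0 < t ->
  {within `[a, b], continuous (smooth f M k s t)}.
Proof.
move=> t0; apply: within_contM; last first.
  elim: s => [|T s IH].
    have -> : (fun y => \sum_(T <- [::]) term_val a b c f t y T) = (fun=> 0).
      by apply/funext => y; rewrite big_nil.
    exact: within_cont_cst.
  have -> : (fun y => \sum_(T' <- T :: s) term_val a b c f t y T') =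
      (fun y => term_val a b c f t y T + \sum_(T' <- s) term_val a b c f t y T').
    by apply/funext => y; rewrite big_cons.
  apply: within_contD => //; apply: within_contM; last exact: within_cont_mom.
  exact: within_cont_ceval.
apply: within_contM.
  have -> : (fun y => (Bs t y)^-1 ^+ k) = (fun y => ('X^k).[(Bs t y)^-1]).
    by apply/funext => y; rewrite hornerXn.
  apply: within_cont_horner; apply: within_contV; last exact: within_cont_Bs.
  by move=> y /=; rewrite in_itv/= => /andP[ay _]; rewrite gt_eqF// Bs_gt0.
have -> : (fun y => (b - y) ^+ (M - k)) = (fun y => ('X^(M - k)).[b - y]).
  by apply/funext => y; rewrite hornerXn.
by apply: within_cont_horner; exact: within_cont_v.
Qed.

Lemma nder_smooth f M k n s t : (n + k <= M)%N -> 0 < t -> all_vanishing n s ->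
  nder n a b (smooth f M k s t) (smooth f M (k + n) (terms_iter M k n s) t).
Proof.
move=> + t0; elim: n k s => [|n IH] k s nk Hs /=.
  by rewrite addn0; split => //; exact: within_cont_smooth.
exists (smooth f M k.+1 (flatten (map (dterm M k) s)) t); split.
  split; [exact: within_cont_smooth|exact: within_cont_smooth|].
  move=> y; rewrite in_itv/= => /andP[ay yb].
  apply: is_derive_smooth => //; [lia|exact: ltW|exact: all_vanishing_le Hs].
rewrite addnS -addSn; apply: IH; first by rewrite addnS -addSn.
exact: vanishing_dterms.
Qed.

Lemma NB_smooth M k s : (k <= M)%N -> all_vanishing 0 s -> exists2 K, 0 <= K &
  forall t f e, 0 < t -> t <= 1 -> NB a b (horner f) e ->
  NB a b (fun y => phi y ^+ k * smooth f M k s t y) (K * t^-1 ^+ k * e).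
Proof.
move=> kM Hs.
have [K K0 HK] : exists2 K, 0 <= K & forall t f e, 0 < t -> t <= 1 -> NB a b (horner f) e ->
    NB a b (fun y => \sum_(T <- s) term_val a b c f t y T) (K * e).
  elim: s Hs => [_|[[e eta] i] s IH /= [[/andP[i0 ir] _] /IH[K1 K10 HK1]]].
    exists 0 => // t f e _ _ _; rewrite mul0r.
    by apply: NB_ext (NB0 a b) => x _; rewrite big_nil.
  have [K2 K20 HK2] := NB_mom ab c0 rr0 csmall eta.
  have [K3 K30 HK3] := ceval_bounded ab c0 e.
  exists (K3 * K2 + K1); first by rewrite addr_ge0// mulr_ge0.
  move=> t f e' t0 t1 Hf; rewrite mulrDl -mulrA.
  apply: (NB_ext (f := fun y => term_val a b c f t y (e, eta, i) + \sum_(T <- s) term_val a b c f t y T)).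
    by move=> y _; rewrite big_cons.
  apply: NB_add; last exact: HK1.
  apply: (NB_le _ K30 _ (HK2 i t f e' (ltW i0) ir t0 t1 Hf)).
    apply: within_meas; apply: within_contM; [exact: within_cont_ceval|exact: within_cont_mom].
  by move=> y yab; rewrite /term_val /= normrM ler_wpM2r// HK3.
have L0 : 0 < b - a by rewrite subr_gt0.
pose W := (c^-1 * Num.sqrt (b - a)) ^+ k * (b - a) ^+ (M - k).
have cs0 : 0 <= c^-1 * Num.sqrt (b - a) by rewrite mulr_ge0 ?sqrtr_ge0// invr_ge0 ltW.
exists (W * K).
  by rewrite !mulr_ge0 ?exprn_ge0 ?(ltW L0).
move=> t f e t0 t1 Hf.
have -> : W * K * t^-1 ^+ k * e = (W * t^-1 ^+ k) * (K * e) by ring.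
apply: (NB_le _ _ _ (HK t f e t0 t1 Hf)).
- apply: measurable_funM; first by apply: measurable_funX; exact: measurable_step_weight.
  by apply: within_meas; exact: within_cont_smooth.
- by rewrite !mulr_ge0 ?exprn_ge0 ?(ltW L0) ?invr_ge0 ?(ltW t0).
move=> y /[dup] yab; rewrite in_itv/= => /andP[ay yb].
have B0 := Bs_gt0 c0 t0 ay.
have v0 : 0 <= b - y by rewrite subr_ge0.
rewrite smoothE mulrA normrM ler_wpM2r//.
rewrite ger0_norm; last first.
  by rewrite !mulr_ge0 ?exprn_ge0 ?step_weight_ge0 ?invr_ge0 ?(ltW B0).
rewrite mulrA -exprMn /W -mulrA (mulrC ((b - a) ^+ _)) mulrA -exprMn.
(* phi^2 = (y - a)(b - y) is at most (y - a + t^2)(b - a), so each factor 1 / Bs is traded against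
   one phi at the price of 1 / t. *)
have key : phi y / Bs t y <= c^-1 * Num.sqrt (b - a) / t.
  rewrite ler_pdivrMr//.
  have -> : c^-1 * Num.sqrt (b - a) / t * Bs t y = Num.sqrt ((b - a) * (y - a + t ^+ 2)).
    rewrite sqrtrM ?(ltW L0)// !BsE; field; rewrite !gt_eqF//.
  rewrite ler_wsqrtr// mulrC ler_pM ?subr_ge0//; first by rewrite lerB.
  by rewrite lerDl sqr_ge0.
apply: ler_pM; rewrite ?exprn_ge0//.
- by rewrite divr_ge0 ?step_weight_ge0// ltW.
- by rewrite lerXn2r ?nnegrE// ?divr_ge0 ?step_weight_ge0 ?(ltW B0) ?(ltW t0).
- by rewrite lerXn2r ?nnegrE ?(ltW L0)// lerB.
Qed.

(** Jackson's inequality of order k asks for k <= N; for N < k the bound on the norm suffices,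
    because k / (N t) >= 1 when t <= 1. *)
Lemma EB_smooth M k s : (k <= M)%N -> all_vanishing k s -> exists2 K, 0 <= K &
  forall t f e N, 0 < t -> t <= 1 -> (0 < N)%N -> NB a b (horner f) e ->
  EB a b (smooth f M 0 s t) N (K * (N%:R * t)^-1 ^+ k * e).
Proof.
move=> kM Hs.
have [K1 K10 HK1] := NB_smooth (leq0n M) (all_vanishing_le (leq0n k) Hs).
have Hs' : all_vanishing 0 (terms_iter M 0 k s) by apply: all_vanishing_iter; rewrite addn0.
have [K2 K20 HK2] := NB_smooth kM Hs'.
exists (k%:R ^+ k * K1 + k%:R ^+ k * K2); first by rewrite addr_ge0// mulr_ge0// exprn_ge0.
move=> t f e N t0 t1 N0 Hf; have e0 : 0 <= e by case: Hf.
have N0' : 0 < (N%:R : R) by rewrite ltr0n.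
have Nt0 : 0 < N%:R * t by rewrite mulr_gt0.
have u0 : 0 <= (N%:R * t)^-1 ^+ k by rewrite exprn_ge0// invr_ge0 ltW.
have kk0 : 0 <= (k%:R : R) ^+ k by rewrite exprn_ge0.
case: (leqP k N) => kN.
  apply: (EB_mono (leqnn N) _ (EB_jackson ab dense kN _ (HK2 t f e t0 t1 Hf))); last first.
    by apply: nder_smooth => //; rewrite addn0.
  have -> : (k%:R / N%:R) ^+ k * (K2 * t^-1 ^+ k * e) = k%:R ^+ k * K2 * (N%:R * t)^-1 ^+ k * e.
    by rewrite invfM !exprMn; ring.
  by rewrite ler_wpM2r// ler_wpM2r// lerDr mulr_ge0.
apply: NB_EB; apply: (NB_mono (e := K1 * e)); last first.
  have := HK1 t f e t0 t1 Hf; rewrite expr0 mulr1.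
  by apply: NB_ext => y _; rewrite expr0 mul1r.
rewrite ler_wpM2r//; apply: (@le_trans _ _ (k%:R ^+ k * (N%:R * t)^-1 ^+ k * K1)).
  rewrite ler_peMl// -exprMn exprn_ege1// ler_pdivlMr// mul1r.
  rewrite -[leRHS]mulr1 ler_pM ?(ltW t0)// ler_nat ltnW//.
have -> : k%:R ^+ k * (N%:R * t)^-1 ^+ k * K1 = k%:R ^+ k * K1 * (N%:R * t)^-1 ^+ k by ring.
by rewrite ler_wpM2r// lerDl mulr_ge0.
Qed.

End smoothing_rate.

(** * From the averaged difference to the weighted modulus *)

Section measurability.
Context {R : realType} {d : measure_display} {T : measurableType d}.

Lemma measurable_le_set (f g : T -> R) : measurable_fun [set: T] f -> measurable_fun [set: T] g ->
  measurable [set p | f p <= g p].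
Proof.
move=> mf mg; have := (measurable_funB mg mf) measurableT `[0, +oo[%classic (measurable_itv _).
by rewrite setTI; congr measurable; apply/seteqP; split => x /=; rewrite in_itv/= andbT subr_ge0.
Qed.

Lemma measurable_lt_set (f g : T -> R) : measurable_fun [set: T] f -> measurable_fun [set: T] g ->
  measurable [set p | f p < g p].
Proof.
move=> mf mg; have := (measurable_funB mg mf) measurableT `]0, +oo[%classic (measurable_itv _).
by rewrite setTI; congr measurable; apply/seteqP; split => x /=; rewrite in_itv/= andbT subr_gt0.
Qed.

Lemma measurable_if (P : T -> Prop) (f : T -> R) : measurable [set p | P p] ->
  measurable_fun [set: T] f ->
  measurable_fun [set: T] (fun p => if `[< P p >] then f p else 0).
Proof.
move=> mP mf.
have -> : (fun p => if `[< P p >] then f p else 0) = f \_ [set p | P p].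
  apply/funext => x; rewrite patchE; case: asboolP => Px; first by rewrite mem_set.
  by rewrite memNset.
by apply/(measurable_restrictT _ _).1; last exact: measurable_funTS.
Qed.

Lemma measurable_inv_ge0 (f : T -> R) : (forall x, 0 <= f x) -> measurable_fun [set: T] f ->
  measurable_fun [set: T] (fun x => (f x)^-1).
Proof.
move=> f0 mf; have -> : (fun x => (f x)^-1) = (fun x => powR (f x) (-1)).
  by apply/funext => x; rewrite powR_inv1.
by apply: (measurableT_comp (f := (powR (R:=R))^~ (-1))) => //; exact: measurable_powR.
Qed.

End measurability.

(** In the application u = y - a, v = b - y, S is the root in [Bs], and the right side is t^2
    phi(x)^2 at x = y + rs. If t^2 <= u then S^2 <= 2 u, and phi(x)^2 >= (3/4) u v suffices.
    Otherwise S <= 2 t, u may vanish, and rs >= s / 2 keeps phi(x) away from 0. *)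
Lemma zone_step_le {R : realType} (u v t k rs s S L : R) : 0 <= u -> 0 < v -> v <= L -> 0 < t -> 0 < k ->
  0 < s -> 0 < rs -> 0 < S -> rs <= v / 4 -> S ^+ 2 = u + t ^+ 2 -> s <= k * t * S * v ->
  s / 2 <= rs -> 16 * k * (L + 1) <= 1 -> s ^+ 2 <= t ^+ 2 * ((u + rs) * (v - rs)).
Proof.
move=> u0 v0 vL t0 k0 s0 rs0 S0 rs_v S2 sS srs kL.
have L0 : 0 < L by exact: lt_le_trans vL.
have k16 : 16 * k <= 1 by apply: le_trans kL; rewrite ler_peMr ?mulr_ge0 ?(ltW k0)//; lra.
have kL16 : 16 * k * L <= 1 by apply: le_trans kL; rewrite ler_wpM2l ?mulr_ge0 ?(ltW k0)//; lra.
have h1 : (u + rs) * (3/4 * v) <= (u + rs) * (v - rs) by rewrite ler_wpM2l//; lra.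
apply: (@le_trans _ _ (t ^+ 2 * ((u + rs) * (3/4 * v)))); last by rewrite ler_wpM2l ?sqr_ge0.
have tt0 : 0 <= t ^+ 2 by exact: sqr_ge0.
case: (leP (t ^+ 2) u) => ut.
  have h2 : s ^+ 2 <= (k * t * S * v) ^+ 2 by rewrite lerXn2r ?nnegrE ?(ltW s0)// (le_trans (ltW s0)).
  have h3 : (k * t * S * v) ^+ 2 <= t ^+ 2 * (2 * u * v) * (k * k * v).
    rewrite !exprMn S2.
    have -> : k ^+ 2 * t ^+ 2 * (u + t ^+ 2) * v ^+ 2 = t ^+ 2 * ((u + t ^+ 2) * v) * (k * k * v) by ring.
    rewrite ler_wpM2r ?mulr_ge0 ?(ltW k0) ?(ltW v0)// ler_wpM2l// ler_wpM2r ?(ltW v0)//; lra.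
  have h4 : k * k * v <= 1/4.
    have kv : k * v <= k * L by rewrite ler_wpM2l ?(ltW k0).
    have : k * (k * v) <= 1 * (1/4) by apply: ler_pM; rewrite ?mulr_ge0 ?(ltW k0) ?(ltW v0)//; lra.
    lra.
  have h5 : 0 <= t ^+ 2 * (2 * u * v) by rewrite !mulr_ge0 ?(ltW v0) ?(ltW t0).
  apply: (le_trans h2); apply: (le_trans h3).
  apply: (@le_trans _ _ (t ^+ 2 * (2 * u * v) * (1/4))); first by rewrite ler_wpM2l.
  have p1 : 0 <= t ^+ 2 * (rs * v) by rewrite !mulr_ge0 ?(ltW v0) ?(ltW rs0) ?(ltW t0).
  have p2 : 0 <= t ^+ 2 * (u * v) by rewrite !mulr_ge0 ?(ltW v0) ?(ltW t0).
  have -> : t ^+ 2 * (2 * u * v) * (1 / 4) = 1/2 * (t ^+ 2 * (u * v)) by field.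
  have -> : t ^+ 2 * ((u + rs) * (3 / 4 * v)) = 3/4 * (t ^+ 2 * (u * v)) + 3/4 * (t ^+ 2 * (rs * v)) by field.
  clear -p1 p2; lra.
have S2t : S <= 2 * t.
  rewrite -(ler_pXn2r (n := 2))// ?nnegrE ?(ltW S0) ?mulr_ge0 ?(ltW t0)// S2 exprMn.
  clear -tt0 ut; lra.
have h2 : s <= 2 * k * t ^+ 2 * v.
  apply: (le_trans sS).
  have -> : 2 * k * t ^+ 2 * v = k * t * (2 * t) * v by ring.
  by rewrite ler_wpM2r ?(ltW v0)// ler_wpM2l ?mulr_ge0 ?(ltW k0) ?(ltW t0).
have h3 : s ^+ 2 <= s * (2 * k * t ^+ 2 * v) by rewrite expr2 ler_wpM2l ?(ltW s0).
apply: (le_trans h3).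
have q0 : 0 <= t ^+ 2 * v by rewrite mulr_ge0 ?(ltW v0).
have -> : s * (2 * k * t ^+ 2 * v) = (2 * k * s) * (t ^+ 2 * v) by ring.
have -> : t ^+ 2 * ((u + rs) * (3 / 4 * v)) = ((u + rs) * (3/4)) * (t ^+ 2 * v) by ring.
rewrite ler_wpM2r//.
have ks : (16 * k) * s <= 1 * s by rewrite ler_wpM2r// ltW.
clear -u0 srs rs0 ks s0; lra.
Qed.

(** In the same notation, t <= S and s <= k t S v force rs <= S^2, so x - a <= 2 S^2 and phi(x) =
    O(S). This converts 1 / Bs at y into 1 / (t phi) at x. *)
Lemma zone_weight_le_aux {R : realType} (u v t k rr rs s S L : R) : 0 <= u -> 0 < v -> v <= L -> 0 < t -> 0 < k ->
  0 <= rr -> 0 < rs -> 0 < S -> rs = rr * s / 2 -> S ^+ 2 = u + t ^+ 2 -> s <= k * t * S * v -> t <= S ->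
  rr * (k * (2 * L + 2)) <= 2^-1 -> (u + rs) * (v - rs) <= (2 * (L + 1) * S) ^+ 2.
Proof.
move=> u0 v0 vL t0 k0 rr0 rs0 S0 rsE S2 sS tS small.
have L0 : 0 < L by exact: lt_le_trans vL.
have rsS : rs <= u + t ^+ 2.
  rewrite -S2; apply: (@le_trans _ _ (rr * (k * (2 * L + 2)) * (S * S))); last first.
    rewrite -expr2 -[leRHS]mul1r ler_wpM2r ?sqr_ge0//; clear -small; lra.
  have -> : rr * (k * (2 * L + 2)) * (S * S) = rr * (2 * (k * (L + 1) * S * S)) by ring.
  rewrite rsE -mulrA ler_wpM2l//.
  have h1 : k * t * S * v <= k * (L + 1) * S * S.
    have -> : k * t * S * v = (k * S) * (t * v) by ring.
    have -> : k * (L + 1) * S * S = (k * S) * (S * (L + 1)) by ring.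
    rewrite ler_wpM2l ?mulr_ge0 ?(ltW k0) ?(ltW S0)// ler_pM ?(ltW t0) ?(ltW v0)//; clear -vL; lra.
  have h2 : 0 <= k * (L + 1) * S * S.
    by rewrite !mulr_ge0 ?(ltW k0) ?(ltW S0)//; clear -L0; lra.
  clear -sS h1 h2; lra.
have t20 : 0 <= t ^+ 2 by exact: sqr_ge0.
have h1 : (u + rs) * (v - rs) <= (2 * (u + t ^+ 2)) * L.
  case: (leP 0 (v - rs)) => vrs.
    by rewrite ler_pM//; clear -u0 rs0 rsS vL v0 t20; lra.
  have h2 : 0 <= (u + rs) * (rs - v) by rewrite mulr_ge0//; clear -u0 rs0 vrs; lra.
  have h3 : 0 <= 2 * (u + t ^+ 2) * L by rewrite !mulr_ge0 ?addr_ge0 ?(ltW L0).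
  clear -h2 h3; lra.
apply: (le_trans h1); rewrite !exprMn S2.
have w0 : 0 <= u + t ^+ 2 by rewrite addr_ge0.
have -> : 2 * (u + t ^+ 2) * L = (2 * L) * (u + t ^+ 2) by ring.
rewrite ler_wpM2r//; clear -L0; nra.
Qed.

Section averaged_modulus.
Context {R : realType}.
Notation mu := (@lebesgue_measure R).
Notation RR := (measurableTypeR R * measurableTypeR R)%type.
Variables (a b c : R) (r M : nat).
Hypotheses (ab : a < b) (c0 : 0 < c) (r0 : (0 < r)%N) (M0 : (0 < M)%N).
Hypothesis csmall : r%:R * (c * (2 * (b - a) + 2)) <= 2^-1.
Hypothesis csmall2 : 16 * c * (b - a + 1) <= 1.
Notation phi := (step_weight a b).
Notation stepw := (stepw a b c).
Notation Bs := (Bs a c).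

Definition pdiff (f : {poly R}) (y s : R) : R :=
  \sum_(i < r.+1) 'C(r, i)%:R * (-1) ^+ i * f.[y + i%:R * s].

Lemma measurable_Bs t : measurable_fun [set: R] (Bs t).
Proof.
apply: measurable_funM => //.
apply: (measurableT_comp (f := @Num.sqrt R) (g := fun x : R => x - a + t ^+ 2)).
  by apply: continuous_measurable_fun; exact: sqrt_continuous.
by apply: measurable_funD => //; exact: measurable_funB.
Qed.

Lemma measurable_comp_fst (f : R -> R) : measurable_fun [set: R] f ->
  measurable_fun [set: RR] (fun p : RR => f p.1).
Proof. by move=> mf; apply: (measurableT_comp (f := f)) => //; exact: measurable_fst. Qed.

Lemma measurable_pdiff f : measurable_fun [set: RR] (fun p : RR => pdiff f p.1 p.2).
Proof.
apply: measurable_sum => i; apply: measurable_funM => //.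
apply: (measurableT_comp (f := horner f)); first exact: measurable_horner.
apply: measurable_funD; first exact: measurable_fst.
by apply: measurable_funM => //; exact: measurable_snd.
Qed.

(* The substitutions [s = stepw t y * z], [x = y + r s / 2] and [s = h * step_weight a b x]
   turn the averaged square of the one-sided difference into the square of [wdiff_int],
   integrated over [0 < h <= t]; [zone] is the integrand in the variables [y] and [s]. *)
Definition in_zone (t y s : R) : Prop := [/\ a <= y, y < b, 0 < s & s <= stepw t y].

Definition zone_weight (t y : R) : R := (b - y) ^+ (2 * M).-1 * (Bs t y)^-1.

Definition zone (f : {poly R}) (t y s : R) : R :=
  if `[< in_zone t y s >] then zone_weight t y * pdiff f y s ^+ 2 else 0.

Lemma zoneE f t y s : zone f t y s =
  if `[< in_zone t y s >] then zone_weight t y * pdiff f y s ^+ 2 else 0.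
Proof. by []. Qed.

Lemma zone_weight_ge0 t y : 0 < t -> a <= y -> y < b -> 0 <= zone_weight t y.
Proof.
move=> t0 ay yb; rewrite mulr_ge0 ?exprn_ge0 ?subr_ge0 ?(ltW yb)//.
by rewrite invr_ge0 ltW// Bs_gt0.
Qed.

Lemma zone_ge0 f t y s : 0 < t -> 0 <= zone f t y s.
Proof.
move=> t0; rewrite /zone; case: asboolP => // -[ay yb _ _].
by rewrite mulr_ge0 ?sqr_ge0// zone_weight_ge0.
Qed.

Lemma measurable_zone f t : 0 < t -> measurable_fun [set: RR] (fun p : RR => zone f t p.1 p.2).
Proof.
move=> t0; apply: measurable_if.
  have -> : [set p : RR | in_zone t p.1 p.2] = ([set p : RR | a <= p.1] `&` [set p : RR | p.1 < b]) `&`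
     ([set p : RR | 0 < p.2] `&` [set p : RR | p.2 <= stepw t p.1]).
    by apply/seteqP; split => p /=; [move=> []|move=> [[? ?] [? ?]]; split].
  have m1 := @measurable_fst _ _ (measurableTypeR R) (measurableTypeR R).
  have m2 := @measurable_snd _ _ (measurableTypeR R) (measurableTypeR R).
  apply: measurableI; apply: measurableI.
  - exact: measurable_le_set.
  - exact: measurable_lt_set.
  - exact: measurable_lt_set.
  - by apply: measurable_le_set => //; apply: measurable_comp_fst; exact: measurable_stepw.
apply: measurable_funM; last by apply: measurable_funX; exact: measurable_pdiff.
apply: (measurable_comp_fst (f := zone_weight t)).
apply: measurable_funM; first by apply: measurable_funX; exact: measurable_funB.
apply: measurable_inv_ge0; last exact: measurable_Bs.
by move=> y; exact: mulr_ge0 (mulr_ge0 (ltW c0) (ltW t0)) (sqrtr_ge0 _).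
Qed.

Lemma measurable_wdiff_int2 f : measurable_fun [set: RR]
  (fun p : RR => wdiff_int a b r p.2 (horner f) p.1).
Proof.
have m1 := @measurable_fst _ _ (measurableTypeR R) (measurableTypeR R).
have m2 := @measurable_snd _ _ (measurableTypeR R) (measurableTypeR R).
have mp : measurable_fun [set: RR] (fun p : RR => phi p.1).
  by apply: measurable_comp_fst; exact: measurable_step_weight.
apply: measurable_if.
  have -> : [set p : RR | admissible a b (r%:R * p.2 / 2) p.1] =
     ([set p : RR | a < p.1] `&` [set p : RR | p.1 < b]) `&`
     ([set p : RR | r%:R * p.2 / 2 * phi p.1 <= p.1 - a] `&` [set p : RR | r%:R * p.2 / 2 * phi p.1 <= b - p.1]).
    by apply/seteqP; split => p /=; [move=> []|move=> [[? ?] [? ?]]; split].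
  have mk : measurable_fun [set: RR] (fun p : RR => r%:R * p.2 / 2 * phi p.1).
    by apply: measurable_funM => //; apply: measurable_funM => //; exact: measurable_funM.
  apply: measurableI; apply: measurableI.
  - exact: measurable_lt_set.
  - exact: measurable_lt_set.
  - by apply: measurable_le_set => //; exact: measurable_funB.
  - by apply: measurable_le_set => //; exact: measurable_funB.
apply: measurable_sum => i; apply: measurable_funM => //.
apply: (measurableT_comp (f := horner f)); first exact: measurable_horner.
apply: measurable_funD => //; apply: measurable_funM => //; exact: measurable_funM.
Qed.

(** Licenses the substitution s = h phi(x): h lies in ]0, t], the stencil around x is admissible for
    that h, and the weight at y is controlled at x. *)
Lemma zone_point t y s : 0 < t -> t <= 1 -> in_zone t y s ->
  let x := y + r%:R * s / 2 in
  [/\ a < x /\ x < b, s <= t * phi x, admissible a b (r%:R * (s / phi x) / 2) x &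
      zone_weight t y <= (b - a + 1) ^+ (2 * M) * (2 / c) / (t * phi x)].
Proof.
move=> t0 t1 [ay yb s0 sd] x.
have yab : y \in `[a, b] by rewrite in_itv/= ay ltW.
have [d0 rd] := stepw_le ab c0 (ler0n _ r) csmall t0 t1 yab.
have xE : x = y + r%:R * s / 2 by [].
have : exists rs, rs = r%:R * s / 2 by eexists.
move=> [rs rsE]; rewrite -rsE in xE; clearbody x.
have rpos : (1 : R) <= r%:R by rewrite ler1n.
have rs0 : 0 < rs by rewrite rsE !mulr_gt0// ltr0n.
have u0 : 0 <= y - a by rewrite subr_ge0.
have v0 : 0 < b - y by rewrite subr_gt0.
have L0 : 0 < b - a by rewrite subr_gt0.
have vL : b - y <= b - a by rewrite lerB.
have rs_v : rs <= (b - y) / 4.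
  have : r%:R * s <= r%:R * stepw t y by rewrite ler_wpM2l.
  rewrite rsE; lra.
have [S [S2 S0 BE tS]] : exists S, [/\ S ^+ 2 = y - a + t ^+ 2, 0 < S, Bs t y = c * t * S & t <= S].
  exists (Num.sqrt (y - a + t ^+ 2)); split => //.
  - by rewrite sqr_sqrtr// addr_ge0// sqr_ge0.
  - by rewrite sqrtr_gt0 ltr_wpDl ?subr_ge0// exprn_gt0.
  - by rewrite -{1}(gtr0_norm t0) -sqrtr_sqr ler_wsqrtr// lerDr.
have sS : s <= c * t * S * (b - y) by rewrite -BE.
have ax : a < x by rewrite xE; lra.
have xb : x < b by rewrite xE; lra.
have xab : x \in `[a, b] by rewrite in_itv/= !ltW.
have p0 : 0 < phi x by rewrite sqrtr_gt0 mulr_gt0// subr_gt0.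
have p2 : phi x ^+ 2 = (y - a + rs) * (b - y - rs).
  by rewrite step_weight_sqr// xE; ring.
have srs : s / 2 <= rs by rewrite rsE ler_wpM2r// ler_peMl ?(ltW s0).
split => //.
- rewrite -(ler_pXn2r (n := 2))// ?nnegrE ?(ltW s0)// ?mulr_ge0 ?(ltW t0) ?(ltW p0)//.
  rewrite exprMn p2; exact: (zone_step_le u0 v0 vL t0 c0 s0 rs0 S0 rs_v S2 sS srs csmall2).
- have E : r%:R * (s / phi x) / 2 * phi x = rs by rewrite rsE; field; rewrite gt_eqF.
  by split; rewrite ?E//; [rewrite xE; lra|rewrite xE; lra].
have pS : phi x <= 2 * (b - a + 1) * S.
  rewrite -(ler_pXn2r (n := 2))// ?nnegrE ?(ltW p0)// ?mulr_ge0 ?(ltW S0)//; last by lra.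
  rewrite p2; exact: (zone_weight_le_aux u0 v0 vL t0 c0 (ler0n _ r) rs0 S0 rsE S2 sS tS csmall).
have B0 : 0 < Bs t y by exact: Bs_gt0.
rewrite /zone_weight ler_pdivlMr ?mulr_gt0// mulrAC ler_pdivrMr// BE.
have -> : (b - a + 1) ^+ (2 * M) * (2 / c) * (c * t * S) =
    (b - a + 1) ^+ (2 * M).-1 * (t * (2 * (b - a + 1) * S)).
  have -> : (2 * M)%N = (2 * M).-1.+1 by rewrite prednK// muln_gt0.
  by rewrite exprS /=; field; rewrite gt_eqF.
apply: ler_pM; rewrite ?exprn_ge0 ?mulr_ge0 ?(ltW t0) ?(ltW p0) ?(ltW v0)//.
  by rewrite lerXn2r ?nnegrE ?(ltW v0)//; lra.
by rewrite ler_wpM2l ?(ltW t0).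
Qed.

End averaged_modulus.

Section averaged_modulus_bound.
Context {R : realType}.
Notation mu := (@lebesgue_measure R).
Notation RR := (measurableTypeR R * measurableTypeR R)%type.
Variables (a b c : R) (r M : nat).
Hypotheses (ab : a < b) (c0 : 0 < c) (r0 : (0 < r)%N) (M0 : (0 < M)%N).
Hypothesis csmall : r%:R * (c * (2 * (b - a) + 2)) <= 2^-1.
Hypothesis csmall2 : 16 * c * (b - a + 1) <= 1.
Notation phi := (step_weight a b).
Notation stepw := (stepw a b c).
Notation Bs := (Bs a c).
Notation zone := (zone a b c r M).
Notation pdiff := (pdiff r).

Lemma pint_mul_sqr_le (eta G : {poly R}) (K : R) : 0 <= K ->
  (forall x, x \in `[0, 1] -> `|eta.[x]| <= K) ->
  pint 0 1 (eta * G) ^+ 2 <= K ^+ 2 * pint 0 1 (G ^+ 2).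
Proof.
move=> K0 HK; rewrite (le_trans (pint_sqr_le _))// -subr_ge0 -mulN1r -!pintZ -pintD.
apply: pint_ge0 => // x x01.
rewrite hornerD !hornerZ !horner_exp hornerM mulN1r subr_ge0 exprMn ler_wpM2r ?sqr_ge0//.
by apply: ler_sqr_norm; rewrite (ger0_norm K0) HK.
Qed.

Definition diff_poly (f : {poly R}) (t y : R) : {poly R} :=
  \sum_(i < r.+1) ('C(r, i)%:R * (-1) ^+ i) *: (f \Po (y%:P + (i%:R * stepw t y) *: 'X)).

Lemma horner_diff_poly f t y z : (diff_poly f t y).[z] = pdiff f y (stepw t y * z).
Proof.
rewrite /diff_poly horner_sum; apply: eq_bigr => i _.
by rewrite hornerZ horner_comp_affine mulrA.
Qed.

Lemma measurable_pdiff1 f y : measurable_fun [set: R] (pdiff f y).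
Proof.
have -> : pdiff f y = (fun p : RR => pdiff f p.1 p.2) \o (fun s => (y, s)) by [].
by apply: measurableT_comp; [exact: measurable_pdiff|exact: measurable_fun_pair].
Qed.

(** Cauchy-Schwarz in z followed by s = d(y) z. The factor 1 / d(y) = 1 / (Bs (b - y)) takes one
    power from (b - y)^(2 M), hence the exponent 2 M - 1 in [zone_weight]. *)
Lemma average_le_zone (eta f : {poly R}) (t y K : R) : 0 < t -> t <= 1 -> y \in `[a, b] -> 0 <= K ->
  (forall x, x \in `[0, 1] -> `|eta.[x]| <= K) ->
  ((((b - y) ^+ M * pint 0 1 (eta * diff_poly f t y)) ^+ 2)%:E <=
    (K ^+ 2)%:E * \int[mu]_s (zone f t y s)%:E)%E.
Proof.
move=> t0 t1; rewrite in_itv/= => /andP[ay yb] K0 HK.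
have Z0 : (0 <= \int[mu]_s (zone f t y s)%:E)%E.
  by apply: integral_ge0 => s _; rewrite lee_fin zone_ge0.
(* At y = b the step is 0 and no substitution is possible; the left side vanishes because M > 0. *)
have [->|nby] := eqVneq y b.
  rewrite subrr expr0n eqn0Ngt M0 mul0r expr0n/= mule_ge0// ?lee_fin ?sqr_ge0//.
  by apply: integral_ge0 => s _; rewrite lee_fin zone_ge0.
have {nby}yb : y < b by rewrite lt_neqAle nby.
have d0 : 0 < stepw t y by exact: stepw_gt0.
have v0 : 0 < b - y by rewrite subr_gt0.
have B0 : 0 < Bs t y by exact: Bs_gt0.
apply: (@le_trans _ _ ((K ^+ 2)%:E * (((b - y) ^+ M) ^+ 2 * pint 0 1 (diff_poly f t y ^+ 2))%:E)%E).
  rewrite -EFinM lee_fin (exprMn 2 ((b - y) ^+ M)) (mulrCA (K ^+ 2)).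
  apply: ler_wpM2l; first exact: sqr_ge0.
  exact: pint_mul_sqr_le.
rewrite lee_wpmul2l ?lee_fin ?sqr_ge0//.
rewrite EFinM -pint_lebesgue//.
have -> : (\int[mu]_(x in `[0%R, 1%R]) ((diff_poly f t y ^+ 2).[x])%:E =
    \int[mu]_(z in `]0%R, 1%R]) ((pdiff f y (stepw t y * z)) ^+ 2)%:E)%E.
  rewrite -integral_itv_obnd_cbnd; last first.
    by apply/measurable_EFinP; exact: measurable_horner.
  by apply: eq_integral => z _; rewrite horner_exp horner_diff_poly.
pose F (s : R) := if `[< 0 < s /\ s <= stepw t y >] then (pdiff f y s) ^+ 2 else 0.
have F0 s : 0 <= F s by rewrite /F; case: ifP => // _; exact: sqr_ge0.
have mF : measurable_fun [set: R] F.
  apply: measurable_if; last by apply: measurable_funX; exact: measurable_pdiff1.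
  have -> : [set s | 0 < s /\ s <= stepw t y] = `]0, stepw t y]%classic.
    by apply/seteqP; split => s /=; rewrite in_itv/=; [move=> [-> ->]|move=> /andP[]].
  exact: measurable_itv.
have -> : (\int[mu]_(z in `]0%R, 1%R]) ((pdiff f y (stepw t y * z)) ^+ 2)%:E =
    \int[mu]_(z in `]0%R, 1%R]) (F (stepw t y * z))%:E)%E.
  apply: eq_integral => z /[!inE]/=; rewrite in_itv/= => /andP[z0 z1].
  rewrite /F; case: asboolP => // -[]; split; first exact: mulr_gt0.
  by rewrite -[leRHS]mulr1 ler_wpM2l ?(ltW d0).
have := @expanding_integral R `]0%R, 1%R] setT (fun z => stepw t y * z) (stepw t y)
  (fun s => (F s)%:E) d0.
move=> E.
have H : (\int[mu]_(z in `]0%R, 1%R]) (F (stepw t y * z))%:E <=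
    (stepw t y)^-1%:E * \int[mu]_s (F s)%:E)%E.
  apply: E => //.
  - by apply: measurable_funM.
  - by apply/measurable_EFinP.
  - by move=> x z _ _; rewrite -mulrBr normrM (gtr0_norm d0).
have w0 : (0 <= (((b - y) ^+ M) ^+ 2)%:E)%E by rewrite lee_fin sqr_ge0.
apply: (le_trans (lee_wpmul2l w0 H)).
rewrite muleA -EFinM -ge0_integralZl//; first last.
- by rewrite lee_fin mulr_ge0 ?sqr_ge0// invr_ge0 ltW.
- by move=> s _; rewrite lee_fin.
- by apply/measurable_EFinP.
rewrite le_eqVlt; apply/orP; left; apply/eqP; apply: eq_integral => s _.
rewrite -EFinM /F !zoneE; congr (_%:E); case: asboolP => P1; case: asboolP => P2.
- congr (_ * _); rewrite /zone_weight !stepwE -exprM.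
  have -> : (M * 2)%N = (2 * M).-1.+1 by rewrite prednK ?muln_gt0// mulnC.
  by rewrite exprS /=; field; rewrite !gt_eqF.
- by case: P2; split=> //; case: P1.
- by case: P1; case: P2.
- by rewrite mulr0.
Qed.

(** For a fixed midpoint x, substitute s = h phi(x): the factor phi(x) so produced cancels the one
    in the bound on the weight, and a multiple of the mean over h in ]0, t] remains. *)
Lemma zone_fiber_le (f : {poly R}) (t x : R) : 0 < t -> t <= 1 ->
  (\int[mu]_s (zone f t (x - r%:R * s / 2) s)%:E <=
   if x \in `[a, b] then
    ((b - a + 1) ^+ (2 * M) * (2 / c) / t)%:E *
     \int[mu]_(h in `]0%R, t]) ((wdiff_int a b r h (horner f) x) ^+ 2)%:E
   else 0)%E.
Proof.
move=> t0 t1; pose A := (b - a + 1) ^+ (2 * M) * (2 / c).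
have A0 : 0 <= A.
  by rewrite mulr_ge0 ?exprn_ge0 ?divr_ge0 ?(ltW c0)// addr_ge0// subr_ge0 ltW.
case: (boolP ((a < x) && (x < b))) => [/andP[ax xb]|nx]; last first.
  have -> : (\int[mu]_s (zone f t (x - r%:R * s / 2) s)%:E = 0)%E.
    apply: integral0_eq => s _; rewrite !zoneE; case: asboolP => // Z.
    have [[ax xb] _ _ _] := zone_point ab c0 r0 M0 csmall csmall2 t0 t1 Z.
    by move: ax xb nx; rewrite subrK => -> ->.
  case: ifP => // _; apply: mule_ge0.
    by rewrite lee_fin divr_ge0 ?(ltW t0).
  by apply: integral_ge0 => h _; rewrite lee_fin sqr_ge0.
have xab : x \in `[a, b] by rewrite in_itv/= !ltW.
rewrite xab.
have p0 : 0 < phi x by rewrite sqrtr_gt0 mulr_gt0// subr_gt0.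
have w0 : (0 <= (A / (t * phi x))%:E)%E.
  by rewrite lee_fin; exact: divr_ge0 A0 (mulr_ge0 (ltW t0) (ltW p0)).
pose g (h : R) := ((wdiff_int a b r h (horner f) x) ^+ 2)%:E.
have mg : measurable_fun [set: R] g.
  apply/measurable_EFinP; apply: measurable_funX.
  have -> : (fun h => wdiff_int a b r h (horner f) x) =
    (fun p : RR => wdiff_int a b r p.2 (horner f) p.1) \o (fun s => (x, s)) by [].
  by apply: measurableT_comp; [exact: measurable_wdiff_int2|exact: measurable_fun_pair].
have g0 h : (0 <= g h)%E by rewrite lee_fin sqr_ge0.
have mZ : measurable_fun [set: R] (fun s => zone f t (x - r%:R * s / 2) s).
  have -> : (fun s => zone f t (x - r%:R * s / 2) s) =
    (fun p : RR => zone f t p.1 p.2) \o (fun s => (x - r%:R * s / 2, s)) by [].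
  apply: measurableT_comp; first exact: measurable_zone.
  apply: measurable_fun_pair => //.
  by apply: measurable_funB => //; apply: measurable_funM => //; exact: measurable_funM.
have step1 : (\int[mu]_s (zone f t (x - r%:R * s / 2) s)%:E <=
    \int[mu]_(s in `]0%R, (t * phi x)%R]) ((A / (t * phi x))%:E * g (s / phi x)%R))%E.
  rewrite [leRHS]integral_mkcond.
  apply: ge0_le_integral => //.
  - by move=> s _; rewrite lee_fin zone_ge0.
  - exact/measurable_EFinP.
  - apply/(measurable_restrictT _ _).1 => //; apply: emeasurable_funM => //.
    apply: measurable_funTS; apply: (measurableT_comp mg).
    exact: measurable_funM.
  move=> s _; rewrite patchE !zoneE; case: asboolP => Z; last first.
    by case: ifP => // _; exact: mule_ge0.
  have [_ st adm zw] := zone_point ab c0 r0 M0 csmall csmall2 t0 t1 Z.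
  rewrite subrK in st adm zw.
  have [_ _ s0 _] := Z.
  rewrite mem_set; last by rewrite /= in_itv/= s0.
  rewrite /g -EFinM lee_fin.
  have -> : wdiff_int a b r (s / phi x) (horner f) x = pdiff f (x - r%:R * s / 2) s.
    rewrite /wdiff_int; case: asboolP => // _; apply: eq_bigr => i _.
    by congr (_ * _.[_]); field; rewrite gt_eqF.
  by rewrite ler_wpM2r ?sqr_ge0.
apply: (le_trans step1).
rewrite ge0_integralZl//; first last.
- apply: measurable_funTS; apply: (measurableT_comp mg); exact: measurable_funM.
have H : (\int[mu]_(s in `]0%R, (t * phi x)%R]) g (s / phi x)%R <=
    ((phi x)^-1^-1)%:E * \int[mu]_(h in `]0%R, t]) g h)%E.
  apply: (@expanding_integral R `]0%R, (t * phi x)%R] `]0%R, t] (fun s => s / phi x) (phi x)^-1 g) => //.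
  - by rewrite invr_gt0.
  - exact: measurable_funM.
  - exact: measurable_funTS.
  - move=> s; rewrite /= !in_itv/= => /andP[s0 st].
    by rewrite divr_gt0//= ler_pdivrMr.
  - by move=> s s' _ _; rewrite -mulrBl normrM (gtr0_norm (_ : 0 < (phi x)^-1)) ?invr_gt0// mulrC.
apply: (le_trans (lee_wpmul2l w0 H)).
rewrite muleA -EFinM invrK -/A.
have -> : A / (t * phi x) * phi x = A / t by field; rewrite !gt_eqF.
by [].
Qed.

(** Tonelli is used three times: to fix s, where y -> y + r s / 2 is a translation; to return to
    fixed x for the fibre bound; and to integrate in x first for each h, where the hypothesis
    applies. The factor 1 / t then cancels the length of ]0, t]. *)
Lemma NB_averaged_modulus (eta : {poly R}) : exists2 K : R, 0 <= K &
  forall (t : R) (f : {poly R}) (e : R), 0 < t -> t <= 1 -> 0 <= e ->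
  (forall h, 0 < h -> h <= t -> NB a b (wdiff_int a b r h (horner f)) e) ->
  NB a b (fun y => (b - y) ^+ M * pint 0 1 (eta * diff_poly f t y)) (K * e).
Proof.
have [K K0 HK] := horner_bounded eta (ler01 : (0 : R) <= 1).
pose A := (b - a + 1) ^+ (2 * M) * (2 / c).
have A0 : 0 <= A.
  by rewrite mulr_ge0 ?exprn_ge0 ?divr_ge0 ?(ltW c0)// addr_ge0// subr_ge0 ltW.
exists (K * Num.sqrt A); first by rewrite mulr_ge0// sqrtr_ge0.
move=> t f e t0 t1 e0 He.
have mI : measurable_fun `[a, b] (fun y => (b - y) ^+ M * pint 0 1 (eta * diff_poly f t y)).
  apply: within_meas; apply: within_contM.
    have -> : (fun y => (b - y) ^+ M) = (fun y => ('X^M).[b - y]) by apply/funext => y; rewrite hornerXn.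
    by apply: within_cont_horner; exact: within_cont_v.
  have -> : (fun y => pint 0 1 (eta * diff_poly f t y)) =
    (fun y => \sum_(i < r.+1) ('C(r, i)%:R * (-1) ^+ i) * mom eta f y (i%:R * stepw t y)).
    apply/funext => y; rewrite /diff_poly mulr_sumr.
    rewrite (pint_sum _ (fun i => eta * (('C(r, i)%:R * (-1) ^+ i) *: (f \Po (y%:P + (i%:R * stepw t y) *: 'X))))).
    by apply: eq_bigr => i _; rewrite -scalerAr pintZ.
  apply: (within_cont_sum (F := fun i y => ('C(r, i)%:R * (-1) ^+ i) * mom eta f y (i%:R * stepw t y))) => i.
  by apply: within_contM; [exact: within_cont_cst|exact: within_cont_mom].
split => //; first by rewrite !mulr_ge0// sqrtr_ge0.
have mZ : measurable_fun [set: RR] (fun p : RR => zone f t p.1 p.2) by exact: measurable_zone.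
have Z0 y s : (0 <= (zone f t y s)%:E)%E by rewrite lee_fin zone_ge0.
have mZE : measurable_fun [set: RR] (fun p : RR => (zone f t p.1 p.2)%:E) by exact/measurable_EFinP.
have mZin : measurable_fun [set: R] (fun y => \int[mu]_s (zone f t y s)%:E)%E.
  exact: (measurable_inner_integral (G := fun y s => (zone f t y s)%:E)).
apply: (@le_trans _ _ ((K ^+ 2)%:E * \int[mu]_y \int[mu]_s (zone f t y s)%:E)%E).
  apply: (@le_trans _ _ (\int[mu]_(y in `[a, b]) ((K ^+ 2)%:E * \int[mu]_s (zone f t y s)%:E))%E).
    apply: ge0_le_integral => //=.
    - by move=> y _; rewrite lee_fin sqr_ge0.
    - exact: msqr.
    - by apply: emeasurable_funM => //; exact: measurable_funTS.
    - by move=> y yab; exact: average_le_zone.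
  rewrite ge0_integralZl//; first last.
  - by rewrite lee_fin sqr_ge0.
  - by move=> y _; exact: integral_ge0.
  - exact: measurable_funTS.
  rewrite lee_wpmul2l ?lee_fin ?sqr_ge0//.
  by apply: ge0_subset_integral => // y _; exact: integral_ge0.
rewrite 2!exprMn sqr_sqrtr// -mulrA (EFinM (K ^+ 2)) lee_wpmul2l ?lee_fin ?sqr_ge0//.
rewrite (tonelli_on (G := fun y s => (zone f t y s)%:E))//.
pose W (x s : R) := (zone f t (x - r%:R * s / 2) s)%:E.
have mW : measurable_fun [set: RR] (fun p : RR => W p.1 p.2).
  apply: (measurableT_comp (f := fun p : RR => (zone f t p.1 p.2)%:E)
    (g := fun p : RR => (p.1 - r%:R * p.2 / 2, p.2))) => //.
  apply: measurable_fun_pair; last exact: measurable_snd.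
  apply: measurable_funB; first exact: measurable_fst.
  by apply: measurable_funM => //; apply: measurable_funM => //; exact: measurable_snd.
have W0 x s : (0 <= W x s)%E by exact: Z0.
have mWs : measurable_fun [set: RR] (fun p : RR => W p.2 p.1).
  exact: (measurableT_comp mW (@measurable_swap _ _ _ _)).
have mZs : measurable_fun [set: RR] (fun p : RR => (zone f t p.2 p.1)%:E).
  exact: (measurableT_comp mZE (@measurable_swap _ _ _ _)).
apply: (@le_trans _ _ (\int[mu]_s \int[mu]_x W x s)%E).
  apply: ge0_le_integral => //.
  - by move=> s _; exact: integral_ge0.
  - exact: (measurable_inner_integral (G := fun s y => (zone f t y s)%:E)).
  - exact: (measurable_inner_integral (G := fun s x => W x s)).
  move=> s _.
  have E : (\int[mu]_y (zone f t y s)%:E = \int[mu]_y W (y + r%:R * s / 2)%R s)%E.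
    by apply: eq_integral => y _; rewrite /W addrK.
  rewrite E; have := @expanding_integral R setT setT (fun y => y + r%:R * s / 2) 1 (W^~ s) ltr01.
  rewrite invr1 mul1e; apply => //.
  - exact: measurable_funD.
  - apply: (measurableT_comp (f := fun p : RR => W p.1 p.2) (g := fun x : R => ((x, s) : RR))) => //.
  - by move=> x y _ _; rewrite mul1r opprD addrACA subrr addr0.
rewrite -(tonelli_on (G := W))//.
pose g (x h : R) := ((wdiff_int a b r h (horner f) x) ^+ 2)%:E.
have mg : measurable_fun [set: RR] (fun p : RR => g p.1 p.2).
  by apply/measurable_EFinP; apply: measurable_funX; exact: measurable_wdiff_int2.
have g0 x h : (0 <= g x h)%E by rewrite lee_fin sqr_ge0.
have mgin : measurable_fun [set: R] (fun x => \int[mu]_(h in `]0%R, t]) g x h)%E.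
  exact: measurable_inner_integral.
have At0 : (0 <= (A / t)%:E)%E by rewrite lee_fin divr_ge0 ?(ltW t0).
apply: (@le_trans _ _ (\int[mu]_(x in `[a, b]) ((A / t)%:E * \int[mu]_(h in `]0%R, t]) g x h))%E).
  rewrite [leRHS]integral_mkcond; apply: ge0_le_integral => //.
  - by move=> x _; exact: integral_ge0.
  - exact: (measurable_inner_integral (G := W)).
  - by apply/(measurable_restrictT _ _).1 => //; apply: emeasurable_funM => //; exact: measurable_funTS.
  - move=> x _; rewrite patchE; have := zone_fiber_le f x t0 t1.
    rewrite (_ : (x \in `[a, b]%classic) = (x \in `[a, b])) ?mem_setE//.
rewrite ge0_integralZl//; first last.
- by move=> x _; exact: integral_ge0.
- exact: measurable_funTS.
rewrite tonelli_on//.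
apply: (@le_trans _ _ ((A / t)%:E * (\int[mu]_(h in `]0%R, t]) cst (e ^+ 2)%:E h))%E).
  rewrite lee_wpmul2l//; apply: ge0_le_integral => //.
  - by move=> h _; exact: integral_ge0.
  - apply: measurable_funTS; apply: (measurable_inner_integral (G := fun h x => g x h)) => //.
    exact: (measurableT_comp mg (@measurable_swap _ _ _ _)).
  - by move=> h; rewrite /= in_itv/= => /andP[h0 ht]; have [_ _] := He h h0 ht.
rewrite integral_cst//.
rewrite [X in (_ * (_ * X))%E](_ : _ = t%:E); last first.
  by rewrite /= lebesgue_measure_itv/= lte_fin t0 -EFinB subr0.
rewrite -!EFinM lee_fin; have -> : A / t * (e ^+ 2 * t) = A * e ^+ 2 by field; rewrite gt_eqF.
by [].
Qed.

End averaged_modulus_bound.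

(** * The local direct inequality at one endpoint, and reflection *)

Section averaging_kernel.
Context {R : realType}.

Lemma pint01_Xn m : pint 0 1 ('X^m : {poly R}) = m.+1%:R^-1.
Proof.
have := pint_deriv 0 1 ('X^(m.+1) : {poly R}).
rewrite derivXn /= -scaler_nat pintZ !hornerXn expr0n expr1n subr0 => E.
by apply: (mulfI (x := m.+1%:R)); rewrite ?pnatr_eq0// E divff// pnatr_eq0.
Qed.

(** A normalised power of X (1 - X). The exponent 2^k, which is at least k, lets positivity of the
    integral follow by repeated squaring from [pint_sqr_le]. *)
Lemma averaging_kernel k : exists rho : {poly R},
  pint 0 1 rho = 1 /\ exists g, rho = ('X * (1 - 'X)) ^+ k * g.
Proof.
pose w : {poly R} := 'X * (1 - 'X).
have P0 j : 0 < pint 0 1 (w ^+ (2 ^ j)).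
  elim: j => [|j IH]; last first.
    by rewrite expnSr exprM; apply: lt_le_trans (pint_sqr_le _); exact: exprn_gt0.
  have -> : w ^+ (2 ^ 0) = 'X^1 + (-1) *: 'X^2.
    by rewrite expn0 expr1 /w mulrBr mulr1 scaleN1r expr2.
  by rewrite pintD pintZ !pint01_Xn; lra.
exists ((pint 0 1 (w ^+ (2 ^ k)))^-1 *: w ^+ (2 ^ k)); split.
  by rewrite pintZ mulVf// gt_eqF.
exists ((pint 0 1 (w ^+ (2 ^ k)))^-1 *: w ^+ (2 ^ k - k)).
rewrite -scalerAr -exprD subnKC//; exact: ltnW (ltn_expl _ _).
Qed.

Lemma ceval_poly (a b c : R) (G : {poly R}) :
  exists e, forall t y, ceval a b c t y e = G.[y].
Proof.
elim/poly_ind: G => [|p x [e He]].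
  by exists (Cst 0) => t y; rewrite /= horner0.
exists (Cadd (Cmul e (Cadd (Cst b) (Cmul (Cst (-1)) Cv))) (Cst x)) => t y.
by rewrite /= He hornerMXaddC; ring.
Qed.

End averaging_kernel.

Section one_sided.
Context {R : realType}.
Variables (a b c : R) (r M : nat).
Hypotheses (ab : a < b) (c0 : 0 < c) (r0 : (0 < r)%N) (M0 : (0 < M)%N).
Hypothesis csmall : r%:R * (c * (2 * (b - a) + 2)) <= 2^-1.
Hypothesis csmall2 : 16 * c * (b - a + 1) <= 1.
Hypothesis dense : poly_dense a b.
Notation stepw := (stepw a b c).

(** In the average of the r-th forward difference the term i = 0 is f itself, the kernel having
    integral 1. So f is that average, controlled by the modulus, minus the terms i >= 1, which are
    smooth; the factor G is absorbed into the coefficients of the latter. *)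
Lemma EB_one_sided k (G : {poly R}) : (k <= M)%N -> exists2 K : R, 0 <= K &
  forall (t : R) (f : {poly R}) (e w : R) N, 0 < t -> t <= 1 -> (0 < N)%N -> 0 <= w ->
  NB a b (horner f) e ->
  (forall h, 0 < h -> h <= t -> NB a b (wdiff_int a b r h (horner f)) w) ->
  EB a b (fun y => (b - y) ^+ M * (G.[y] * f.[y])) N (K * (w + (N%:R * t)^-1 ^+ k * e)).
Proof.
move=> kM; have [rho [rho1 [g rhoE]]] := @averaging_kernel R k.
have [eG HG] := ceval_poly a b c G.
pose s := [seq ((Cmul eG (Cst (- ('C(r, i)%:R * (-1) ^+ i))), rho, i%:R) : sterm (R := R))
  | i <- iota 1 r].
have Hs : all_vanishing r%:R k s.
  have : all (fun i => (0 < i <= r)%N) (iota 1 r).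
    by apply/allP => i; rewrite mem_iota add1n ltnS.
  rewrite /s; elim: (iota 1 r) => //= i l IH /andP[i0 Hl]; split; last exact: IH.
  by split; [rewrite /= ltr0n ler_nat|exists g].
have [K1 K10 HK1] := EB_smooth ab c0 (ler0n R r) csmall dense kM Hs.
have [K2 K20 HK2] := NB_averaged_modulus ab c0 r0 M0 csmall csmall2 rho.
have [K3 K30 HK3] := horner_bounded G (ltW ab).
exists (K3 * K2 + K1); first by rewrite addr_ge0// mulr_ge0.
move=> t f e w N t0 t1 N0 w0 Hf Hw; have e0 : 0 <= e by case: Hf.
have N00 : 0 <= (N%:R * t)^-1 ^+ k :> R by rewrite exprn_ge0// invr_ge0 mulr_ge0// ltW.
have E1 : EB a b (fun y => G.[y] * ((b - y) ^+ M * pint 0 1 (rho * diff_poly a b c r f t y))) N (K3 * (K2 * w)).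
  apply: NB_EB; apply: (NB_le _ K30 _ (HK2 t f w t0 t1 w0 Hw)); last first.
    by move=> y yab; rewrite normrM ler_wpM2r// HK3.
  have [mW _ _] := HK2 t f w t0 t1 w0 Hw.
  by apply: measurable_funM => //; exact: measurable_horner.
apply: EB_mono (leqnn N) _ (EB_ext _ (EB_add E1 (HK1 t f e N t0 t1 N0 Hf))).
  have -> : K3 * (K2 * w) + K1 * (N%:R * t)^-1 ^+ k * e = (K3 * K2) * w + K1 * ((N%:R * t)^-1 ^+ k * e) by ring.
  by rewrite mulrDr lerD// ler_wpM2r// ?mulr_ge0// ?lerDr ?lerDl// mulr_ge0.
move=> y yab; rewrite /smooth expr0 mul1r subn0.
have -> : \sum_(T <- s) term_val a b c f t y T =
    - G.[y] * \sum_(1 <= i < r.+1) 'C(r, i)%:R * (-1) ^+ i * mom rho f y (i%:R * stepw t y).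
  rewrite /s big_map mulr_sumr /index_iota subn1 /=.
  by apply: eq_bigr => i _; rewrite /term_val /= HG; ring.
have -> : pint 0 1 (rho * diff_poly a b c r f t y) = f.[y] +
    \sum_(1 <= i < r.+1) 'C(r, i)%:R * (-1) ^+ i * mom rho f y (i%:R * stepw t y).
  rewrite /diff_poly mulr_sumr.
  rewrite (pint_sum _ (fun i => rho * (('C(r, i)%:R * (-1) ^+ i) *: (f \Po (y%:P + (i%:R * stepw t y) *: 'X))))).
  rewrite -(big_mkord xpredT (fun i => pint 0 1 (rho * (('C(r, i)%:R * (-1) ^+ i) *: (f \Po (y%:P + (i%:R * stepw t y) *: 'X)))))).
  rewrite big_ltn//; congr (_ + _); last first.
    by apply: eq_bigr => i _; rewrite -scalerAr pintZ.
  rewrite bin0 expr0 mul1r scale1r mul0r scale0r addr0 comp_polyCr.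
  by rewrite mulrC mul_polyC pintZ rho1 mulr1.
by ring.
Qed.

End one_sided.

Section mirror.
Context {R : realType}.
Variables (a b : R).
Hypothesis ab : a < b.

Lemma NB_mirror f e : NB a b f e -> NB a b (fun x => f (a + b - x)) e.
Proof.
move=> H; have := @NB_comp R a b a b f (fun x => a + b - x) 1 e ltr01.
rewrite invr1 sqrtr1 mul1r; apply => //.
- exact: measurable_funB.
- by move=> x; rewrite !in_itv/= => /andP[? ?]; apply/andP; split; lra.
- by move=> x y _ _; rewrite mul1r distrC; have -> : a + b - x - (a + b - y) = y - x by ring.
Qed.

Definition mirror_poly (P : {poly R}) := P \Po ((a + b)%:P - 'X).

Lemma horner_mirror P x : (mirror_poly P).[x] = P.[a + b - x].
Proof. by rewrite horner_comp !hornerE. Qed.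

Lemma size_mirror P : (size (mirror_poly P) <= size P)%N.
Proof.
rewrite /mirror_poly; have S : size ((a + b)%:P - 'X : {poly R}) = 2%N.
  by rewrite -opprB size_polyN size_XsubC.
have [->|P0] := eqVneq P 0; first by rewrite comp_poly0.
by rewrite (leq_trans (size_comp_poly_leq _ _))// S muln1 prednK// size_poly_gt0.
Qed.

Lemma EB_mirror f n e : EB a b f n e -> EB a b (fun x => f (a + b - x)) n e.
Proof.
move=> H eps e0; have [P sP HP] := H _ e0.
exists (mirror_poly P); first exact: leq_trans (size_mirror P) sP.
by apply: NB_ext (NB_mirror HP) => x _; rewrite horner_mirror.
Qed.

Lemma step_weight_mirror x : step_weight a b (a + b - x) = step_weight a b x.
Proof. by rewrite /step_weight; congr Num.sqrt; ring. Qed.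

Lemma wdiff_int_mirror r h f x :
  wdiff_int a b r h (fun x => f (a + b - x)) x = (-1) ^+ r * wdiff_int a b r h f (a + b - x).
Proof.
rewrite /wdiff_int step_weight_mirror.
have E : admissible a b (r%:R * h / 2) (a + b - x) = admissible a b (r%:R * h / 2) x.
  apply/propext; rewrite /admissible step_weight_mirror.
  have -> : a + b - x - a = b - x by ring.
  have -> : b - (a + b - x) = x - a by ring.
  by split => -[h1 h2 h3 h4]; split => //; lra.
rewrite E; case: asboolP => A; last by rewrite mulr0.
rewrite mulr_sumr (reindex_inj rev_ord_inj)/=; apply: eq_bigr => i _.
have ir : (i <= r)%N by rewrite -ltnS.
rewrite subSS bin_sub// natrB// -signr_odd oddB// signr_addb !signr_odd.
rewrite -!mulrA [RHS]mulrCA; congr (_ * (_ * (_ * f _))); by field.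
Qed.

End mirror.

(** * Direct and converse inequalities for the modulus *)

Section direct_inequality.
Context {R : realType}.
Variables (a b : R) (r : nat).
Hypotheses (ab : a < b) (r0 : (0 < r)%N).
Hypothesis dense : poly_dense a b.

Lemma wdiff_intB h f g x :
  wdiff_int a b r h (fun x => f x - g x) x = wdiff_int a b r h f x - wdiff_int a b r h g x.
Proof.
rewrite /wdiff_int; case: asboolP => // A; last by rewrite subr0.
by rewrite -sumrB; apply: eq_bigr => i _; rewrite mulrBr.
Qed.

Lemma coprime_endpoints M : exists G1 G2 : {poly R}, forall y,
  (b - y) ^+ M * G1.[y] + (y - a) ^+ M * G2.[y] = 1.
Proof.
have C : coprimep ((b%:P - 'X) ^+ M : {poly R}) (('X - a%:P) ^+ M).
  apply: coprimep_expl; apply: coprimep_expr.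
  rewrite coprimep_XsubC /root !hornerE subr_eq0 gt_eqF//.
have /Bezout_eq1_coprimepP[[u v] /= uv] := C.
exists u, v => y; have := congr1 (fun p => p.[y]) uv.
by rewrite !hornerE => <-; rewrite [u.[y] * _]mulrC [v.[y] * _]mulrC.
Qed.

Lemma EB_modulus_poly k : exists2 K : R, 0 <= K &
  forall (t : R) (f : {poly R}) (e w : R) N, 0 < t -> t <= 1 -> (0 < N)%N ->
  NB a b (horner f) e ->
  (forall h, 0 < h -> h <= t -> NB a b (wdiff_int a b r h (horner f)) w) ->
  EB a b (horner f) N (K * (w + (N%:R * t)^-1 ^+ k * e)).
Proof.
pose L := b - a; have L0 : 0 < L by rewrite subr_gt0.
(* Small enough for two purposes: averages that stay in [a, b] and expand, and difference steps s <=
   t phi(x). *)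
pose c := (16 * (r%:R + 1) * (L + 2))^-1.
have rp : (0 : R) <= r%:R by [].
have d0 : 0 < 16 * (r%:R + 1) * (L + 2) by rewrite !mulr_gt0//; lra.
have c0 : 0 < c by rewrite invr_gt0.
have csmall : r%:R * (c * (2 * (b - a) + 2)) <= 2^-1.
  have -> : r%:R * (c * (2 * (b - a) + 2)) = r%:R * (2 * L + 2) / (16 * (r%:R + 1) * (L + 2)).
    by rewrite /c /L; ring.
  by rewrite ler_pdivrMr//; move: rp L0; clear; move: (r%:R : R) => q; nra.
have csmall2 : 16 * c * (b - a + 1) <= 1.
  have -> : 16 * c * (b - a + 1) = 16 * (L + 1) / (16 * (r%:R + 1) * (L + 2)).
    by rewrite /c /L; ring.
  by rewrite ler_pdivrMr//; move: rp L0; clear; move: (r%:R : R) => q; nra.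
(* M = k + 1 provides one factor b - y for each of the k derivatives, and is positive even when k =
   0. *)
have [G1 [G2 HG]] := coprime_endpoints k.+1.
have [K1 K10 HK1] := EB_one_sided ab c0 r0 (ltn0Sn k) csmall csmall2 dense G1 (leqnSn k).
have [K2 K20 HK2] := EB_one_sided ab c0 r0 (ltn0Sn k) csmall csmall2 dense (mirror_poly a b G2) (leqnSn k).
exists (K1 + K2); first exact: addr_ge0.
move=> t f e w N t0 t1 N0 Hf Hw.
have w0 : 0 <= w by have [] := Hw t t0 (lexx t).
have E1 := HK1 t f e w N t0 t1 N0 w0 Hf Hw.
have Hfm : NB a b (horner (mirror_poly a b f)) e.
  by apply: NB_ext (NB_mirror Hf) => x _; rewrite horner_mirror.
have Hwm h : 0 < h -> h <= t -> NB a b (wdiff_int a b r h (horner (mirror_poly a b f))) w.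
  move=> h0 ht; have := NB_scale ((-1) ^+ r) (NB_mirror (Hw h h0 ht)).
  rewrite normrX normrN1 expr1n mul1r; apply: NB_ext => x _.
  rewrite -wdiff_int_mirror//; congr wdiff_int.
  by apply/funext => y; rewrite horner_mirror.
have E2 := EB_mirror (HK2 t _ e w N t0 t1 N0 w0 Hfm Hwm).
rewrite mulrDl; apply: EB_ext (EB_add E1 E2) => x _.
rewrite !horner_mirror.
have -> : a + b - (a + b - x) = x by ring.
have -> : b - (a + b - x) = x - a by ring.
by rewrite !mulrA -mulrDl HG mul1r.
Qed.

(** The averages are formed for polynomials, so f is replaced by a polynomial at distance d. The
    changes in the norm, in the differences and in f itself add up to d D = eps. *)
Theorem EB_modulus k : exists2 K : R, 0 <= K &
  forall (t : R) (f : R -> R) (e w : R) N, 0 < t -> t <= 1 -> (0 < N)%N ->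
  NB a b f e ->
  (forall h, 0 < h -> h <= t -> NB a b (wdiff_int a b r h f) w) ->
  EB a b f N (K * (w + (N%:R * t)^-1 ^+ k * e)).
Proof.
have [K K0 HK] := EB_modulus_poly k; exists K => // t f e w N t0 t1 N0 Hf Hw.
apply: EB_eps => eps eps0.
pose C := 2 ^+ r * Num.sqrt 2 : R.
have C0 : 0 <= C by rewrite mulr_ge0// ?exprn_ge0// sqrtr_ge0.
pose u := (N%:R * t)^-1 ^+ k; have u0 : 0 <= u.
  by rewrite exprn_ge0// invr_ge0 mulr_ge0// ltW.
pose D := K * (C + u) + 1.
have D0 : 0 < D by rewrite ltr_wpDl// mulr_ge0// addr_ge0.
pose d := eps / D; have d0 : 0 < d by exact: divr_gt0.
have [P HP] := dense Hf d0.
have HPn : NB a b (horner P) (e + d).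
  by apply: NB_ext (NB_sub Hf HP) => x _; ring.
have HPw h : 0 < h -> h <= t -> NB a b (wdiff_int a b r h (horner P)) (w + C * d).
  move=> h0 ht; apply: NB_ext (NB_sub (Hw h h0 ht) (NB_wdiff_int r (ltW h0) HP)) => x _.
  by rewrite -/C wdiff_intB; ring.
have E1 := HK t P (e + d) (w + C * d) N t0 t1 N0 HPn HPw.
apply: EB_mono (leqnn N) _ (EB_ext _ (EB_add E1 (NB_EB N HP))); last by move=> x _; ring.
have dD : d * D = eps by rewrite /d divfK// gt_eqF.
by rewrite -dD /D -/u; lra.
Qed.

End direct_inequality.

Section characterization.
Context {R : realType}.

Lemma expr_unbounded (y M : R) : 1 < y -> exists2 n, (0 < n)%N & M <= y ^+ n.
Proof.
move=> y1; have y10 : 0 < y - 1 by rewrite subr_gt0.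
have B n : n%:R * (y - 1) <= y ^+ n.
  elim: n => [|n IH]; first by rewrite mul0r.
  have p : 1 <= y ^+ n by rewrite exprn_ege1// ltW.
  have : (y - 1) * 1 <= (y - 1) * y ^+ n by rewrite ler_wpM2l// ltW.
  by rewrite -natr1 exprS; lra.
exists (Num.truncn (M / (y - 1))).+1 => //; apply: le_trans (B _).
by rewrite -ler_pdivrMr// ltW// truncnS_gt.
Qed.

Variables (a b alpha : R) (r : nat).
Hypotheses (ab : a < b) (al0 : 0 < alpha) (alr : alpha < r%:R).
Hypothesis dense : poly_dense a b.
Notation x := (2 `^ alpha).
Notation y := (2 `^ (r%:R - alpha)).

Lemma wdiff_intD h f g z :
  wdiff_int a b r h (fun x => f x + g x) z = wdiff_int a b r h f z + wdiff_int a b r h g z.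
Proof.
rewrite /wdiff_int; case: asboolP => // A; last by rewrite addr0.
by rewrite -big_split; apply: eq_bigr => i _; rewrite mulrDr.
Qed.

Lemma base_x_ge1 : 1 <= x :> R.
Proof.
have : 2 `^ 0 <= x :> R by rewrite ler_powR// ?ler1n// ltW.
by rewrite powRr0.
Qed.

Lemma base_y_gt1 : 1 < y :> R.
Proof.
have : 1 `^ (r%:R - alpha) < y :> R by rewrite gt0_ltr_powR ?subr_gt0 ?nnegrE// ltr1n.
by rewrite powR1.
Qed.

Lemma base_mul : y * x = 2 ^+ r :> R.
Proof.
rewrite -powRD; last by rewrite pnatr_eq0 implybT.
by rewrite subrK powR_mulrn.
Qed.

(* With [N = 2^j], the inequality [EB_modulus] at [t = 2^p / N] is applied to [f - P], where
   [P] has degree < 2^(j-l); [q], [l = p q] and [k] make both terms carrying the unknown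
   constant [K] smaller by a factor 2^-p, and [p] is then taken large. *)
Lemma dyadic_modulus_EB : exists2 K : R, 0 < K & forall (f : R -> R) (A : R), 0 < A ->
  NB a b f A ->
  (forall h, 0 < h -> h <= 1 -> NB a b (wdiff_int a b r h f) (A * h `^ alpha)) ->
  forall j, EB a b f (2 ^ j) (K * A * x^-1 ^+ j).
Proof.
have r0 : (0 < r)%N by rewrite -(ltr_nat R); exact: lt_trans alr.
have x1 := base_x_ge1; have y1 := base_y_gt1; have yx := base_mul.
have x0 : 0 < x :> R by exact: lt_le_trans x1.
have y0 : 0 < y :> R by exact: lt_trans y1.
have y10 : 0 < y - 1 :> R by rewrite subr_gt0.
have two1 : 1 < 2 :> R by rewrite ltr1n.
(* Here l = p q and N t = 2^p. The choice y^q >= 2^(r+1) gives t^r y^(j-l) <= 2^-p x^-j for the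
   modulus of P, and 2^k >= 2 x^q gives (N t)^-k x^-(j-l) <= 2^-p x^-j for the norm of f - P. *)
have [q q0 Hq] := expr_unbounded (2 ^+ r.+1) y1.
have [k k0 Hk] := expr_unbounded (2 * x ^+ q) two1.
have [C C0 HC] := EB_modulus ab r0 dense k.
have [B B0 HB] := NB_wdiff_poly ab r.
pose Y : R := B * (3 + 2 * x) * (y / (y - 1)).
have Y0 : 0 <= Y by rewrite !mulr_ge0 ?invr_ge0 ?(ltW y0) ?(ltW y10)//; lra.
have [p p0 Hp] := expr_unbounded (2 * (C * (Y + 2))) two1.
pose l := (p * q)%N; have l0 : (0 < l)%N by rewrite muln_gt0 p0.
(* The first summand makes C x^p at most K / 2, and the second makes the claim trivial for j < l +
   p. The choice of p brings the part proportional to K below K / 2. *)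
pose K : R := 2 * C * x ^+ p + x ^+ (l + p).
have K0 : 0 < K by rewrite ltr_wpDl ?exprn_gt0// !mulr_ge0 ?exprn_ge0// ltW.
exists K => // f A A0 Hf Hw.
have KA0 : 0 < K * A by exact: mulr_gt0.
have xVj j : 0 < x^-1 ^+ j :> R by rewrite exprn_gt0// invr_gt0.
elim/ltn_ind => j IH.
case: (ltnP j (l + p)) => jJ.
  apply: EB_mono (leqnn _) _ (NB_EB _ Hf).
  rewrite mulrAC ler_peMl ?(ltW A0)// exprVn ler_pdivlMr ?exprn_gt0// mul1r.
  apply: (@le_trans _ _ (x ^+ (l + p))).
    by rewrite ler_weXn2l// ltnW.
  by rewrite lerDr !mulr_ge0 ?exprn_ge0// ltW.
have lj : (l <= j)%N by apply: leq_trans jJ; exact: leq_addr.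
have pj : (p <= j)%N by apply: leq_trans jJ; exact: leq_addl.
pose t : R := (2 ^+ (j - p))^-1.
have t0 : 0 < t by rewrite invr_gt0 exprn_gt0.
have t1 : t <= 1 by rewrite /t invf_le1 ?exprn_gt0// exprn_ege1// (ltW two1).
(* All h <= t at once, with theta = t: these are the h over which the hypothesis of [EB_modulus]
   ranges. *)
pose Phi (g : R -> R) (e : R) := forall h, 0 < h -> h <= t -> NB a b (wdiff_int a b r h g) e.
have PhiD g1 g2 e1 e2 : Phi g1 e1 -> Phi g2 e2 -> Phi (fun z => g1 z + g2 z) (e1 + e2).
  move=> H1 H2 h h0 ht; apply: NB_ext (NB_add (H1 h h0 ht) (H2 h h0 ht)) => z _.
  by rewrite wdiff_intD.
have Phi_mono g e1 e2 : e1 <= e2 -> Phi g e1 -> Phi g e2.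
  by move=> ee H h h0 ht; apply: NB_mono ee (H h h0 ht).
have Phi_poly n (Q : {poly R}) e : (0 < n)%N -> (size Q <= n)%N ->
    NB a b (horner Q) e -> Phi (horner Q) (B * (n%:R * t) ^+ r * e).
  move=> n0 Qn HQ h h0 ht; apply: NB_mono (HB h n Q e (ltW h0) n0 Qn HQ).
  have e0 : 0 <= e by case: HQ.
  rewrite ler_wpM2r// ler_wpM2l// lerXn2r ?nnegrE ?mulr_ge0 ?(ltW h0) ?(ltW t0)//.
  by rewrite ler_wpM2l.
have HfK : NB a b f (K * A).
  apply: NB_mono Hf; rewrite ler_peMl ?(ltW A0)//.
  apply: (@le_trans _ _ (x ^+ (l + p))); first exact: exprn_ege1.
  by rewrite lerDr !mulr_ge0 ?exprn_ge0// ltW.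
have jl : (j - l < j)%N by rewrite ltn_subrL l0 (leq_trans l0).
have [P [sP HP PhiP]] := dyadic_approximant PhiD Phi_mono Phi_poly B0 t0 x1 y1 yx KA0
  HfK (fun i iJ => IH i (leq_ltn_trans iJ jl)).
have N0 : (0 < 2 ^ j)%N by rewrite expn_gt0.
pose u : R := x^-1 ^+ j; have u0 : 0 < u by exact: xVj.
pose v : R := (2 ^+ p)^-1; have v0 : 0 < v by rewrite invr_gt0 exprn_gt0.
have talpha : t `^ alpha = x ^+ p * u.
  rewrite /t powR_inv ?exprn_gt0// powR_exp// /u exprVn -{2}(subnKC pj) exprD invfM mulrA divff ?mul1r//.
have trE : t ^+ r * y ^+ (j - l) <= u * v.
  have Yp0 i : y ^+ i != 0 :> R by rewrite expf_neq0// gt_eqF.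
  have Xp0 i : x ^+ i != 0 :> R by rewrite expf_neq0// gt_eqF.
  have tE : t ^+ r = (y ^+ p * x ^+ p) / (y ^+ j * x ^+ j).
    rewrite /t exprVn -exprM mulnC exprM -yx exprMn.
    by rewrite -{3 4}(subnK pj) !exprD; field; rewrite !Yp0 !Xp0.
  have -> : t ^+ r * y ^+ (j - l) = u * ((y * x) ^+ p / y ^+ l).
    rewrite tE /u exprVn exprMn -{1}(subnK lj) exprD.
    by field; rewrite !Yp0 !Xp0.
  rewrite ler_wpM2l ?(ltW u0)// ler_pdivrMr ?exprn_gt0// /v [leRHS]mulrC ler_pdivlMr ?exprn_gt0//.
  rewrite yx -exprMn /l mulnC exprM lerXn2r ?nnegrE ?mulr_ge0 ?exprn_ge0 ?(ltW y0)//.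
  by rewrite -exprSr.
have tailE : (2 ^+ p)^-1 ^+ k * x^-1 ^+ (j - l) <= u * v.
  have -> : x^-1 ^+ (j - l) = u * x ^+ l.
    rewrite /u -{2}(subnK lj) exprD -mulrA !exprVn mulVf ?mulr1//.
  rewrite mulrCA ler_wpM2l ?(ltW u0)// /v -!exprVn -exprM mulnC exprM /l mulnC exprM -exprMn.
  rewrite lerXn2r ?nnegrE ?mulr_ge0 ?exprn_ge0 ?invr_ge0 ?(ltW x0)//.
  by rewrite exprVn mulrC ler_pdivrMr ?exprn_gt0// mulrC ler_pdivlMr// mulrC.
pose g z := f z - P.[z].
pose w : R := A * (x ^+ p * u) + Y * (K * A) * (u * v).
have Hg : NB a b g (2 * (K * A) * x^-1 ^+ (j - l)) by [].
have Hgw h : 0 < h -> h <= t -> NB a b (wdiff_int a b r h g) w.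
  move=> h0 ht; have hf := Hw h h0 (le_trans ht t1).
  apply: NB_ext (NB_mono _ (NB_sub hf (PhiP h h0 ht))) => [z _|].
    by rewrite -wdiff_intB.
  rewrite /w lerD//.
    by rewrite -talpha ler_wpM2l ?(ltW A0)// ge0_ler_powR ?nnegrE ?(ltW h0) ?(ltW t0) ?(ltW al0).
  have -> : B * (3 + 2 * x) * (K * A) * t ^+ r * (y ^+ (j - l) * (y / (y - 1))) =
    Y * (K * A) * (t ^+ r * y ^+ (j - l)) by rewrite /Y; ring.
  by rewrite ler_wpM2l// mulr_ge0// ltW.
have E := HC t g _ w (2 ^ j)%N t0 t1 N0 Hg Hgw.
have sPN : (size P <= 2 ^ j)%N by apply: (leq_trans sP); rewrite leq_exp2l// leq_subr.
apply: EB_ext (EB_mono (leqnn _) _ (EB_polyD sPN E)) => [z _|]; first by rewrite /g subrK.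
have -> : ((2 ^ j)%:R * t)^-1 = (2 ^+ p)^-1 :> R.
  rewrite natrX /t -{1}(subnKC pj) exprD mulfK//.
rewrite -/u.
apply: (@le_trans _ _ (C * (w + 2 * (K * A) * (u * v)))).
  rewrite ler_wpM2l// lerD2l mulrCA ler_wpM2l// ?mulr_ge0// ltW//.
have -> : C * (w + 2 * (K * A) * (u * v)) = (C * x ^+ p + C * (Y + 2) * v * K) * (A * u).
  by rewrite /w; ring.
rewrite -[leRHS]mulrA ler_wpM2r ?mulr_ge0 ?(ltW A0) ?(ltW u0)//.
have h1 : C * (Y + 2) * v <= 2^-1.
  by rewrite /v ler_pdivrMr ?exprn_gt0//; move: Hp; lra.
have h2 : C * (Y + 2) * v * K <= 2^-1 * K by rewrite ler_wpM2r// ltW.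
have h3 : 2 * C * x ^+ p <= K by rewrite /K lerDl exprn_ge0// ltW.
by move: h2 h3; clear; lra.
Qed.

(** Rounding m down to a power of 2 costs the factor 2^alpha. *)
Theorem modulus_EB : exists2 K : R, 0 < K & forall (f : R -> R) (A : R), 0 < A ->
  NB a b f A ->
  (forall h, 0 < h -> h <= 1 -> NB a b (wdiff_int a b r h f) (A * h `^ alpha)) ->
  forall m, (0 < m)%N -> EB a b f m (K * A * m%:R `^ (- alpha)).
Proof.
have [K K0 HK] := dyadic_modulus_EB; have x0 : 0 < x :> R by exact: powR_gt0.
exists (K * x); first exact: mulr_gt0.
move=> f A A0 Hf Hw m m0; pose j := trunc_log 2 m.
have jm : (2 ^ j <= m)%N by exact: trunc_logP.
have mj : (m < 2 ^ j.+1)%N by exact: trunc_log_ltn.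
apply: EB_mono jm _ (HK f A A0 Hf Hw j).
have -> : K * x * A * m%:R `^ (- alpha) = K * A * (x * m%:R `^ (- alpha)) by ring.
rewrite ler_wpM2l// ?mulr_ge0 ?(ltW K0) ?(ltW A0)//.
rewrite powRN exprVn ler_pdivlMr ?powR_gt0 ?ltr0n// [leLHS]mulrC ler_pdivrMr ?exprn_gt0//.
rewrite -exprS -powR_exp// ge0_ler_powR ?nnegrE ?(ltW al0) ?exprn_ge0//.
by rewrite -natrX ler_nat ltnW.
Qed.

(** The dyadic sum with theta = h for h <= 1; for h > 1 the bound by the norm of f is enough because
    h^alpha >= 1. *)
Theorem EB_modulus_le : exists2 K : R, 0 < K & forall (f : R -> R) (A : R), 0 < A ->
  NB a b f A -> (forall m, (0 < m)%N -> EB a b f m (A * m%:R `^ (- alpha))) ->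
  forall h, 0 < h -> NB a b (wdiff_int a b r h f) (K * A * h `^ alpha).
Proof.
pose C : R := 2 ^+ r * Num.sqrt 2.
have C0 : 0 < C by rewrite mulr_gt0 ?exprn_gt0 ?sqrtr_gt0.
have [B B0 HB] := NB_wdiff_poly ab r.
pose D := C + B; have D0 : 0 < D by rewrite ltr_wpDr.
pose Y : R := 2 * x + (3 + 2 * x) * (y / (y - 1)).
have x1 := base_x_ge1; have y1 := base_y_gt1.
have Y0 : 0 <= Y.
  have y00 : 0 <= y / (y - 1) :> R by rewrite divr_ge0//; lra.
  by rewrite addr_ge0// mulr_ge0//; lra.
exists (D * Y + C); first by rewrite ltr_wpDl// mulr_ge0// ltW.
move=> f A A0 Hf HE h h0; have ha0 : 0 <= h `^ alpha by exact: powR_ge0.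
case: (leP h 1) => h1; last first.
  apply: NB_mono (NB_wdiff_int r (ltW h0) Hf); rewrite -/C.
  have ha1 : 1 <= h `^ alpha.
    have -> : 1 = 1 `^ alpha :> R by rewrite powR1.
    by rewrite ge0_ler_powR ?nnegrE ?(ltW al0) ?(ltW h0) ?(ltW h1).
  rewrite -mulrA; apply: ler_pM; rewrite ?(ltW C0) ?(ltW A0)//.
    by rewrite lerDr mulr_ge0 ?(ltW D0).
  by rewrite ler_peMr ?(ltW A0).
pose Phi (g : R -> R) (e : R) := NB a b (wdiff_int a b r h g) e.
have PhiD g1 g2 e1 e2 : Phi g1 e1 -> Phi g2 e2 -> Phi (fun z => g1 z + g2 z) (e1 + e2).
  by move=> H1 H2; apply: NB_ext (NB_add H1 H2) => z _; rewrite wdiff_intD.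
have Phi_mono g e1 e2 : e1 <= e2 -> Phi g e1 -> Phi g e2 by exact: NB_mono.
have Phi_bounded g e : NB a b g e -> Phi g (D * e).
  move=> Hg; apply: NB_mono (NB_wdiff_int r (ltW h0) Hg).
  by rewrite ler_wpM2r ?lerDl//; case: Hg.
have Phi_poly n (Q : {poly R}) e : (0 < n)%N -> (size Q <= n)%N ->
    NB a b (horner Q) e -> Phi (horner Q) (D * (n%:R * h) ^+ r * e).
  move=> n0 Qn HQ; apply: NB_mono (HB h n Q e (ltW h0) n0 Qn HQ).
  have e0 : 0 <= e by case: HQ.
  by rewrite ler_wpM2r// ler_wpM2r ?exprn_ge0 ?mulr_ge0 ?(ltW h0)// lerDr ltW.
have := dyadic_sum PhiD Phi_mono Phi_bounded Phi_poly (ltW D0) h0 al0 alr h1 A0 Hf.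
move=> H; apply: NB_mono (H _); last first.
  move=> i; have := HE (2 ^ i)%N; rewrite expn_gt0 => /(_ isT).
  by rewrite natrX powR_exp// powRN.
rewrite -/Y ler_wpM2r// ler_wpM2r ?(ltW A0)// lerDl ltW//.
Qed.

End characterization.

(** * Weighted compositions *)

Section smoothness_classes.
Context {R : realType}.
Implicit Types (f g : R -> R) (A B : set R).

Lemma within_cont_comp_in A B f g : {within B, continuous g} -> {within A, continuous f} ->
  (forall x, A x -> B (f x)) -> {within A, continuous (fun x => g (f x))}.
Proof.
move=> /subspace_continuousP cg /subspace_continuousP cf fB.
apply/subspace_continuousP => x Ax.
apply: (@cvg_comp _ _ _ f g _ (within B (nbhs (f x)))); last exact: cg (fB x Ax).
move=> U BU; have H : within A (nbhs (x : R)) (fun y => B (f y) -> U (f y)) by exact: cf Ax _ BU.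
have FF : Filter (within A (nbhs (x : R))) by exact: within_filter.
have HA : within A (nbhs (x : R)) A by exact: withinT.
suff : within A (nbhs (x : R)) (fun y => U (f y)) by [].
by move: HA H; apply: filterS2 => y Ay; apply; exact: fB.
Qed.

Fixpoint Ck (k : nat) (a b : R) (g : R -> R) : Prop :=
  if k is k'.+1 then exists dg, der_on a b g dg /\ Ck k' a b dg
  else {within `[a, b], continuous g}.

Variables (a b : R).

Lemma Ck_cont k g : Ck k a b g -> {within `[a, b], continuous g}.
Proof. by case: k => [//|k [dg [[]]]]. Qed.

Lemma CkS k g : Ck k.+1 a b g -> Ck k a b g.
Proof.
elim: k g => [g|k IH g [dg [Dg /IH ?]]]; first exact: Ck_cont.
by exists dg.
Qed.

Lemma Ck_le k m g : (m <= k)%N -> Ck k a b g -> Ck m a b g.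
Proof. by move=> /subnK <-; elim: (k - m)%N => // n IH /CkS. Qed.

Lemma CkD k f g : Ck k a b f -> Ck k a b g -> Ck k a b (fun x => f x + g x).
Proof.
elim: k f g => [|k IH] f g; first exact: within_contD.
move=> [df [Df cf]] [dg [Dg cg]]; exists (fun x => df x + dg x); split; last exact: IH.
exact: der_onD.
Qed.

Lemma der_onM f df g dg : der_on a b f df -> der_on a b g dg ->
  der_on a b (fun x => f x * g x) (fun x => df x * g x + f x * dg x).
Proof.
move=> [cf cdf Df] [cg cdg Dg]; split; first exact: within_contM.
  by apply: within_contD; exact: within_contM.
by move=> x xab; apply: derM; [exact: Df|exact: Dg].
Qed.

Lemma CkM k f g : Ck k a b f -> Ck k a b g -> Ck k a b (fun x => f x * g x).
Proof.
elim: k f g => [|k IH] f g; first exact: within_contM.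
move=> Hf Hg; have [df [Df cf]] := Hf; have [dg [Dg cg]] := Hg.
exists (fun x => df x * g x + f x * dg x); split; first exact: der_onM.
by apply: CkD; apply: IH => //; exact: CkS.
Qed.

Lemma Ck_cst k (x : R) : Ck k a b (fun=> x).
Proof.
elim: k x => [|k IH] x; first exact: within_cont_cst.
exists (fun=> 0); split => //; split; [exact: within_cont_cst..|].
by move=> y _; exact: is_derive_cst.
Qed.

Lemma itvoo_cc (x : R) : x \in `]a, b[ -> x \in `[a, b].
Proof. by rewrite !in_itv/= => /andP[ax xb]; rewrite !ltW. Qed.

Lemma CkV k f : (forall x, x \in `[a, b] -> f x != 0) -> Ck k a b f ->
  Ck k a b (fun x => (f x)^-1).
Proof.
move=> f0; elim: k => [|k IH]; first by apply: within_contV => x xab; exact: f0.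
move=> Hf; have [df [Df cf]] := Hf.
have Vf : Ck k a b (fun x => (f x)^-1) by apply: IH; exact: CkS.
exists (fun x => (-1) * df x * ((f x)^-1 * (f x)^-1)); split; last first.
  by apply: CkM; apply: CkM => //; exact: Ck_cst.
split; [exact: Ck_cont Vf| |].
  by apply: (@Ck_cont k); apply: CkM; apply: CkM => //; exact: Ck_cst.
move=> x xab; have [_ _ D] := Df.
apply: (is_derive_eq (derV (f0 x (itvoo_cc xab)) (D x xab))).
by rewrite expr2 invfM mulN1r mulNr.
Qed.

End smoothness_classes.

(** The chain rule is applied with two-sided derivatives, so interior points must go to interior
    points. *)
Lemma Ck_comp {R : realType} (a b a' b' : R) k (f g : R -> R) : Ck k a b f -> Ck k a' b' g ->
  (forall x, x \in `[a', b'] -> g x \in `[a, b]) ->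
  (forall x, x \in `]a', b'[ -> g x \in `]a, b[) ->
  Ck k a' b' (fun x => f (g x)).
Proof.
move=> + + gcc goo; elim: k f => [|k IH] f Hf Hg; first exact: within_cont_comp_in Hf Hg gcc.
have [df [[cf cdf Df] Hdf]] := Hf; have [dg [[cg cdg Dg] Hdg]] := Hg.
have H1 : Ck k a' b' (fun x => df (g x)) by apply: IH => //; exact: CkS.
exists (fun x => df (g x) * dg x); split; last exact: CkM.
split.
- exact: within_cont_comp_in cf cg gcc.
- by apply: within_contM => //; exact: within_cont_comp_in cdf cg gcc.
- by move=> x xab; apply: der_comp; [exact: Df (goo x xab)|exact: Dg].
Qed.

Section weighted_composition.
Context {R : realType}.
Variables (a b a' b' kappa : R) (r : nat) (sigma tau : R -> R).
Hypotheses (ab : a < b) (ab' : a' < b') (kappa0 : 0 < kappa).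
Hypotheses (Csigma : Ck r a' b' sigma) (Ctau : Ck r a' b' tau).
Hypothesis tau_in : forall x, x \in `[a', b'] -> tau x \in `[a, b].
Hypothesis tau_expanding : forall x y, x \in `[a', b'] -> y \in `[a', b'] ->
  kappa * `|x - y| <= `|tau x - tau y|.
Hypothesis tau_ends : (tau a' = a /\ tau b' = b) \/ (tau a' = b /\ tau b' = a).
Hypothesis dense' : poly_dense a' b'.

(* The derivatives of [sigma * (Q o tau)], as differential operators in [Q] of order at most
   [m] whose coefficients are of class [k]. *)
Inductive jet_op (k m : nat) : ({poly R} -> R -> R) -> Prop :=
  | jet_term u i : Ck k a' b' u -> (i <= m)%N -> jet_op k m (fun Q x => u x * Q^`(i).[tau x])
  | jet_add F G : jet_op k m F -> jet_op k m G -> jet_op k m (fun Q x => F Q x + G Q x).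

Lemma tau_cont : {within `[a', b'], continuous tau}.
Proof. exact: Ck_cont Ctau. Qed.

Lemma jet_op_deriv k m F : (k < r)%N -> jet_op k.+1 m F -> exists F', jet_op k m.+1 F' /\
  forall Q, der_on a' b' (F Q) (F' Q).
Proof.
move=> kr; have [dtau [Dtau Cdtau]] : exists dtau, der_on a' b' tau dtau /\ Ck k a' b' dtau.
  exact: (Ck_le kr Ctau).
elim=> {F} [u i Hu im|F G _ [F' [HF' DF]] _ [G' [HG' DG]]]; last first.
  exists (fun Q x => F' Q x + G' Q x); split; first exact: jet_add.
  by move=> Q; exact: der_onD.
have [du [Du Cdu]] := Hu; have Cu : Ck k a' b' u by exact: CkS.
exists (fun Q x => du x * Q^`(i).[tau x] + (u x * dtau x) * Q^`(i.+1).[tau x]); split.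
  by apply: jet_add; apply: jet_term => //; [exact: leqW|exact: CkM].
move=> Q; have DQ : der_on a' b' (fun x => Q^`(i).[tau x]) (fun x => Q^`(i.+1).[tau x] * dtau x).
  have [ct cdt dt] := Dtau; split.
  - exact: within_cont_horner.
  - by apply: within_contM => //; exact: within_cont_horner.
  - move=> x xab.
    have D1 : is_derive (tau x) (1 : R) (horner Q^`(i)) Q^`(i.+1).[tau x].
      by rewrite derivnS; exact: is_derive_poly.
    exact: der_comp D1 (dt x xab).
have := der_onM Du DQ; congr der_on; apply/funext => x; ring.
Qed.

Lemma jet_op_nder k m F : (k <= r)%N -> jet_op k m F -> exists F', jet_op 0 (m + k) F' /\
  forall Q, nder k a' b' (F Q) (F' Q).
Proof.
elim: k m F => [|k IH] m F kr HF.
  exists F; rewrite addn0; split => // Q; split => //.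
  elim: HF => [u i cu _|F1 G1 _ c1 _ c2]; last exact: within_contD.
  by apply: within_contM => //; apply: within_cont_horner; exact: tau_cont.
have [F1 [HF1 DF1]] := jet_op_deriv kr HF.
have [F' [HF' DF']] := IH _ _ (ltnW kr) HF1.
exists F'; split; first by rewrite addnS -addSn.
by move=> Q; exists (F1 Q).
Qed.

(** Since [tau] sends ends to ends, expansion compares the distances of x to a' and b' with those of
    [tau x] to a and b; their products are the squared weights. *)
Lemma step_weight_tau x : x \in `[a', b'] ->
  kappa * step_weight a' b' x <= step_weight a b (tau x).
Proof.
move=> xab; have tx := tau_in xab.
rewrite -(ler_pXn2r (n := 2))// ?nnegrE ?step_weight_ge0//; last first.
  exact: mulr_ge0 (ltW kappa0) (step_weight_ge0 _ _ _).
rewrite (exprMn 2 kappa) (step_weight_sqr xab) (step_weight_sqr tx).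
have ax := tau_expanding xab (_ : a' \in `[a', b']).
have bx := tau_expanding xab (_ : b' \in `[a', b']).
have {}ax := ax ltac:(by rewrite in_itv/= lexx ltW).
have {}bx := bx ltac:(by rewrite in_itv/= lexx ltW).
move: xab tx; rewrite !in_itv/= => /andP[x1 x2] /andP[t1 t2].
have E : kappa ^+ 2 * ((x - a') * (b' - x)) = (kappa * `|x - a'|) * (kappa * `|x - b'|).
  by rewrite (ger0_norm (_ : 0 <= x - a')) ?subr_ge0// distrC ger0_norm ?subr_ge0//; ring.
have k0 := ltW kappa0.
rewrite E; case: tau_ends => -[ta tb]; rewrite ta in ax; rewrite tb in bx.
  rewrite [leRHS](_ : _ = `|tau x - a| * `|tau x - b|).
    by apply: ler_pM => //; exact: mulr_ge0.
  by rewrite (ger0_norm (_ : 0 <= tau x - a)) ?subr_ge0// distrC ger0_norm ?subr_ge0.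
rewrite [leRHS](_ : _ = `|tau x - b| * `|tau x - a|).
  by apply: ler_pM => //; exact: mulr_ge0.
by rewrite (ger0_norm (_ : 0 <= tau x - a)) ?subr_ge0// distrC ger0_norm ?subr_ge0// mulrC.
Qed.

(** Of the r weight factors, i are turned into [step_weight a b (tau x)] and consumed by Bernstein's
    inequality on [a, b]; the other r - i are bounded by b' - a'. *)
Lemma NB_jet_op F m : (m <= r)%N -> jet_op 0 m F -> exists2 K : R, 0 <= K &
  forall n (Q : {poly R}) e, (0 < n)%N -> (size Q <= n)%N -> NB a b (horner Q) e ->
  NB a' b' (fun x => step_weight a' b' x ^+ r * F Q x) (K * n%:R ^+ r * e).
Proof.
move=> mr; elim=> {F} [u i cu im|F G _ [K1 K10 H1] _ [K2 K20 H2]]; last first.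
  exists (K1 + K2); first exact: addr_ge0.
  move=> n Q e n0 Qn HQ; have := NB_add (H1 n Q e n0 Qn HQ) (H2 n Q e n0 Qn HQ).
  by rewrite !mulrDl; apply: NB_ext => x _; rewrite mulrDr.
have ir : (i <= r)%N by exact: leq_trans mr.
have [M M0 HM] := within_bounded (ltW ab') cu.
pose L := b' - a'; have L0 : 0 < L by rewrite subr_gt0.
pose c : R := M * L ^+ (r - i) * kappa^-1 ^+ i.
have c0 : 0 <= c by rewrite !mulr_ge0 ?exprn_ge0 ?invr_ge0 ?(ltW L0) ?(ltW kappa0).
have s0 : 0 <= Num.sqrt kappa^-1 by exact: sqrtr_ge0.
have cs0 : 0 <= c * Num.sqrt kappa^-1 * 2 ^+ i.
  by rewrite mulr_ge0 ?exprn_ge0//; exact: mulr_ge0.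
exists (c * Num.sqrt kappa^-1 * 2 ^+ i) => //.
move=> n Q e n0 Qn HQ; have e0 : 0 <= e by case: HQ.
have Q' : (size Q <= n.-1.+1)%N by rewrite prednK.
have HB := NB_comp kappa0 (within_meas tau_cont) tau_in tau_expanding (NB_bernstein ab i Q' HQ).
have HB' := NB_le _ c0 _ HB.
apply: NB_mono (HB' (fun x => step_weight a' b' x ^+ r * (u x * Q^`(i).[tau x])) _ _).
- have n1 : (n.-1%:R : R) <= n%:R by rewrite ler_nat leq_pred.
  have nr : (n.-1%:R : R) ^+ i <= n%:R ^+ r.
    apply: (@le_trans _ _ (n%:R ^+ i)); first by rewrite lerXn2r ?nnegrE.
    by rewrite ler_weXn2l// ler1n.
  rewrite exprMn; have -> : c * (Num.sqrt kappa^-1 * (2 ^+ i * n.-1%:R ^+ i * e)) =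
     c * Num.sqrt kappa^-1 * 2 ^+ i * e * n.-1%:R ^+ i by ring.
  by rewrite [leRHS]mulrAC ler_wpM2l//; exact: mulr_ge0.
- apply: measurable_funM; first by apply: measurable_funX; exact: measurable_step_weight.
  apply: within_meas; apply: within_contM => //; apply: within_cont_horner; exact: tau_cont.
move=> x xab; rewrite !normrM.
have p0 : 0 <= step_weight a' b' x by exact: step_weight_ge0.
have q0 : 0 <= step_weight a b (tau x) by exact: step_weight_ge0.
rewrite !normrX (ger0_norm p0) (ger0_norm q0).
have E : step_weight a' b' x ^+ r <= L ^+ (r - i) * kappa^-1 ^+ i * step_weight a b (tau x) ^+ i.
  rewrite -{1}(subnK ir) exprD -mulrA -exprMn; apply: ler_pM; rewrite ?exprn_ge0//.
    by rewrite lerXn2r ?nnegrE ?(ltW L0)// step_weight_le.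
  rewrite lerXn2r ?nnegrE//; first by rewrite mulr_ge0 ?invr_ge0 ?(ltW kappa0).
  by rewrite ler_pdivlMl// step_weight_tau.
have -> : c * (step_weight a b (tau x) ^+ i * `|Q^`(i).[tau x]|) =
  (L ^+ (r - i) * kappa^-1 ^+ i * step_weight a b (tau x) ^+ i) * (M * `|Q^`(i).[tau x]|).
  by rewrite /c; ring.
apply: ler_pM => //; first exact: exprn_ge0.
by rewrite ler_wpM2r// HM.
Qed.

Lemma NB_weighted_comp : exists2 K : R, 0 <= K & forall f e, NB a b f e ->
  NB a' b' (fun x => sigma x * f (tau x)) (K * e).
Proof.
have [M M0 HM] := within_bounded (ltW ab') (Ck_cont Csigma).
exists (M * Num.sqrt kappa^-1); first exact: mulr_ge0 M0 (sqrtr_ge0 _).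
move=> f e Hf; have H := NB_comp kappa0 (within_meas tau_cont) tau_in tau_expanding Hf.
rewrite -mulrA; apply: (NB_le _ M0 _ H).
  by have [mH _ _] := H; apply: measurable_funM => //; exact: within_meas (Ck_cont Csigma).
by move=> x xab; rewrite normrM ler_wpM2r// HM.
Qed.

(** Jackson's inequality covers r <= N; for N < r the bound on the norm suffices, because r n / N >=
    1. *)
Lemma EB_weighted_comp_poly : exists2 K : R, 0 <= K &
  forall N n (Q : {poly R}) e, (0 < N)%N -> (0 < n)%N -> (size Q <= n)%N -> NB a b (horner Q) e ->
  EB a' b' (fun x => sigma x * Q.[tau x]) N (K * (n%:R * N%:R^-1) ^+ r * e).
Proof.
have J0 : jet_op r 0 (fun Q x => sigma x * Q^`(0).[tau x]) by exact: jet_term.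
have [F' [HF' DF']] := jet_op_nder (leqnn r) J0.
have [K1 K10 HK1] := NB_jet_op (leqnn r) HF'.
have [K2 K20 HK2] := NB_weighted_comp.
have rr0 : 0 <= r%:R ^+ r :> R by rewrite exprn_ge0.
exists (r%:R ^+ r * K1 + r%:R ^+ r * K2); first by rewrite addr_ge0// mulr_ge0.
move=> N n Q e N0 n0 Qn HQ; have e0 : 0 <= e by case: HQ.
have N0' : 0 < (N%:R : R) by rewrite ltr0n.
have u0 : 0 <= (n%:R / N%:R) ^+ r :> R by rewrite exprn_ge0// divr_ge0.
case: (leqP r N) => rN.
  apply: EB_mono (leqnn N) _ (EB_jackson ab' dense' rN (DF' Q) (HK1 n Q e n0 Qn HQ)).
  have -> : (r%:R / N%:R) ^+ r * (K1 * n%:R ^+ r * e) = r%:R ^+ r * K1 * (n%:R / N%:R) ^+ r * e.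
    by rewrite !exprMn; ring.
  by rewrite ler_wpM2r// ler_wpM2r// lerDl mulr_ge0.
apply: EB_mono (leqnn N) _ (NB_EB N (HK2 _ e HQ)).
rewrite ler_wpM2r//.
have h : 1 <= r%:R ^+ r * (n%:R / N%:R) ^+ r :> R.
  rewrite -exprMn exprn_ege1// mulrA ler_pdivlMr// mul1r -natrM ler_nat.
  by rewrite (leq_trans (ltnW rN))// leq_pmulr.
rewrite mulrDl -[leLHS]add0r lerD ?mulr_ge0//.
by rewrite mulrAC mulrC ler_peMr.
Qed.

(** The dyadic sum with theta = 1 / N, where [Phi g e] says that sigma (g o tau) is within e of the
    polynomials of degree < N. *)
Theorem EB_weighted_comp alpha : 0 < alpha -> alpha < r%:R -> exists2 K : R, 0 < K &
  forall (f : R -> R) (A : R), 0 < A -> NB a b f A ->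
  (forall m, (0 < m)%N -> EB a b f m (A * m%:R `^ (- alpha))) ->
  forall N, (0 < N)%N -> EB a' b' (fun x => sigma x * f (tau x)) N (K * A * N%:R `^ (- alpha)).
Proof.
move=> al0 alr.
have [K1 K10 HK1] := EB_weighted_comp_poly.
have [K2 K20 HK2] := NB_weighted_comp.
pose D := K1 + K2 + 1; have D0 : 0 < D by rewrite ltr_wpDl// addr_ge0.
pose x : R := 2 `^ alpha; pose y : R := 2 `^ (r%:R - alpha).
have x1 : 1 <= x by exact: base_x_ge1.
have y1 : 1 < y by exact: base_y_gt1.
pose Y : R := 2 * x + (3 + 2 * x) * (y / (y - 1)).
have Y0 : 0 < Y.
  have y00 : 0 <= y / (y - 1) :> R by rewrite divr_ge0//; lra.
  have h : 0 <= (3 + 2 * x) * (y / (y - 1)) by rewrite mulr_ge0//; lra.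
  by rewrite /Y; lra.
exists (D * Y); first exact: mulr_gt0.
move=> f A A0 Hf HE N N0; have N0' : 0 < (N%:R : R) by rewrite ltr0n.
pose Phi (g : R -> R) (e : R) := EB a' b' (fun x => sigma x * g (tau x)) N e.
have PhiD g1 g2 e1 e2 : Phi g1 e1 -> Phi g2 e2 -> Phi (fun z => g1 z + g2 z) (e1 + e2).
  by move=> H1 H2; apply: EB_ext (EB_add H1 H2) => z _; rewrite mulrDr.
have Phi_mono g e1 e2 : e1 <= e2 -> Phi g e1 -> Phi g e2 by exact: EB_mono.
have Phi_bounded g e : NB a b g e -> Phi g (D * e).
  move=> Hg; apply: NB_EB; apply: NB_mono (HK2 g e Hg).
  by rewrite ler_wpM2r//; [case: Hg|rewrite /D; lra].
have Phi_poly n (Q : {poly R}) e : (0 < n)%N -> (size Q <= n)%N ->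
    NB a b (horner Q) e -> Phi (horner Q) (D * (n%:R * N%:R^-1) ^+ r * e).
  move=> n0 Qn HQ; apply: EB_mono (leqnn N) _ (HK1 N n Q e N0 n0 Qn HQ).
  have e0 : 0 <= e by case: HQ.
  by rewrite ler_wpM2r// ler_wpM2r ?exprn_ge0 ?mulr_ge0 ?invr_ge0// /D; lra.
have N1 : N%:R^-1 <= 1 :> R by rewrite invf_le1// ler1n.
have NV : 0 < N%:R^-1 :> R by rewrite invr_gt0.
have := dyadic_sum PhiD Phi_mono Phi_bounded Phi_poly (ltW D0) NV al0 alr N1 A0 Hf.
rewrite powR_inv// [in X in _ -> X]powRN => H; apply: H.
move=> i; have := HE (2 ^ i)%N; rewrite expn_gt0 => /(_ isT).
by rewrite natrX powR_exp// powRN.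
Qed.

End weighted_composition.

(** * The change of variable and its inverse *)

Section inverse_diffeomorphism.
Context {R : realType}.

Lemma lipschitz_within_cont (A : set R) (f : R -> R) (K : R) :
  (forall x y, A x -> A y -> `|f x - f y| <= K * `|x - y|) -> {within A, continuous f}.
Proof.
move=> H; apply/subspace_continuousP => x Ax; apply/cvgrPdist_lt => e e0.
have K0 : 0 < `|K| + 1 by rewrite ltr_wpDl.
have d0 : 0 < e / (`|K| + 1) by rewrite divr_gt0.
rewrite near_withinE.
have N : \forall t \near x, `|x - t| < e / (`|K| + 1).
  exact: (@nbhsx_ballx R R x _ d0).
near=> t => At; apply: (le_lt_trans (H x t Ax At)).
have h : `|x - t| < e / (`|K| + 1) by near: t.
apply: (@le_lt_trans _ _ ((`|K| + 1) * `|x - t|)).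
  by rewrite ler_wpM2r// (le_trans (ler_norm _))// lerDl.
by rewrite mulrC -ltr_pdivlMr.
Unshelve. all: by end_near. Qed.

Variables (a b a' b' : R) (r : nat) (tau dtau : R -> R).
Hypotheses (ab : a < b) (ab' : a' < b').
Hypotheses (Dtau : der_on a' b' tau dtau) (Cdtau : Ck r a' b' dtau).
Hypothesis dtau0 : forall x, x \in `[a', b'] -> dtau x != 0.
Hypothesis tau_in : forall x, x \in `[a', b'] -> tau x \in `[a, b].
Hypothesis tau_surj : forall z, z \in `[a, b] -> exists2 x, x \in `[a', b'] & tau x = z.

(** [dtau] is continuous and nowhere 0, so its modulus has a positive minimum and a finite bound,
    and the mean value theorem applies. The lower bound serves [tau], the upper one its inverse. *)
Lemma tau_bilipschitz : exists kappa Lam : R, [/\ 0 < kappa, 0 < Lam,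
  forall x y, x \in `[a', b'] -> y \in `[a', b'] -> kappa * `|x - y| <= `|tau x - tau y| &
  forall x y, x \in `[a', b'] -> y \in `[a', b'] -> `|tau x - tau y| <= Lam * `|x - y|].
Proof.
have [ct cd dt] := Dtau.
have cn : {within `[a', b'], continuous (fun x => `|dtau x|)}.
  by apply: within_cont_comp cd; exact: norm_continuous.
have [c cab Hc] := EVT_min (ltW ab') cn.
have [M M0 HM] := within_bounded (ltW ab') cd.
have mvt x y : x \in `[a', b'] -> y \in `[a', b'] -> exists2 z, z \in `[a', b'] &
    `|tau x - tau y| = `|dtau z| * `|x - y|.
  wlog xy : x y / x <= y.
    move=> W xab yab; case: (leP x y) => [|/ltW] xy; first exact: W.
    by have [z zab E] := W y x xy yab xab; exists z => //; rewrite distrC E (distrC x).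
  move=> xab yab; have [z zxy E] := @MVT_segment R tau dtau x y xy
    (fun w wxy => dt w ltac:(move: wxy xab yab; rewrite !in_itv/= => /andP[? ?] /andP[? ?] /andP[? ?]; apply/andP; split; lra))
    ltac:(apply: continuous_subspaceW ct => w /=; move: xab yab; rewrite !in_itv/= => /andP[? ?] /andP[? ?] /andP[? ?]; apply/andP; split; lra).
  exists z; last by rewrite distrC E normrM (distrC x).
  by move: zxy xab yab; rewrite !in_itv/= => /andP[? ?] /andP[? ?] /andP[? ?]; apply/andP; split; lra.
exists `|dtau c|, (M + 1); split.
- by rewrite normr_gt0 dtau0.
- by rewrite ltr_wpDl.
- move=> x y xab yab; have [z zab ->] := mvt x y xab yab.
  by rewrite ler_wpM2r// Hc.
- move=> x y xab yab; have [z zab ->] := mvt x y xab yab.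
  by rewrite ler_wpM2r// (le_trans (HM z zab))// lerDl.
Qed.

Lemma tau_injective x y : x \in `[a', b'] -> y \in `[a', b'] -> tau x = tau y -> x = y.
Proof.
move=> xab yab E; have [k [L [k0 _ H _]]] := tau_bilipschitz.
have := H x y xab yab; rewrite E subrr normr0 pmulr_rle0// normr_le0 subr_eq0.
by move=> /eqP.
Qed.

Lemma left_end : a' \in `[a', b']. Proof. by rewrite in_itv/= lexx ltW. Qed.
Lemma right_end : b' \in `[a', b']. Proof. by rewrite in_itv/= lexx ltW. Qed.

(** A continuous injection on an interval is monotone, so the values a and b are taken at the
    ends. *)
Lemma tau_endpoints : (tau a' = a /\ tau b' = b) \/ (tau a' = b /\ tau b' = a).
Proof.
have [ct _ _] := Dtau.
have inj : {in `[a', b'] &, injective tau} by move=> x y; exact: tau_injective.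
have [x0 x0ab t0] : exists2 x, x \in `[a', b'] & tau x = a.
  by apply: tau_surj; rewrite in_itv/= lexx ltW.
have [x1 x1ab t1] : exists2 x, x \in `[a', b'] & tau x = b.
  by apply: tau_surj; rewrite in_itv/= lexx ltW.
have := tau_in left_end; have := tau_in right_end; rewrite !in_itv/= => /andP[ha1 hb1] /andP[ha0 hb0].
have l0 := left_end; have l1 := right_end.
have b0 : a' <= x0 <= b' by rewrite in_itv/= in x0ab.
have b1 : a' <= x1 <= b' by rewrite in_itv/= in x1ab.
move: b0 b1 => /andP[? ?] /andP[? ?].
case: (leP (tau a') (tau b')) => [|/ltW] H.
  have M := segment_continuous_inj_le H ct inj; left.
  by split; apply/eqP; rewrite eq_le ?ha0 ?hb1 ?andbT -?t0 -?t1 M.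
have M := segment_continuous_inj_ge H ct inj; right.
by split; apply/eqP; rewrite eq_le ?hb0 ?ha1 ?andbT -?t0 -?t1 M.
Qed.

Lemma tau_interior x : x \in `]a', b'[ -> tau x \in `]a, b[.
Proof.
move=> xoo; have xab : x \in `[a', b'] by exact: itvoo_cc.
have := tau_in xab; rewrite !in_itv/= => /andP[h1 h2].
have n1 : tau x != tau a'.
  by apply: contraTneq xoo => /(tau_injective xab left_end) ->; rewrite in_itv/= ltxx.
have n2 : tau x != tau b'.
  by apply: contraTneq xoo => /(tau_injective xab right_end) ->; rewrite in_itv/= ltxx andbF.
rewrite !lt_neqAle h1 h2 !andbT (eq_sym a).
by case: tau_endpoints => -[ea eb]; rewrite ea in n1; rewrite eb in n2; rewrite n1 n2.
Qed.

(** A bootstrap: the inverse is Lipschitz, hence continuous, and its derivative 1 / (dtau o rho) is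
    as smooth as rho, up to order r. Each pass gains one order. *)
Lemma inverse_diffeo : exists rho : R -> R, [/\
  forall z, z \in `[a, b] -> rho z \in `[a', b'] /\ tau (rho z) = z,
  forall x, x \in `[a', b'] -> rho (tau x) = x,
  der_on a b rho (fun z => (dtau (rho z))^-1) &
  Ck r.+1 a b rho].
Proof.
have [kappa [Lam [k0 L0 Hk HL]]] := tau_bilipschitz.
have [rho Hrho] : exists rho : R -> R, forall z, z \in `[a, b] -> rho z \in `[a', b'] /\ tau (rho z) = z.
  suff /choice[rho H] : forall z, exists x, z \in `[a, b] -> x \in `[a', b'] /\ tau x = z.
    by exists rho.
  move=> z.
  have [zab|nzab] := boolP (z \in `[a, b]); last by exists 0.
  by have [x xab tx] := tau_surj zab; exists x.
have rhoK x : x \in `[a', b'] -> rho (tau x) = x.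
  by move=> xab; have [h1 h2] := Hrho _ (tau_in xab); exact: tau_injective h1 xab h2.
have crho : {within `[a, b], continuous rho}.
  apply: (lipschitz_within_cont (K := kappa^-1)) => z w zab wab.
  have [z1 z2] := Hrho z zab; have [w1 w2] := Hrho w wab.
  by rewrite -{2}z2 -{2}w2 ler_pdivlMl// Hk.
have rho_oo z : z \in `]a, b[ -> rho z \in `]a', b'[.
  move=> zoo; have zab := itvoo_cc zoo; have [z1 z2] := Hrho z zab.
  have n1 : rho z != a'.
    apply: contraTneq zoo => E; rewrite -z2 E.
    by case: tau_endpoints => -[-> _]; rewrite in_itv/= ltxx ?andbF.
  have n2 : rho z != b'.
    apply: contraTneq zoo => E; rewrite -z2 E.
    by case: tau_endpoints => -[_ ->]; rewrite in_itv/= ltxx ?andbF.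
  by move: z1; rewrite !in_itv/= => /andP[h1 h2]; rewrite !lt_neqAle h1 h2 n2 eq_sym n1.
have [ct cd dt] := Dtau.
have rho_in z : z \in `[a, b] -> rho z \in `[a', b'] by move=> /Hrho[].
have cdr : {within `[a, b], continuous (fun z => (dtau (rho z))^-1)}.
  apply: within_contV => [z zab|]; first by rewrite dtau0// rho_in.
  exact: within_cont_comp_in cd crho rho_in.
have D : der_on a b rho (fun z => (dtau (rho z))^-1).
  split => // z zoo; have zab := itvoo_cc zoo; have [z1 z2] := Hrho z zab.
  have roo := rho_oo z zoo.
  have nearoo : \forall x \near rho z, x \in `]a', b'[ by exact: near_in_itvoo.
  rewrite -{1}z2; apply: is_derive_inverse.
  - by apply: filterS nearoo => x xoo; rewrite rhoK// itvoo_cc.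
  - apply: filterS nearoo => x xoo; have Dx := dt x xoo.
    by apply: differentiable_continuous; apply/derivable1_diffP; case: Dx.
  - exact: dt.
  - by rewrite dtau0.
exists rho; split => //.
have Ckk k : (k <= r)%N -> Ck k a b rho -> Ck k.+1 a b rho.
  move=> kr Cr; exists (fun z => (dtau (rho z))^-1); split => //.
  apply: CkV; first by move=> z zab; rewrite dtau0// rho_in.
  exact: (Ck_comp (Ck_le kr Cdtau) Cr rho_in rho_oo).
suff : forall k, (k <= r.+1)%N -> Ck k a b rho by apply.
by elim=> [|k IH] kr //; apply: Ckk => //; apply: IH; exact: ltnW.
Qed.

End inverse_diffeomorphism.

(** * Derivatives relative to the closed interval *)

Section relative_derivatives.
Context {R : realType}.
Variables (a b : R).
Hypothesis ab : a < b.
Implicit Types (f df : R -> R).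

Lemma has_derivative_near f df x e : has_derivative_on a b f df -> x \in `[a, b] -> 0 < e ->
  \forall y \near x, y != x -> y \in `[a, b] -> `|df x - (f y - f x) / (y - x)| < e.
Proof.
move=> H xab e0; have /cvgrPdist_lt/(_ e e0) := H x xab.
rewrite !near_withinE => N; near=> y => yx yab.
by move: yx yab; near: y.
Unshelve. all: by end_near. Qed.

Lemma has_derivative_cont f df : has_derivative_on a b f df -> {within `[a, b], continuous f}.
Proof.
move=> H; apply/subspace_continuousP => x xab; apply/cvgrPdist_lt => e e0.
rewrite near_withinE.
have K0 : 0 < `|df x| + 1 by rewrite ltr_wpDl.
have d0 : 0 < e / (`|df x| + 1) by rewrite divr_gt0.
have N1 := has_derivative_near H xab ltr01.
have N2 : \forall t \near x, `|x - t| < e / (`|df x| + 1) by exact: (@nbhsx_ballx R R x _ d0).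
near=> y => yab.
have [->|yx] := eqVneq y x; first by rewrite subrr normr0.
have h1 : `|df x - (f y - f x) / (y - x)| < 1.
  have : y != x -> y \in `[a, b] -> `|df x - (f y - f x) / (y - x)| < 1 by near: y.
  exact.
have h2 : `|x - y| < e / (`|df x| + 1) by near: y.
have h3 : `|(f y - f x) / (y - x)| <= `|df x| + 1.
  have -> : (f y - f x) / (y - x) = df x - (df x - (f y - f x) / (y - x)) by ring.
  by rewrite (le_trans (ler_normB _ _))// lerD2l ltW.
have yx0 : y - x != 0 by rewrite subr_eq0.
rewrite distrC -[f y - f x](divfK yx0) normrM distrC.
apply: (@le_lt_trans _ _ ((`|df x| + 1) * `|x - y|)).
  by rewrite ler_wpM2r// distrC.
by rewrite mulrC -ltr_pdivlMr.
Unshelve. all: by end_near. Qed.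

Lemma has_derivative_is_derive f df x : has_derivative_on a b f df -> x \in `]a, b[ ->
  is_derive x (1 : R) f (df x).
Proof.
move=> H xoo; have xab := itvoo_cc xoo.
suff C : (fun h : R => h^-1 *: ((f \o shift x) (h *: (1 : R)) - f x)) @ 0^' --> df x.
  by split; [apply/cvg_ex; exists (df x)|exact: cvg_lim C].
apply/cvgrPdist_lt => e e0; rewrite near_withinE.
have N1 := has_derivative_near H xab e0.
have N2 : \forall y \near x, y \in `]a, b[ by exact: near_in_itvoo.
have N3 : \forall y \near x, y != x -> `|df x - (f y - f x) / (y - x)| < e.
  near=> y => yx; have yoo : y \in `]a, b[ by near: y.
  have : y != x -> y \in `[a, b] -> `|df x - (f y - f x) / (y - x)| < e by near: y.
  by apply => //; exact: itvoo_cc.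
rewrite (near_shift 0) subr0 in N3; apply: filterS N3 => h /= Hh h0.
have := Hh; rewrite addrK => /(_ _) Hh'.
have hx : h + x != x by rewrite -subr_eq0 addrK.
have := Hh' hx; by rewrite /GRing.scale/= mulr1 [_^-1 * _]mulrC.
Unshelve. all: by end_near. Qed.

Lemma Cn_on_Ck n f : Cn_on a b n f -> Ck n a b f.
Proof.
elim: n f => [|n IH] f //= [df [Hf /IH Hdf]]; exists df; split => //.
split; [exact: has_derivative_cont Hf|exact: Ck_cont Hdf|].
by move=> x; exact: has_derivative_is_derive Hf.
Qed.

Lemma near_point x (P : R -> Prop) : x \in `[a, b] -> (\forall y \near x, P y) ->
  exists y, [/\ y != x, y \in `[a, b] & P y].
Proof.
move=> xab /nbhs_ballP[d /= d0 HP]; move: xab; rewrite in_itv/= => /andP[ax xb].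
have [xltb|bx] := ltP x b.
  pose s := Num.min (d / 2) (b - x).
  have s0 : 0 < s by rewrite lt_min divr_gt0//= subr_gt0.
  have sd : s <= d / 2 by rewrite ge_min lexx.
  have sb : s <= b - x by rewrite ge_min lexx orbT.
  exists (x + s); split; first by rewrite -subr_eq0 addrAC subrr add0r gt_eqF.
    by rewrite in_itv/=; apply/andP; split; lra.
  by apply: HP; rewrite -ball_normE /= opprD addrA subrr add0r normrN gtr0_norm//; lra.
pose s := Num.min (d / 2) (b - a).
have s0 : 0 < s by rewrite lt_min divr_gt0//= subr_gt0.
have sd : s <= d / 2 by rewrite ge_min lexx.
have sb : s <= b - a by rewrite ge_min lexx orbT.
exists (x - s); split; first by rewrite -subr_eq0 addrAC subrr add0r oppr_eq0 gt_eqF.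
  by rewrite in_itv/=; apply/andP; split; lra.
by apply: HP; rewrite -ball_normE /= opprB addrCA subrr addr0 gtr0_norm//; lra.
Qed.

(** The smoothness class of [tau] and its nonvanishing derivative come from separate existentials;
    this identifies the two derivatives, endpoints included. *)
Lemma has_derivative_unique f df1 df2 x : has_derivative_on a b f df1 ->
  has_derivative_on a b f df2 -> x \in `[a, b] -> df1 x = df2 x.
Proof.
move=> H1 H2 xab; apply/eqP; rewrite -subr_eq0 -normr_le0; apply/ler_addgt0Pr => e e0.
have e2 : 0 < e / 2 by rewrite divr_gt0.
have N1 := has_derivative_near H1 xab e2; have N2 := has_derivative_near H2 xab e2.
have [y [yx yab [h1 h2]]] := near_point xab (filterI N1 N2).
rewrite add0r; set q := (f y - f x) / (y - x) in h1 h2.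
have -> : df1 x - df2 x = (df1 x - q) - (df2 x - q) by ring.
rewrite (le_trans (ler_normB _ _))//; move: (h1 yx yab) (h2 yx yab); lra.
Qed.

End relative_derivatives.

(** * The spaces L2 and the isometry *)

Section L2_bridge.
Context {R : realType}.
Notation mu := (@lebesgue_measure R).
Variables (a b : R).

Lemma lebesgue_on_sqr (f : R -> R) : measurable_fun [set: R] f ->
  (\int[lebesgue_on a b]_x (`|(f x)%:E| `^ 2) = \int[mu]_(x in `[a, b]) ((f x) ^+ 2)%:E)%E.
Proof.
move=> mf; rewrite -(@integral_mrestr _ _ (measurable_itv `[a, b]) (fun x => ((f x) ^+ 2)%:E)).
- by apply: eq_integral => x _; rewrite /= powR_mulrn// real_normK// num_real.
- by apply/measurable_EFinP; exact: measurable_funX.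
- by move=> x; rewrite lee_fin sqr_ge0.
Qed.

Lemma L2norm_NB (f : R -> R) e : measurable_fun [set: R] f -> 0 <= e ->
  (L2norm a b f <= e%:E)%E <-> NB a b f e.
Proof.
move=> mf e0; split => [H|[_ _ H]].
  split => //; first exact: measurable_funTS.
  rewrite -lebesgue_on_sqr//.
  have := @poweR_Lnorm _ _ _ (lebesgue_on a b) (EFin \o f) 2 ltac:(by rewrite pnatr_eq0).
  rewrite /= => <-; rewrite -powR_mulrn// -poweR_EFin gt0_ler_poweR// in_itv/= ?leey ?andbT//.
  exact: Lnorm_ge0.
rewrite /L2norm unlock /Lnorm /= lebesgue_on_sqr//.
have -> : e%:E = ((e ^+ 2)%:E `^ 2^-1)%E.
  by rewrite poweR_EFin -powR_mulrn// -powRrM divff ?powRr1// pnatr_eq0.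
rewrite gt0_ler_poweR// ?in_itv/= ?leey ?andbT// ?lee_fin ?sqr_ge0 ?invr_ge0//.
by apply: integral_ge0 => x _; rewrite lee_fin sqr_ge0.
Qed.

Lemma measurable_L2 (f : L2 a b) : measurable_fun [set: R] f.
Proof. by have := LfunP f => /andP[/[!inE]]. Qed.

Lemma NB_L2 (f : L2 a b) : exists e, NB a b f e.
Proof.
have := LfunP f; rewrite inE => /andP[_]; rewrite inE/= /finite_norm => F.
have N0 : (0 <= L2norm a b f)%E by exact: Lnorm_ge0.
have Ffin : L2norm a b f \is a fin_num by rewrite ge0_fin_numE.
exists (fine (L2norm a b f)); apply/L2norm_NB; [exact: measurable_L2|exact: fine_ge0|].
by rewrite fineK.
Qed.

Lemma L2_of_NB (f : R -> R) e : measurable_fun [set: R] f -> NB a b f e ->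
  exists F : L2 a b, forall x, F x = f x.
Proof.
move=> mf Hf; have e0 : 0 <= e by case: Hf.
have fL : f \in Lfun (lebesgue_on a b) 2%:E.
  rewrite inE; apply/andP; split; rewrite inE//=.
  have /(L2norm_NB mf e0) H := Hf; rewrite /finite_norm.
  exact: (le_lt_trans H (ltry _)).
by exists (Lfun_Sub (le1_2 R) fL) => x; rewrite Lfun_valP.
Qed.

Lemma ae_lebesgue_on (f g : R -> R) : f = g %[ae lebesgue_on a b] ->
  {ae mu, forall x, x \in `[a, b] -> f x = g x}.
Proof.
move=> [N [mN N0 sub]]; exists (N `&` `[a, b]%classic); split => //.
  exact: measurableI.
by move=> x /= /not_implyP[xab fg]; split => //; apply: sub => /= /(_ I).
Qed.

Lemma L2_mul_integrable (f g : L2 a b) :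
  (lebesgue_on a b).-integrable setT (EFin \o (fun x => f x * g x)).
Proof. by apply/Lfun1_integrable; apply: Lfun2_mul_Lfun1; exact: LfunP. Qed.

Lemma L2innerC (f g : L2 a b) : L2inner a b f g = L2inner a b g f.
Proof. by rewrite /L2inner; apply: eq_Rintegral => x _; rewrite mulrC. Qed.

Lemma L2innerD (f g h : L2 a b) : L2inner a b (f + g)%R h = L2inner a b f h + L2inner a b g h.
Proof.
rewrite /L2inner -RintegralD//; [|exact: L2_mul_integrable..].
by apply: eq_Rintegral => x _; rewrite mulrDl.
Qed.

Lemma L2innerZ (c : R) (f h : L2 a b) : L2inner a b (c *: f)%R h = c * L2inner a b f h.
Proof.
rewrite /L2inner -RintegralZl//; last exact: L2_mul_integrable.
by apply: eq_Rintegral => x _; rewrite mulrA.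
Qed.

Lemma L2inner_ge0 (f : L2 a b) : 0 <= L2inner a b f f.
Proof. by apply: Rintegral_ge0 => x _; rewrite -expr2 sqr_ge0. Qed.

Lemma L2inner_sqrD (f g : L2 a b) : L2inner a b (f + g)%R (f + g)%R =
  L2inner a b f f + 2 * L2inner a b f g + L2inner a b g g.
Proof.
rewrite L2innerD L2innerC [X in _ + X]L2innerC !L2innerD (L2innerC g f); ring.
Qed.

Lemma L2inner_orth_le (w u v : L2 a b) : w = (u + v)%R -> L2inner a b u v = 0 ->
  L2inner a b u u <= L2inner a b w w.
Proof. by move=> -> O; rewrite L2inner_sqrD O mulr0 addr0 lerDl L2inner_ge0. Qed.

Lemma L2inner_NB (f : L2 a b) e : 0 <= e -> L2inner a b f f <= e ^+ 2 <-> NB a b f e.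
Proof.
move=> e0; have mf := measurable_L2 f.
have E : ((L2inner a b f f)%:E = \int[mu]_(x in `[a, b]) ((f x) ^+ 2)%:E)%E.
  rewrite /L2inner /Rintegral fineK; last first.
    by apply: integrable_fin_num => //; exact: L2_mul_integrable.
  rewrite -lebesgue_on_sqr//; apply: eq_integral => x _.
  by rewrite /= powR_mulrn// real_normK ?num_real// expr2.
split => [H|[_ _ H]].
  by split => //; [exact: measurable_funTS|rewrite -E lee_fin].
by rewrite -lee_fin E.
Qed.

Lemma lincombE (phi : nat -> L2 a b) m c x : lincomb phi m c x = \sum_(k < m) c k * phi k x.
Proof.
rewrite /lincomb; elim: m => [|m IH]; first by rewrite !big_ord0.
by rewrite !big_ord_recr/= -IH.
Qed.

Lemma orthproj_span (phi : nat -> L2 a b) m (f : L2 a b) :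
  spanL2 phi m (orthproj (spanL2 phi m) f).
Proof.
by rewrite /orthproj; case: xgetP => [p -> []//|_]; exists (fun=> 0);
  rewrite /lincomb big1// => i _; rewrite scale0r.
Qed.

(** A projection exists by Gram-Schmidt even for a degenerate form, so the default branch of [xget]
    is excluded. *)
Lemma orthproj_orth (phi : nat -> L2 a b) m (f v : L2 a b) : spanL2 phi m v ->
  L2inner a b (f - orthproj (spanL2 phi m) f)%R v = 0.
Proof.
move=> Vv; rewrite /orthproj; case: xgetP => [p -> [_ /(_ _ Vv)//]|N].
have [c Hc] := orth_projection_exists L2innerC L2innerD L2innerZ L2inner_ge0 phi m f.
exfalso; apply: (N (lincomb phi m c)); split; first by exists c.
move=> w [d ->]; rewrite L2innerC /lincomb.
rewrite (form_suml L2innerD L2innerZ _ (fun k => d k *: phi k)) big1// => k _.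
by rewrite L2innerZ L2innerC Hc ?mulr0.
Qed.

(** Pythagoras: f - v is the sum of f - p and of p - v, which lies in the span. *)
Lemma orthproj_best (phi : nat -> L2 a b) m (f : L2 a b) (c : nat -> R) e :
  NB a b (fun x => f x - lincomb phi m c x) e ->
  NB a b (fun x => f x - orthproj (spanL2 phi m) f x) e.
Proof.
move=> H; have e0 : 0 <= e by case: H.
set p := orthproj _ f; pose v := lincomb phi m c.
apply: (NB_ext (f := (f - p)%R : L2 a b)) => //; apply/L2inner_NB => //.
have Hv : L2inner a b (f - v)%R (f - v)%R <= e ^+ 2.
  by apply/L2inner_NB => //; apply: NB_ext H.
have [d pd] := orthproj_span phi m f; rewrite -/p in pd.
have Vpv : spanL2 phi m (p - v)%R.
  exists (fun k => d k - c k); rewrite pd /v /lincomb -sumrB.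
  by apply: eq_bigr => i _; rewrite scalerBl.
apply: le_trans Hv; apply: (L2inner_orth_le (v := (p - v)%R)); last exact: orthproj_orth.
by rewrite addrA subrK.
Qed.

End L2_bridge.

Section smooth_class_NB.
Context {R : realType}.
Notation mu := (@lebesgue_measure R).
Variables (a b : R).

Lemma ae_subset (P Q : R -> Prop) : (forall x, P x -> Q x) -> {ae mu, forall x, P x} ->
  {ae mu, forall x, Q x}.
Proof. by move=> PQ [N [mN N0 sub]]; exists N; split => // x /= nQ; apply: sub => /PQ. Qed.

Lemma measurable_wdiff r h (f : R -> R) : measurable_fun [set: R] f ->
  measurable_fun [set: R] (wdiff a b r h f).
Proof.
move=> mf; have mphi := measurable_step_weight a b (D := [set: R]).
have mk c : measurable_fun [set: R] (fun x => x + c * (h * step_weight a b x)).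
  by apply: measurable_funD => //; apply: measurable_funM => //; exact: measurable_funM.
pose P x := [/\ a <= x + r%:R / 2 * (h * step_weight a b x), x + r%:R / 2 * (h * step_weight a b x) <= b,
  a <= x + (- (r%:R / 2)) * (h * step_weight a b x) & x + (- (r%:R / 2)) * (h * step_weight a b x) <= b].
have -> : wdiff a b r h f = (fun x => if `[< P x >] then
    \sum_(i < r.+1) 'C(r, i)%:R * (-1) ^+ i * f (x + (i%:R - r%:R / 2) * (h * step_weight a b x)) else 0).
  apply/funext => x; rewrite /wdiff /sym_diff !in_itv/=.
  have -> : x + r%:R * (h * step_weight a b x) / 2 = x + r%:R / 2 * (h * step_weight a b x) by ring.
  have -> : x - r%:R * (h * step_weight a b x) / 2 = x + (- (r%:R / 2)) * (h * step_weight a b x) by ring.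
  congr (if _ then _ else _); apply/andP/asboolP.
    by move=> [/andP[? ?] /andP[? ?]].
  by move=> [-> -> -> ->].
apply: measurable_if; last first.
  apply: measurable_sum => i; apply: measurable_funM => //.
  by apply: measurable_funTS; apply: (measurableT_comp mf).
have -> : [set x | P x] =
   ([set x | a <= x + r%:R / 2 * (h * step_weight a b x)] `&` [set x | x + r%:R / 2 * (h * step_weight a b x) <= b]) `&`
   ([set x | a <= x + (- (r%:R / 2)) * (h * step_weight a b x)] `&` [set x | x + (- (r%:R / 2)) * (h * step_weight a b x) <= b]).
  by apply/seteqP; split => x /=; [move=> []|move=> [[? ?] [? ?]]; split].
by apply: measurableI; apply: measurableI; exact: measurable_le_set.
Qed.

Lemma wdiff_ae r h (f : R -> R) : 0 <= h ->
  {ae mu, forall x, x \in `[a, b] -> wdiff a b r h f x = wdiff_int a b r h f x}.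
Proof.
move=> h0; exists ([set a] `|` [set b]); split.
- by apply: measurableU.
- have m0 c : mu [set c] = 0 by exact: lebesgue_measure_set1.
  by rewrite measureU0//; exact: m0.
move=> x /= /not_implyP[xab N].
have [xa|xa] := eqVneq x a; [by left|have [xb|xb] := eqVneq x b; [by right|]].
exfalso; apply: N; apply: wdiff_intE => //; move: xab; rewrite !in_itv/= => /andP[h1 h2].
by rewrite !lt_neqAle h1 h2 xb eq_sym xa.
Qed.

Lemma NB_wdiffE r h (f : R -> R) e : 0 <= h -> measurable_fun [set: R] f ->
  NB a b (wdiff a b r h f) e <-> NB a b (wdiff_int a b r h f) e.
Proof.
move=> h0 mf; have AE := wdiff_ae r f h0; split => H.
  by apply: (NB_ae _ AE H); apply: measurable_funTS; exact: measurable_wdiff_int.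
apply: (NB_ae _ _ H); first by apply: measurable_funTS; exact: measurable_wdiff.
by apply: ae_subset AE => x E /E.
Qed.

(** A bound at each h, obtained by taking t = h, carries the same information as the supremum over h
    <= t, because t^alpha is increasing; [wdiff] and [wdiff_int] agree off the two endpoints. *)
Lemma smooth_classP (alpha C : R) (f : L2 a b) : 0 <= alpha -> 0 <= C ->
  smooth_class alpha C f <-> NB a b f C /\
    forall h, 0 < h -> NB a b (wdiff_int a b (intpart alpha).+1 h f) (C * h `^ alpha).
Proof.
move=> al0 C0; have mf := measurable_L2 f; set r := (intpart alpha).+1.
have Ch h : 0 <= C * h `^ alpha by rewrite mulr_ge0// powR_ge0.
split=> [[Hf Hm]|[Hf Hh]].
  split => [|h h0]; first exact/L2norm_NB.
  apply/(NB_wdiffE r _ (ltW h0) mf)/L2norm_NB => //; first exact: measurable_wdiff.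
  apply: le_trans (Hm h h0); apply: ereal_sup_ubound; exists h => //=.
  by rewrite h0 lexx.
split => [|t t0]; first exact/L2norm_NB.
apply: ge_ereal_sup => _ [h /= /andP[h0 ht] <-].
apply/L2norm_NB => //; first exact: measurable_wdiff.
apply/(NB_wdiffE r _ (ltW h0) mf); apply: NB_mono (Hh h h0).
by rewrite ler_wpM2l// ge0_ler_powR ?nnegrE// ltW.
Qed.

End smooth_class_NB.

Section indicator_estimates.
Context {R : realType}.
Notation mu := (@lebesgue_measure R).
Variables (a b u v : R).
Hypotheses (uv : u <= v) (au : a <= u) (vb : v <= b).

Lemma itv_sub x : x \in `[u, v] -> x \in `[a, b].
Proof. by rewrite !in_itv/= => /andP[h1 h2]; rewrite (le_trans au h1) (le_trans h2 vb). Qed.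

Lemma length_le_sqr (g : R -> R) e : (forall x, x \in `[u, v] -> g x = 1) ->
  NB a b g e -> v - u <= e ^+ 2.
Proof.
move=> g1 [mg e0 ge]; rewrite -lee_fin; apply: le_trans ge.
have -> : ((v - u)%:E = \int[mu]_(x in `[u, v]) ((g x) ^+ 2)%:E)%E.
  rewrite -(lebesgue_itvcc uv) -[LHS]mul1e -integral_cst//.
  by apply: eq_integral => x /[!inE] xuv; rewrite g1// expr1n.
apply: ge0_subset_integral => //.
- exact: msqr.
- by move=> x _; rewrite lee_fin sqr_ge0.
- by move=> x; exact: itv_sub.
Qed.

Lemma NB_supported (g : R -> R) eps : 0 <= eps -> measurable_fun `[a, b] g ->
  (forall x, x \in `[u, v] -> `|g x| <= eps) ->
  (forall x, x \in `[a, b] -> x \notin `[u, v] -> g x = 0) ->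
  NB a b g (Num.sqrt (v - u) * eps).
Proof.
move=> eps0 mg g1 g0.
have mg' : measurable_fun `[u, v] g by apply: measurable_funS mg => // x; exact: itv_sub.
have [_ _ H] := NB_sup uv eps0 mg' g1.
split => //; first exact: mulr_ge0 (sqrtr_ge0 _) eps0.
apply: le_trans H; rewrite [leRHS]integral_mkcond [leLHS]integral_mkcond.
rewrite le_eqVlt; apply/orP; left; apply/eqP; apply: eq_integral => x _.
rewrite !patchE; case: ifP => [/set_mem xab|xnab]; case: ifP => [/set_mem xuv|xnuv] //.
- by rewrite g0 ?expr0n//; apply/negP => xuv; rewrite mem_set in xnuv.
- by rewrite mem_set// in xnab; exact: itv_sub.
Qed.

End indicator_estimates.

(** * What the isometry imposes on [sigma] and [tau] *)

Section isometry.
Context {R : realType}.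
Notation mu := (@lebesgue_measure R).
Variables (a b a' b' : R).
Hypotheses (ab : a < b) (ab' : a' < b').
Variables (T : L2 a b -> L2 a' b') (sigma tau : R -> R).
Hypothesis T_norm : forall f : L2 a b, L2norm a' b' (T f) = L2norm a b f.
Hypothesis T_onto : forall h : L2 a' b', exists f : L2 a b, T f = h %[ae lebesgue_on a' b'].
Hypothesis TE : forall f : L2 a b,
  T f = (fun y => sigma y * f (tau y)) %[ae lebesgue_on a' b'].
Hypotheses (csigma : {within `[a', b'], continuous sigma}) (ctau : {within `[a', b'], continuous tau}).
Hypothesis tau_in : forall x, x \in `[a', b'] -> tau x \in `[a, b].

Notation wcomp f := (fun y => sigma y * f (tau y)).

Lemma measurable_wcomp (f : R -> R) : measurable_fun [set: R] f ->
  measurable_fun `[a', b'] (wcomp f).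
Proof.
move=> mf; apply: measurable_funM; first exact: within_meas.
by apply: (measurableT_comp mf); exact: within_meas.
Qed.

Lemma T_ae (f : L2 a b) : {ae mu, forall x, x \in `[a', b'] -> T f x = sigma x * f (tau x)}.
Proof. exact: ae_lebesgue_on (TE f). Qed.

Lemma NB_isometry (f : R -> R) e : measurable_fun [set: R] f -> NB a b f e ->
  NB a' b' (wcomp f) e.
Proof.
move=> mf Hf; have e0 : 0 <= e by case: Hf.
have [F FE] := L2_of_NB mf Hf.
have fE : (F : R -> R) = f by apply/funext.
have H : NB a' b' (T F) e.
  apply/L2norm_NB => //; first exact: measurable_L2.
  rewrite T_norm; apply/L2norm_NB => //; first exact: measurable_L2.
  by rewrite fE.
apply: NB_ae H; first exact: measurable_wcomp.
by apply: ae_subset (T_ae F) => x E /E ->; rewrite FE.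
Qed.

(** The a priori bound [e0] places f in L2, so that T can be applied; equality of norms then gives
    the bound [e]. *)
Lemma NB_isometry_inv (f : R -> R) e0 e : measurable_fun [set: R] f -> NB a b f e0 ->
  NB a' b' (wcomp f) e -> NB a b f e.
Proof.
move=> mf Hf0 Hf; have [F FE] := L2_of_NB mf Hf0.
have fE : (F : R -> R) = f by apply/funext.
have e1 : 0 <= e by case: Hf.
have mTF := measurable_L2 (T F).
suff : NB a b F e by rewrite fE.
apply/L2norm_NB => //; first exact: measurable_L2.
rewrite -T_norm; apply/L2norm_NB => //.
apply: NB_ae Hf; first exact: measurable_funTS.
by apply: ae_subset (T_ae F) => x E /E ->; rewrite FE.
Qed.

Lemma indicator_NB (S : set R) : measurable S -> NB a b (\1_S : R -> R) (Num.sqrt (b - a) * 1).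
Proof.
move=> mS; apply: NB_sup => //; first exact: ltW.
by move=> x _; rewrite indicE; case: (_ \in _); rewrite ?normr1 ?normr0.
Qed.

Lemma ball_segment (z d l r : R) : l < r -> z \in `[l, r] -> 0 < d -> exists p q : R,
  [/\ p < q, l <= p, q <= r & forall x, x \in `[p, q] -> `|z - x| < d].
Proof.
move=> lr; rewrite in_itv/= => /andP[lz zr] d0.
exists (Num.max l (z - d / 2)), (Num.min r (z + d / 2)); split.
- by rewrite gt_max !lt_min lr; apply/andP; split; apply/andP; split; lra.
- by rewrite le_max lexx.
- by rewrite ge_min lexx.
move=> x; rewrite in_itv/= ge_max le_min => /andP[/andP[_ h1] /andP[_ h2]].
by rewrite ltr_norml; apply/andP; split; lra.
Qed.

(* T annihilates the indicator of a set missed by [tau]. *)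
Lemma tau_onto z : z \in `[a, b] -> exists2 x, x \in `[a', b'] & tau x = z.
Proof.
move=> zab; apply: contrapT => N.
have cS : closed (tau @` `[a', b']%classic).
  by apply: compact_closed => //; apply: continuous_compact => //; exact: segment_compact.
have : nbhs z (~` (tau @` `[a', b']%classic)).
  apply: open_nbhs_nbhs; split; first exact: closed_openC.
  by move=> [x xab tx]; apply: N; exists x.
move=> /nbhs_ballP[d /= d0 Hd].
have [p [q [pq ap qb Hpq]]] := ball_segment ab zab d0.
pose f : R -> R := \1_(`[p, q]%classic).
have mf : measurable_fun [set: R] f by exact: measurable_indic.
have Hf := @indicator_NB `[p, q]%classic (measurable_itv _).
have f0 y : y \in `[a', b'] -> f (tau y) = 0.
  move=> yab; rewrite /f indicE memNset// => /= H.
  by apply: (Hd (tau y)); [rewrite -ball_normE /=; exact: Hpq|exists y].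
have H0 : NB a' b' (wcomp f) 0.
  by apply: NB_ext (NB0 a' b') => y yab; rewrite f0// mulr0.
have := length_le_sqr (ltW pq) ap qb _ (NB_isometry_inv mf Hf H0).
rewrite expr0n/= => /(_ _) H; suff : q - p <= 0 by rewrite subr_le0 leNgt pq.
by apply: H => x xpq; rewrite /f indicE mem_set.
Qed.

(* If [sigma] were at most [eps] on an interval [I], the isometry would give
   |tau(I)| <= eps^2 |I|, whereas |tau(I)| >= kappa |I|. *)
Lemma sigma_neq0 kappa y0 : 0 < kappa ->
  (forall x y, x \in `[a', b'] -> y \in `[a', b'] -> kappa * `|x - y| <= `|tau x - tau y|) ->
  y0 \in `[a', b'] -> sigma y0 != 0.
Proof.
move=> k0 Hk yab; apply/eqP => s0.
(* Half of the critical value sqrt(kappa): the comparison ends with v - u <= (v - u) / 4. *)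
pose eps := Num.sqrt kappa / 2; have eps0 : 0 < eps by rewrite divr_gt0// sqrtr_gt0.
have /nbhs_ballP[d /= d0 Hd] : \forall x \near y0, x \in `[a', b'] -> `|sigma x| < eps.
  have := (subspace_continuousP _ _).1 csigma y0 yab.
  move=> /cvgrPdist_lt/(_ eps eps0); rewrite near_withinE; apply: filterS => x H /H.
  by rewrite /from_subspace s0 sub0r normrN.
have [u [v [uv au vb Huv]]] := ball_segment ab' yab d0.
have suv x : x \in `[u, v] -> x \in `[a', b'] by exact: itv_sub.
pose S := tau @` `[u, v]%classic.
have mS : measurable S.
  apply: closed_measurable; apply: compact_closed => //; apply: continuous_compact.
    by apply: continuous_subspaceW ctau => x; exact: suv.
  exact: segment_compact.
pose f : R -> R := \1_S.
have mf : measurable_fun [set: R] f by exact: measurable_indic.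
have f1 y : y \in `[u, v] -> f (tau y) = 1.
  by move=> yuv; rewrite /f indicE mem_set//=; exists y.
have f0 y : y \in `[a', b'] -> y \notin `[u, v] -> f (tau y) = 0.
  move=> yab' yuv; rewrite /f indicE memNset//= => -[x xuv E].
  have := Hk x y (suv x xuv) yab'; rewrite E subrr normr0 pmulr_rle0// normr_le0 subr_eq0.
  by move=> /eqP xy; rewrite -xy xuv in yuv.
have H1 : NB a' b' (wcomp f) (Num.sqrt (v - u) * eps).
  apply: NB_supported => //; [exact: ltW|exact: ltW|exact: measurable_wcomp| |].
    move=> x xuv; rewrite f1// mulr1; apply: ltW.
    by have := Hd x; rewrite -ball_normE /=; apply; [exact: Huv|exact: suv].
  by move=> x xab nx; rewrite f0// mulr0.
have H2 := NB_isometry_inv mf (indicator_NB mS) H1.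
have H3 := NB_comp k0 (within_meas ctau) tau_in Hk H2.
have := length_le_sqr (ltW uv) au vb f1 H3.
have vu : 0 < v - u by rewrite subr_gt0.
have -> : (Num.sqrt kappa^-1 * (Num.sqrt (v - u) * eps)) ^+ 2 = (v - u) / 4.
  rewrite !exprMn !sqr_sqrtr ?invr_ge0 ?(ltW k0) ?(ltW vu)//.
  by field; rewrite gt_eqF.
lra.
Qed.

End isometry.

(** * Density of polynomials and the approximation class *)

Section affine_density.
Context {R : realType}.
Variables (a b a' b' : R).
Hypotheses (ab : a < b) (ab' : a' < b').

(** An affine change of variable preserves polynomials, which the inverse of T does not do in
    general. *)
Lemma poly_dense_affine : poly_dense a' b' -> poly_dense a b.
Proof.
move=> dense' g e Hg eps eps0.
have L0 : 0 < b - a by rewrite subr_gt0.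
have L'0 : 0 < b' - a' by rewrite subr_gt0.
pose k := (b - a) / (b' - a'); have k0 : 0 < k by exact: divr_gt0.
pose l x := a + (x - a') * k.
pose m x := a' + (x - a) / k.
have ml x : l (m x) = x by rewrite /l /m; field; rewrite gt_eqF.
have H1 : NB a' b' (fun x => g (l x)) (Num.sqrt k^-1 * e).
  apply: (NB_comp k0 _ _ _ Hg).
  - by apply: measurable_funD => //; apply: measurable_funM => //; exact: measurable_funB.
  - move=> x; rewrite !in_itv/= => /andP[x1 x2]; rewrite /l lerDl mulr_ge0 ?subr_ge0 ?(ltW k0)//=.
    rewrite -lerBrDl /k mulrA ler_pdivrMr// mulrC ler_wpM2l ?(ltW L0)//; lra.
  - move=> x y _ _; have -> : l x - l y = (x - y) * k by rewrite /l; ring.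
    by rewrite normrM (gtr0_norm k0) mulrC.
pose s := Num.sqrt k; have s0 : 0 < s by rewrite sqrtr_gt0.
have d0 : 0 < eps / s by rewrite divr_gt0.
have [P HP] := dense' _ _ H1 _ d0.
exists (P \Po ((a' - a / k)%:P + k^-1 *: 'X)).
have kV : 0 < k^-1 by rewrite invr_gt0.
have := @NB_comp R a' b' a b _ m k^-1 _ kV _ _ _ HP.
rewrite invrK -/s mulrC divfK ?gt_eqF// => H; apply: NB_ext (H _ _ _).
- move=> x _; rewrite ml horner_comp !hornerE; congr (_ - P.[_]).
  by rewrite /m; field; rewrite gt_eqF.
- by apply: measurable_funD => //; apply: measurable_funM => //; exact: measurable_funB.
- move=> x; rewrite !in_itv/= => /andP[x1 x2]; rewrite /m lerDl divr_ge0 ?subr_ge0 ?(ltW k0)//=.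
  rewrite -lerBrDl ler_pdivrMr// /k mulrC divfK ?gt_eqF//; lra.
- move=> x y _ _; have -> : m x - m y = (x - y) * k^-1 by rewrite /m; ring.
  by rewrite normrM (gtr0_norm kV) mulrC.
Qed.

End affine_density.

Section polynomial_isometry.
Context {R : realType}.
Notation mu := (@lebesgue_measure R).
Variables (a b a' b' : R).
Hypotheses (ab : a < b) (ab' : a' < b').
Variables (T : L2 a b -> L2 a' b') (sigma tau : R -> R).
Hypothesis T_norm : forall f : L2 a b, L2norm a' b' (T f) = L2norm a b f.
Hypothesis T_onto : forall h : L2 a' b', exists f : L2 a b, T f = h %[ae lebesgue_on a' b'].
Hypothesis TE : forall f : L2 a b,
  T f = (fun y => sigma y * f (tau y)) %[ae lebesgue_on a' b'].
Hypotheses (csigma : {within `[a', b'], continuous sigma}) (ctau : {within `[a', b'], continuous tau}).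
Hypothesis tau_in : forall x, x \in `[a', b'] -> tau x \in `[a, b].
Variable phi : nat -> L2 a b.
Hypothesis phi_total : L2total phi.
Hypothesis T_phi : forall k, exists p : {poly R},
  size p = k.+1 /\ T (phi k) = horner p %[ae lebesgue_on a' b'].

Notation wcomp f := (fun y => sigma y * f (tau y)).

Lemma ae_and (P Q : R -> Prop) : {ae mu, forall x, P x} -> {ae mu, forall x, Q x} ->
  {ae mu, forall x, P x /\ Q x}.
Proof.
move=> HP HQ; apply: (negligibleS _ (negligibleU HP HQ)) => x /= /not_andP[nP|nQ]; [by left|by right].
Qed.

(** Each [phi k] brings a null set off which its image is a polynomial; a finite combination meets
    finitely many of them. *)
Lemma lincomb_poly : exists2 p : nat -> {poly R}, (forall k, size (p k) = k.+1) &
  forall m c, {ae mu, forall x, x \in `[a', b'] ->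
    sigma x * lincomb phi m c (tau x) = (\sum_(k < m) c k *: p k).[x]}.
Proof.
have /choice[p Hp] := T_phi; exists p; first by move=> k; case: (Hp k).
move=> m c; elim: m => [|m IH].
  apply: aeW => x _; rewrite lincombE !big_ord0 horner0 mulr0 //.
have Hm := ae_lebesgue_on (Hp m).2; have Hm' := ae_lebesgue_on (TE (phi m)).
apply: ae_subset (ae_and IH (ae_and Hm Hm')) => x [H1 [H2 H3]] xab.
have := H1 xab; rewrite !lincombE !big_ord_recr/= hornerD hornerZ => <-.
by rewrite -(H2 xab) (H3 xab); ring.
Qed.

(** Pull g back by surjectivity of T, approximate it by combinations of the [phi k], and push
    forward: the images are polynomials and distances are preserved. *)
Lemma poly_dense_target : poly_dense a' b'.
Proof.
have [p sp Hp] := lincomb_poly.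
move=> g e Hg eps eps0; have [mg e0 _] := Hg.
pose g0 := g \_ (`[a', b']%classic).
have mg0 : measurable_fun [set: R] g0 by apply/(measurable_restrictT _ _).1.
have gE x : x \in `[a', b'] -> g x = g0 x by move=> xab; rewrite /g0 patchE mem_set.
have [G GE] := L2_of_NB mg0 (NB_ext gE Hg).
have [F TF] := T_onto G.
have [m [c Hc]] := phi_total F eps0.
have mD := measurable_L2 (lincomb phi m c - F)%R.
have H1 : NB a b (lincomb phi m c - F)%R eps by apply/L2norm_NB => //; [exact: ltW|exact: ltW].
have H2 := NB_isometry T_norm TE csigma ctau mD H1.
exists (\sum_(k < m) c k *: p k).
have mP : measurable_fun `[a', b'] (fun x => g x - (\sum_(k < m) c k *: p k).[x]).
  by apply: measurable_funB => //; exact: measurable_horner.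
apply: NB_ae mP _ (NB_opp H2).
apply: ae_subset (ae_and (Hp m c) (ae_and (ae_lebesgue_on TF) (ae_lebesgue_on (TE F)))) => x [E1 [E2 E3]] xab.
rewrite -(E1 xab) (gE x xab) -GE -(E2 xab) (E3 xab).
have -> : (lincomb phi m c - F)%R (tau x) = lincomb phi m c (tau x) - F (tau x) by [].
by ring.
Qed.

Lemma approx_class_EB alpha C (f : L2 a b) : 0 <= C -> approx_class phi alpha C f ->
  NB a b f C /\ forall m, (0 < m)%N -> EB a' b' (wcomp f) m (C * m%:R `^ (- alpha)).
Proof.
have [p sp Hp] := lincomb_poly; move=> C0 [Hf Hm]; have mf := measurable_L2 f.
split; first exact/L2norm_NB.
move=> m m0; have e0 : 0 <= C * m%:R `^ (- alpha) by rewrite mulr_ge0// powR_ge0.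
have [c pc] := orthproj_span phi m f.
have := Hm m m0; rewrite pc => H.
have mD := measurable_L2 (lincomb phi m c - f)%R.
have H1 : NB a b (lincomb phi m c - f)%R (C * m%:R `^ (- alpha)) by apply/L2norm_NB.
have H2 := NB_isometry T_norm TE csigma ctau mD H1.
move=> eps eps0; exists (\sum_(k < m) c k *: p k).
  rewrite (leq_trans (size_sum _ _ _))//; apply/bigmax_leqP => i _.
  by rewrite (leq_trans (size_scale_leq _ _))// sp.
apply: (NB_mono (e := C * m%:R `^ (- alpha))); first by rewrite lerDl ltW.
apply: NB_ae (NB_opp H2).
  apply: measurable_funB; last exact: measurable_horner.
  exact: measurable_wcomp.
apply: ae_subset (Hp m c) => x E xab; rewrite -(E xab).
have -> : (lincomb phi m c - f)%R (tau x) = lincomb phi m c (tau x) - f (tau x) by [].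
by ring.
Qed.

(** The p_k have degree exactly k, so every polynomial of degree < m is the image of a combination
    in V_m. A near-best polynomial yields such a combination, and the orthogonal projection is at
    least as close. *)
Lemma EB_approx_class alpha C (f : L2 a b) : NB a b f C ->
  (forall m, (0 < m)%N -> EB a' b' (wcomp f) m (C * m%:R `^ (- alpha))) ->
  approx_class phi alpha C f.
Proof.
have [p sp Hp] := lincomb_poly; move=> Hf HE; have C0 : 0 <= C by case: Hf.
have mf := measurable_L2 f.
split; first exact/L2norm_NB.
move=> m m0; have e0 : 0 <= C * m%:R `^ (- alpha) by rewrite mulr_ge0// powR_ge0.
apply/L2norm_NB => //; first exact: measurable_L2.
suff H : NB a b (fun x => f x - orthproj (spanL2 phi m) f x) (C * m%:R `^ (- alpha)).
  apply: NB_ext (NB_opp H) => x _.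
  have -> : (orthproj (spanL2 phi m) f - f)%R x = orthproj (spanL2 phi m) f x - f x by [].
  by ring.
apply: NB_eps => // eps eps0; have [P sP HP] := HE m m0 eps eps0.
(* Made monic, as the basis expansion requires. *)
pose q k := (lead_coef (p k))^-1 *: p k.
have pl k : lead_coef (p k) != 0 by rewrite lead_coef_eq0 -size_poly_gt0 sp.
have q1 k : (size (q k) <= k.+1)%N by rewrite (leq_trans (size_scale_leq _ _))// sp.
have q2 k : (q k)`_k = 1.
  by rewrite coefZ; have -> : (p k)`_k = lead_coef (p k); [rewrite lead_coefE sp|rewrite mulVf].
have [c Pc] := monic_basis_expand q1 q2 sP.
pose c' k := c k / lead_coef (p k).
have PE : P = \sum_(k < m) c' k *: p k.
  by rewrite Pc; apply: eq_bigr => i _; rewrite /q scalerA.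
apply: (orthproj_best (c := c')).
have [e1 He1] := NB_L2 (f - lincomb phi m c')%R.
have mD := measurable_L2 (f - lincomb phi m c')%R.
apply: (NB_isometry_inv T_norm TE mD He1).
apply: NB_ae HP; first exact: measurable_wcomp.
apply: ae_subset (Hp m c') => x E xab; rewrite PE -(E xab).
have -> : (f - lincomb phi m c')%R (tau x) = f (tau x) - lincomb phi m c' (tau x) by [].
by ring.
Qed.

End polynomial_isometry.

(** * Comparison of the two classes *)

Unset Implicit Arguments.

Theorem theorem2 (R : realType) (alpha : R) (halpha : 0 < alpha)
  (a b a' b' : R) (hab : a < b) (hab' : a' < b')
  (d : measure_display) (X : measurableType d)
  (zeta : {measure set X -> \bar R})
  (pi : R -> X -> R)
  (hpi : forall t, t \in `[a, b] -> is_density zeta (pi t))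
  (g : nat -> X -> R)
  (hg : forall k t, t \in `[a, b] ->
     zeta.-integrable setT (fun x => (g k x * pi t x)%:E))
  (phi : nat -> L2 a b)
  (hphi : forall k,
     phi k = (fun t => Rintegral zeta setT (fun x => g k x * pi t x))
       %[ae lebesgue_on a b])
  (hfree : L2free phi)
  (htotal : L2total phi)
  (T : L2 a b -> L2 a' b')
  (hT : linear_isometry_onto T)
  (hTphi : forall k, exists p : {poly R},
     size p = k.+1 /\ T (phi k) = horner p %[ae lebesgue_on a' b'])
  (sigma tau : R -> R)
  (hTdef : forall f : L2 a b,
     T f = (fun y => sigma y * f (tau y)) %[ae lebesgue_on a' b'])
  (hsigma_ge0 : forall y, y \in `[a', b'] -> 0 <= sigma y)
  (hsigma : Cn_on a' b' (intpart alpha).+1 sigma)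
  (htau_in : forall y, y \in `[a', b'] -> tau y \in `[a, b])
  (htau : Cn_on a' b' (intpart alpha).+1 tau)
  (hdtau : exists dtau : R -> R, has_derivative_on a' b' tau dtau /\
     forall y, y \in `[a', b'] -> dtau y != 0) :
  exists C1 C2 : R, [/\ 0 < C1, 0 < C2 &
    forall C : R, 0 < C ->
      approx_class phi alpha (C1 * C) `<=` smooth_class alpha C /\
      smooth_class alpha C `<=` approx_class phi alpha (C2 * C)].
Proof.
have [Tlin Tnorm Tonto] := hT.
set r := (intpart alpha).+1 in hsigma htau.
have alr : alpha < r%:R.
  by rewrite /r /intpart truncnS_gt.
have Csigma := Cn_on_Ck hsigma.
have [dtau [Hdtau Cdtau]] := htau.
have Ctau := Cn_on_Ck htau.
have {}Cdtau := Cn_on_Ck Cdtau.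
have csigma := Ck_cont Csigma; have ctau := Ck_cont Ctau.
have dtau0 y : y \in `[a', b'] -> dtau y != 0.
  move=> yab; have [dtau' [Hd' d'0]] := hdtau.
  by rewrite (has_derivative_unique hab' Hdtau Hd' yab) d'0.
have Dtau : der_on a' b' tau dtau.
  split => //; first exact: Ck_cont Cdtau.
  by move=> x xoo; exact: has_derivative_is_derive Hdtau xoo.
have tau_surj z : z \in `[a, b] -> exists2 x, x \in `[a', b'] & tau x = z.
  exact: (tau_onto hab Tnorm hTdef).
have [kappa [Lam [k0 L0 Hk HL]]] := tau_bilipschitz hab' Dtau dtau0.
have ends := tau_endpoints hab hab' Dtau dtau0 htau_in tau_surj.
have sigma0 y : y \in `[a', b'] -> sigma y != 0.
  exact: (sigma_neq0 hab hab' Tnorm hTdef csigma ctau htau_in k0 Hk).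
have dense' : poly_dense a' b'.
  exact: (poly_dense_target Tnorm Tonto hTdef csigma ctau htotal hTphi).
have dense := poly_dense_affine hab hab' dense'.
have [rho [Hrho rhoK Drho Crho]] := inverse_diffeo hab hab' Dtau Cdtau dtau0 htau_in tau_surj.
have rho_in z : z \in `[a, b] -> rho z \in `[a', b'] by move=> /Hrho[].
have Lip z w : z \in `[a, b] -> w \in `[a, b] -> Lam^-1 * `|z - w| <= `|rho z - rho w|.
  move=> zab wab; have [z1 z2] := Hrho z zab; have [w1 w2] := Hrho w wab.
  by rewrite -{1}z2 -{1}w2 ler_pdivrMl// HL.
have LV : 0 < Lam^-1 by rewrite invr_gt0.
have rho_surj x : x \in `[a', b'] -> exists2 z, z \in `[a, b] & rho z = x.
  by move=> xab; exists (tau x); [exact: htau_in|exact: rhoK].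
have drho0 z : z \in `[a, b] -> (dtau (rho z))^-1 != 0.
  by move=> zab; rewrite invr_neq0// dtau0// rho_in.
have ends' := tau_endpoints hab' hab Drho drho0 rho_in rho_surj.
have oo' := tau_interior hab' hab Drho drho0 rho_in rho_surj.
(* The inverse of T sends g to [sigma2] times g o rho, again a weighted composition of class C^r. *)
pose sigma2 z := (sigma (rho z))^-1.
have Csigma2 : Ck r a b sigma2.
  apply: CkV; first by move=> z zab; rewrite sigma0// rho_in.
  exact: Ck_comp Csigma Crho rho_in oo'.
have [K1 K10 HK1] := EB_weighted_comp hab hab' k0 Csigma Ctau htau_in Hk ends dense' halpha alr.
have [K2 K20 HK2] := EB_weighted_comp hab' hab LV Csigma2 Crho rho_in Lip ends' dense halpha alr.
have [Ka Ka0 HKa] := modulus_EB hab halpha alr dense.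
have [Kb Kb0 HKb] := EB_modulus_le hab halpha alr.
have pw m : 0 <= m%:R `^ (- alpha) by exact: powR_ge0.
(* C1 compensates the losses of the inverse of T ([K2]) and of the passage to the modulus ([Kb]); C2
   combines those of the direct inequality ([Ka]) and of T ([K1]). The added ones let the same
   constants bound the norm of f itself. *)
exists ((Kb + 1) * (K2 + 1))^-1, (K1 * (Ka + 1) + 1); split.
- by rewrite invr_gt0 mulr_gt0// addr_gt0.
- by rewrite addr_gt0// mulr_gt0// addr_gt0.
move=> C C0; split => f.
  set C1 := _^-1; have C10 : 0 < C1 by rewrite invr_gt0 mulr_gt0// addr_gt0.
  have E : (Kb + 1) * (K2 + 1) * C1 = 1 by rewrite mulfV// gt_eqF// mulr_gt0// addr_gt0.
  have D0 : 0 < C1 * C by exact: mulr_gt0.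
  move=> /(approx_class_EB Tnorm hTdef csigma ctau hTphi (ltW D0))[Hf HE].
  have HF := NB_isometry Tnorm hTdef csigma ctau (measurable_L2 f) Hf.
  have H2 m : (0 < m)%N -> EB a b f m ((K2 + 1) * (C1 * C) * m%:R `^ (- alpha)).
    move=> m0; apply: EB_ext (EB_mono (leqnn _) _ (HK2 _ _ D0 HF HE m m0)) => [z zab|].
      have [z1 z2] := Hrho z zab; rewrite /sigma2 z2 mulrA mulVf ?mul1r// sigma0//.
    by rewrite ler_wpM2r// ler_wpM2r ?(ltW D0)// lerDl.
  have A0 : 0 < (K2 + 1) * (C1 * C) by rewrite mulr_gt0// addr_gt0.
  have HfA : NB a b f ((K2 + 1) * (C1 * C)).
    by apply: NB_mono Hf; rewrite ler_peMl ?(ltW D0)// lerDr ltW.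
  have H3 := HKb f _ A0 HfA H2.
  have KE : (Kb + 1) * ((K2 + 1) * (C1 * C)) = C by rewrite !mulrA E mul1r.
  apply/smooth_classP; [exact: ltW|exact: ltW|split].
    apply: NB_mono HfA; rewrite -[leRHS]KE ler_peMl ?(ltW A0)// lerDr ltW//.
  move=> h h0; apply: NB_mono (H3 h h0).
  rewrite ler_wpM2r ?powR_ge0// -[leRHS]KE ler_wpM2r ?(ltW A0)// lerDl//.
move=> /(smooth_classP f (ltW halpha) (ltW C0))[Hf Hw].
have A0 : 0 < (Ka + 1) * C by rewrite mulr_gt0// addr_gt0.
have HfA : NB a b f ((Ka + 1) * C).
  by apply: NB_mono Hf; rewrite ler_peMl ?(ltW C0)// lerDr ltW.
have H1 m : (0 < m)%N -> EB a b f m ((Ka + 1) * C * m%:R `^ (- alpha)).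
  move=> m0; apply: EB_mono (leqnn _) _ (HKa f C C0 Hf (fun h h0 _ => Hw h h0) m m0).
  by rewrite ler_wpM2r// ler_wpM2r ?(ltW C0)// lerDl.
have H2 := HK1 _ _ A0 HfA H1.
apply: (EB_approx_class Tnorm hTdef csigma ctau hTphi).
  apply: NB_mono Hf; rewrite ler_peMl ?(ltW C0)// lerDr mulr_ge0 ?(ltW K10)//.
  by rewrite addr_ge0// ltW.
move=> m m0; apply: EB_mono (leqnn _) _ (H2 m m0).
rewrite ler_wpM2r// mulrA ler_wpM2r ?(ltW C0)// lerDl//.
Qed.
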